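(* There is an absolute constant $C>0$ such that the following holds. Let $N\in\mathbb{N}$ be square-free. Then for every even integer $k\geq C\max\{1,\omega(N)\}$ and every integer $m$ with $1\leq m\leq \frac{1}{32\pi^2}N(k-1)^2$ and $\gcd(m,N)=1$, one has $v_\infty\left(P_{k,m,N}\right)\leq 2N$; in particular $P_{k,m,N}\not\equiv0$.
   Context: $\omega(N)$ denotes the number of distinct prime factors of $N$. For positive integers $k,m,N$ with $k$ even, $P_{k,m,N}$ denotes the Poincaré series of weight $k$ and index $m$ at the cusp $i\infty$ for $\Gamma_0(N)=\{\begin{pmatrix}a&b\\c&d\end{pmatrix}\in \mathrm{SL}_2(\mathbb{Z}) : N\mid c\}$: $$P_{k,m,N}(z)=\sum_{\gamma\in\Gamma_\infty\backslash\Gamma_0(N)} j(\gamma,z)^{-k} e(m\gamma z),$$ where $\Gamma_\infty=\{\begin{pmatrix}1&*\\0&1\end{pmatrix}\in\mathrm{SL}_2(\mathbb{Z})\}$, $j(\begin{pmatrix}a&b\\c&d\end{pmatrix},z)=cz+d$ and $e(z)=e^{2\pi i z}$. It has a Fourier expansion $P_{k,m,N}(z)=\sum_{n\geq1} p_{k,N}(m;n)e(nz)$, and $v_\infty(f)$ denotes the order of vanishing of $f$ at the cusp $i\infty$, i.e. the least $n\ge 1$ with nonzero $n$-th Fourier coefficient. *)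

(* Defs.v *)
From Stdlib Require Import Reals ZArith Znumtheory List ClassicalEpsilon.
From Coquelicot Require Import Coquelicot.
Open Scope R_scope.

Definition omega (N : nat) : nat :=
  length (filter (fun p => if prime_dec (Z.of_nat p) then Nat.eqb (N mod p) 0 else false)
                 (seq 1 N)).

Definition squarefree (N : nat) : Prop :=
  forall p : nat, prime (Z.of_nat p) -> ~ Nat.divide (p * p) N.

(* e(z) = exp(2 pi i z) for complex z *)
Definition e (z : C) : C :=
  (exp (-2 * PI * Im z) * cos (2 * PI * Re z), exp (-2 * PI * Im z) * sin (2 * PI * Re z)).

Fixpoint Cpow (z : C) (n : nat) : C :=
  match n with O => RtoC 1 | S n' => Cmult z (Cpow z n') end.

Definition CSeries (a : nat -> C) : C :=
  (Series (fun n => Re (a n)), Series (fun n => Im (a n))).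

Definition Zsum (f : Z -> C) : C :=
  Cplus (CSeries (fun n => f (Z.of_nat n))) (CSeries (fun n => f (- Z.of_nat n - 1)%Z)).

Definition complete_row (c d : Z) : Z * Z :=
  epsilon (inhabits (0%Z, 0%Z)) (fun ab => (fst ab * d - snd ab * c = 1)%Z).

(* Coset Gamma_infty \ Gamma_0(N) <-> bottom row (c,d), gcd(c,d)=1, N | c
   (Gamma_infty contains only +(1 *;0 1), so (c,d) and (-c,-d) are distinct cosets).
   Term j(gamma,z)^(-k) e(m gamma z); e(m gamma z) does not depend on the choice of
   the top row since e is 1-periodic. *)
Definition poincare_term (k m N : nat) (z : C) (c d : Z) : C :=
  if (Z.eqb (c mod Z.of_nat N) 0 && Z.eqb (Z.gcd c d) 1)%bool then
    let ab := complete_row c d in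
    let j := Cplus (Cmult (RtoC (IZR c)) z) (RtoC (IZR d)) in
    Cmult (Cinv (Cpow j k))
          (e (Cmult (RtoC (INR m))
                    (Cdiv (Cplus (Cmult (RtoC (IZR (fst ab))) z) (RtoC (IZR (snd ab)))) j)))
  else RtoC 0.

Definition Poincare (k m N : nat) (z : C) : C :=
  Zsum (fun c => Zsum (fun d => poincare_term k m N z c d)).

Definition pcoef (k m N n : nat) : C :=
  let g := fun x : R => Cmult (Poincare k m N (x, 1)) (e (Cmult (RtoC (- INR n)) (x, 1))) in
  (RInt (fun x => Re (g x)) 0 1, RInt (fun x => Im (g x)) 0 1).

(* Main.v *)
Require Import Defs.
From Stdlib Require Import Reals ZArith Znumtheory List ClassicalEpsilon.
From Stdlib Require Import Lra Lia Permutation.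
From Coquelicot Require Import Coquelicot.
Open Scope R_scope.

(** Take [n = N], or [n = 2] when [m = N = 1]; then [N] divides [n] and [n <> m], so the diagonal
    term of the Fourier coefficient [p_{k,N}(m;n)] vanishes and only the rows [(c, d)] with
    [c = N j], [j <> 0], remain.  Unfolding the sum over [d] modulo [c] turns their contribution
    into a nonzero constant times [c^(-k) S(m,n;c) psi_(k-1)(4 pi^2 m n / c^2)], where [S] is a
    Kloosterman sum and [psi_nu(X) = sum_r (-X)^r / (r! (nu+r)!)].

    Since [N] divides [n], the Kloosterman sum splits over the residue classes mod [j] into sums
    [sum e(m t / N)] over [t] mod [N] with [j t + a] prime to [N].  These are multiplicative in the
    square-free number [N]: a prime factor [p] contributes a complete sum with one term removed, of
    modulus [1], if it does not divide [j], and a complete or empty sum, [0], otherwise.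
    Hence [|S(m,n;N)| = 1] and [|S(m,n;N j)| <= j].

    On the analytic side [psi_nu' = - psi_(nu+1)] and the three-term recurrence, run downwards in
    [nu], give [0 < psi_(nu+1) <= 2/(nu+1) psi_nu] in the range at hand, hence
    [psi_nu(X) >= exp(-2X/(nu+1)) / nu!].  With [X <= nu^2/8] this is at least
    [(3/4)^nu / nu!], which beats the sum over [j >= 2], of size [2^(-nu) / nu!].

    The common constant is a multiple of [int z^(-2) e(-nz) dz] along [Im z = 1].  Integration by
    parts links it to the same integral with exponent [S], the even integer nearest to [2 pi n];
    there the phase is nearly stationary at [x = 0], which makes the integral nonzero without
    any residue computation. *)

(** All rows with [c <> 0] share one factor, a power of [n] times the integral [kappa] of
    [z^(-2) e(-nz)], so only the ratios of the row contributions matter; [kappa] stays abstract and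
    has only to be nonzero. No contour is ever moved: [pcoef] integrates at height one, and every
    factor is expanded or differentiated on that line. Choosing [n] divisible by [N] replaces deep
    bounds for Kloosterman sums by an elementary evaluation: the part of the character carried by
    [n] then lives modulo [c / N]. At [c = N] and [n = N n'] the argument of [psi] is
    [4 pi^2 m n' / N], and for [n' = 1] the hypothesis on [m] says exactly that it is at most
    [(k-1)^2 / 8]. The top rows of the matrices come from [epsilon], so whatever is proved about
    them must be invariant under adding a multiple of the bottom row; periodicity in [d] and the
    symmetry [(c, d) -> (-c, -d)] need an argument for this reason. *)

Lemma C_eq (z w : C) : Re z = Re w -> Im z = Im w -> z = w.
Proof. destruct z, w; simpl; intros -> ->; reflexivity. Qed.

Lemma Defs_Cpow_eq (z : C) (n : nat) : Defs.Cpow z n = (z ^ n)%C.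
Proof. induction n as [|n IH]; simpl; [reflexivity | now rewrite IH]. Qed.

Lemma Im_le_Cmod (z : C) : Rabs (Im z) <= Cmod z.
Proof. eapply Rle_trans; [apply Rmax_r | apply Rmax_Cmod]. Qed.

Lemma Cmod_le_Re_Im (z : C) : Cmod z <= Rabs (Re z) + Rabs (Im z).
Proof.
  replace z with (RtoC (Re z) + Ci * RtoC (Im z))%C at 1.
  - eapply Rle_trans; [apply Cmod_triangle|].
    rewrite Cmod_mult, Cmod_Ci, !Cmod_R. lra.
  - destruct z as [a b]. apply C_eq; simpl; ring.
Qed.

(** * Finite sums and limits of complex sequences *)

Fixpoint csum {A : Type} (f : A -> C) (l : list A) : C :=
  match l with nil => RtoC 0 | a :: t => (f a + csum f t)%C end.

Lemma csum_ext {A} (f g : A -> C) l :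
  (forall a, In a l -> f a = g a) -> csum f l = csum g l.
Proof.
  induction l as [|a l IH]; simpl; intros H; [reflexivity|].
  rewrite H by auto. rewrite IH; [reflexivity | auto].
Qed.

Lemma csum_app {A} (f : A -> C) l l' : csum f (l ++ l') = (csum f l + csum f l')%C.
Proof.
  induction l as [|a l IH]; simpl; [now rewrite Cplus_0_l|].
  rewrite IH. ring.
Qed.

Lemma csum_map {A B} (h : A -> B) (f : B -> C) l :
  csum f (map h l) = csum (fun a => f (h a)) l.
Proof. induction l as [|a l IH]; simpl; [reflexivity | now rewrite IH]. Qed.

Lemma csum_plus {A} (f g : A -> C) l :
  csum (fun a => f a + g a)%C l = (csum f l + csum g l)%C.
Proof. induction l as [|a l IH]; simpl; [now rewrite Cplus_0_l | rewrite IH; ring]. Qed.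

Lemma csum_scal {A} (c : C) (f : A -> C) l :
  csum (fun a => c * f a)%C l = (c * csum f l)%C.
Proof. induction l as [|a l IH]; simpl; [ring | rewrite IH; ring]. Qed.

Lemma csum_zero {A} (f : A -> C) l :
  (forall a, In a l -> f a = 0%R) -> csum f l = 0%R.
Proof.
  induction l as [|a l IH]; simpl; intros H; [reflexivity|].
  rewrite H by auto. rewrite IH by auto. now rewrite Cplus_0_l.
Qed.

Lemma csum_perm {A} (f : A -> C) l l' : Permutation l l' -> csum f l = csum f l'.
Proof. induction 1; simpl; try congruence; ring. Qed.

Lemma csum_swap {A B} (f : A -> B -> C) l l' :
  csum (fun a => csum (f a) l') l = csum (fun b => csum (fun a => f a b) l) l'.
Proof.
  induction l as [|a l IH]; simpl.
  - symmetry; apply csum_zero; auto.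
  - rewrite IH, csum_plus. reflexivity.
Qed.

Lemma csum_Cmod_le {A} (f : A -> C) (K : R) l :
  (forall a, In a l -> Cmod (f a) <= K) -> Cmod (csum f l) <= INR (length l) * K.
Proof.
  induction l as [|a l IH]; intros H.
  - simpl. rewrite Cmod_0. lra.
  - simpl csum. simpl length. rewrite S_INR.
    eapply Rle_trans; [apply Cmod_triangle|].
    specialize (IH (fun b Hb => H b (or_intror Hb))).
    specialize (H a (or_introl eq_refl)). lra.
Qed.

Lemma csum_if {A} (b : A -> bool) (f : A -> C) l :
  csum (fun a => if b a then f a else RtoC 0) l = csum f (filter b l).
Proof.
  induction l as [|a l IH]; simpl; [reflexivity|].
  destruct (b a); simpl; rewrite IH; [reflexivity | ring].
Qed.

Lemma csum_list_prod {A B} (f : A * B -> C) l l' :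
  csum f (list_prod l l') = csum (fun a => csum (fun b => f (a, b)) l') l.
Proof.
  induction l as [|a l IH]; simpl; [reflexivity|].
  rewrite csum_app, csum_map, IH. reflexivity.
Qed.

Lemma csum_seq_S (f : nat -> C) n :
  csum f (seq 0 (S n)) = (csum f (seq 0 n) + f n)%C.
Proof. rewrite seq_S, csum_app. simpl. ring. Qed.

(** Euclidean division of the index by [c]. It groups the rows by the residue of [d], isolates the
    [c] divisible by the level, and sorts residues modulo [j * N] by their class modulo [j]. *)
Lemma csum_seq_mul (f : nat -> C) c M :
  csum f (seq 0 (c * M)) = csum (fun l => csum (fun i => f (c * l + i)%nat) (seq 0 c)) (seq 0 M).
Proof.
  induction M as [|M IH].
  - now rewrite Nat.mul_0_r.
  - rewrite csum_seq_S, <- IH, Nat.mul_succ_r, seq_app, csum_app. f_equal.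
    rewrite <- (csum_map (fun i => (c * M + i)%nat)). f_equal.
    generalize (c * M)%nat as s. intros s. simpl. clear.
    induction c as [|c IH]; [reflexivity|]. rewrite !seq_S, map_app, IH. reflexivity.
Qed.

Lemma csum_rev_seq (f : nat -> C) n :
  csum (fun i => f (n - 1 - i)%nat) (seq 0 n) = csum f (seq 0 n).
Proof.
  rewrite <- (csum_map (fun i => (n - 1 - i)%nat)).
  apply csum_perm, NoDup_Permutation_bis.
  - apply NoDup_map_NoDup_ForallPairs; [|apply seq_NoDup].
    intros a b Ha Hb. apply in_seq in Ha, Hb. lia.
  - now rewrite length_map.
  - intros a Ha. apply in_map_iff in Ha as [b [<- Hb]].
    apply in_seq in Hb. apply in_seq. lia.
Qed.

(** Componentwise, because [CSeries] and [pcoef] are defined through real and imaginary parts. *)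
Definition Clim (u : nat -> C) (l : C) : Prop :=
  is_lim_seq (fun n => Re (u n)) (Re l) /\ is_lim_seq (fun n => Im (u n)) (Im l).

Lemma Clim_ext u v l : (forall n, u n = v n) -> Clim u l -> Clim v l.
Proof.
  intros E [H1 H2]. split; (eapply is_lim_seq_ext; [|eassumption]);
  intros n; simpl; now rewrite E.
Qed.

Lemma Clim_unique u l l' : Clim u l -> Clim u l' -> l = l'.
Proof.
  intros [H1 H2] [H3 H4]. apply C_eq.
  - apply is_lim_seq_unique in H1, H3. rewrite H1 in H3. now injection H3.
  - apply is_lim_seq_unique in H2, H4. rewrite H2 in H4. now injection H4.
Qed.

Lemma Clim_const l : Clim (fun _ => l) l.
Proof. split; apply is_lim_seq_const. Qed.

Lemma Clim_plus u v l l' : Clim u l -> Clim v l' -> Clim (fun n => u n + v n)%C (l + l')%C.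
Proof. intros [H1 H2] [H3 H4]. split; simpl; now apply is_lim_seq_plus'. Qed.

Lemma Clim_mult u v l l' : Clim u l -> Clim v l' -> Clim (fun n => u n * v n)%C (l * l')%C.
Proof.
  intros [H1 H2] [H3 H4]. split; simpl.
  - apply is_lim_seq_minus'; now apply is_lim_seq_mult'.
  - apply is_lim_seq_plus'; now apply is_lim_seq_mult'.
Qed.

Lemma Clim_scal c u l : Clim u l -> Clim (fun n => c * u n)%C (c * l)%C.
Proof. intros H. apply Clim_mult; [apply Clim_const | exact H]. Qed.

Lemma Clim_csum {A} (u : A -> nat -> C) (v : A -> C) l :
  (forall a, In a l -> Clim (u a) (v a)) ->
  Clim (fun n => csum (fun a => u a n) l) (csum v l).
Proof.
  induction l as [|a l IH]; simpl; intros H; [apply Clim_const|].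
  apply Clim_plus; auto.
Qed.

Lemma Clim_0_le (u : nat -> C) (b : nat -> R) :
  (forall n, Cmod (u n) <= b n) -> is_lim_seq b 0 -> Clim u 0%R.
Proof.
  intros H Hb. split; simpl; apply is_lim_seq_abs_0;
  (eapply is_lim_seq_le_le; [|apply is_lim_seq_const|exact Hb]); intros n; simpl.
  - split; [apply Rabs_pos|]. eapply Rle_trans; [apply re_le_Cmod | apply H].
  - split; [apply Rabs_pos|]. eapply Rle_trans; [apply Im_le_Cmod | apply H].
Qed.

Lemma Clim_subseq u l (phi : nat -> nat) :
  (forall n, (phi n < phi (S n))%nat) -> Clim u l -> Clim (fun n => u (phi n)) l.
Proof.
  intros Hp [H1 H2].
  assert (F : filterlim phi eventually eventually) by now apply eventually_subseq.
  split.
  - exact (is_lim_seq_subseq _ _ phi F H1).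
  - exact (is_lim_seq_subseq _ _ phi F H2).
Qed.

Lemma Clim_Cmod u l : Clim u l -> is_lim_seq (fun n => Cmod (u n)) (Cmod l).
Proof.
  intros [H1 H2].
  assert (L : is_lim_seq (fun n => Cmod (u n - l)%C) 0).
  { eapply is_lim_seq_le_le with (u := fun _ => 0)
      (w := fun n => Rabs (Re (u n) - Re l) + Rabs (Im (u n) - Im l)).
    - intros n; split; [apply Cmod_ge_0 | apply (Cmod_le_Re_Im (u n - l)%C)].
    - apply is_lim_seq_const.
    - replace 0 with (Rabs (Re l - Re l) + Rabs (Im l - Im l))
        by (rewrite !Rminus_diag, Rabs_R0; lra).
      apply is_lim_seq_plus'; apply (is_lim_seq_abs _ (Finite _)), is_lim_seq_minus';
        trivial; apply is_lim_seq_const. }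
  apply is_lim_seq_ext with (u := fun n => (Cmod (u n) - Cmod l) + Cmod l); [intros; ring|].
  replace (Finite (Cmod l)) with (Finite (0 + Cmod l)) by (f_equal; ring).
  apply is_lim_seq_plus'; [|apply is_lim_seq_const].
  apply is_lim_seq_abs_0.
  eapply is_lim_seq_le_le; [|apply is_lim_seq_const|exact L].
  intros n; split; [apply Rabs_pos|].
  apply Rabs_le. split.
  - pose proof (Cmod_triangle (u n) (l - u n)%C) as T.
    replace (u n + (l - u n))%C with l in T by ring.
    replace (l - u n)%C with (- (u n - l))%C in T by ring.
    rewrite Cmod_opp in T. lra.
  - pose proof (Cmod_triangle l (u n - l)%C) as T.
    replace (l + (u n - l))%C with (u n) in T by ring. lra.
Qed.

Lemma Clim_Cmod_le u l K : Clim u l -> (forall n, Cmod (u n) <= K) -> Cmod l <= K.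
Proof.
  intros H HK. apply Clim_Cmod in H.
  exact (is_lim_seq_le _ _ (Cmod l) K HK H (is_lim_seq_const K)).
Qed.

(** * Absolutely convergent complex series *)

Definition Csummable (a : nat -> C) : Prop :=
  exists b : nat -> R, ex_series b /\ forall n, Cmod (a n) <= b n.

Lemma Csummable_Re a : Csummable a -> ex_series (fun n => Re (a n)).
Proof.
  intros [b [Hb H]]. apply (ex_series_le (V := R_CompleteNormedModule)) with b; trivial.
  intros n. eapply Rle_trans; [apply re_le_Cmod | apply H].
Qed.

Lemma Csummable_Im a : Csummable a -> ex_series (fun n => Im (a n)).
Proof.
  intros [b [Hb H]]. apply (ex_series_le (V := R_CompleteNormedModule)) with b; trivial.
  intros n. eapply Rle_trans; [apply Im_le_Cmod | apply H].
Qed.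

(** [sum_n a n] includes the term of index [n], whereas a sum over [seq 0 n] stops before it; the
    shift by one is absorbed here once for both components. *)
Lemma is_lim_seq_partial_sums (a : nat -> R) (u : nat -> R) :
  ex_series a -> u 0%nat = 0 -> (forall n, u (S n) = u n + a n) -> is_lim_seq u (Series a).
Proof.
  intros H H0 HS. apply Series_correct in H.
  apply is_lim_seq_incr_1, is_lim_seq_ext with (u := sum_n a); [|exact H].
  intros n. induction n as [|n IH].
  - rewrite sum_O, HS, H0. ring.
  - rewrite sum_Sn, IH, (HS (S n)). reflexivity.
Qed.

Lemma CSeries_lim (a : nat -> C) :
  Csummable a -> Clim (fun n => csum a (seq 0 n)) (CSeries a).
Proof.
  intros H. split; simpl; apply is_lim_seq_partial_sums.
  - now apply Csummable_Re.
  - reflexivity.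
  - intros n. rewrite csum_seq_S. reflexivity.
  - now apply Csummable_Im.
  - reflexivity.
  - intros n. rewrite csum_seq_S. reflexivity.
Qed.

Lemma CSeries_unique (a : nat -> C) l :
  Clim (fun n => csum a (seq 0 n)) l -> CSeries a = l.
Proof.
  intros [H1 H2].
  assert (E : forall (p : C -> R) (g : nat -> R), (forall x y, p (x + y)%C = p x + p y) -> p 0%R = 0 ->
     (forall n, g n = p (a n)) -> forall n, sum_n g n = p (csum a (seq 0 (S n)))).
  { intros p g Hp Hp0 Hg n. induction n as [|n IH].
    - rewrite sum_O, Hg, csum_seq_S. simpl. rewrite Hp, Hp0. ring.
    - rewrite sum_Sn, IH, (csum_seq_S a (S n)), Hp, Hg. reflexivity. }
  apply C_eq; simpl; apply is_series_unique.
  - apply is_lim_seq_incr_1 in H1.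
    change (is_lim_seq (sum_n (fun n => Re (a n))) (Re l)).
    eapply is_lim_seq_ext; [|exact H1]. intros n. symmetry. now apply E.
  - apply is_lim_seq_incr_1 in H2.
    change (is_lim_seq (sum_n (fun n => Im (a n))) (Im l)).
    eapply is_lim_seq_ext; [|exact H2]. intros n. symmetry. now apply E.
Qed.

Lemma CSeries_ext a b : (forall n, a n = b n) -> CSeries a = CSeries b.
Proof. intros H. unfold CSeries. f_equal; apply Series_ext; intros; now rewrite H. Qed.

Lemma Series_nonneg_partial_le (b : nat -> R) n :
  (forall n, 0 <= b n) -> ex_series b -> sum_n b n <= Series b.
Proof.
  intros Hb H. apply Series_correct in H.
  apply (is_lim_seq_incr_compare (sum_n b) (Series b)); [exact H|].
  intros m. rewrite sum_Sn. unfold plus; simpl. specialize (Hb (S m)). lra.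
Qed.

Lemma csum_Cmod_le_Series (a : nat -> C) (b : nat -> R) n :
  (forall n, Cmod (a n) <= b n) -> ex_series b -> Cmod (csum a (seq 0 n)) <= Series b.
Proof.
  intros H Hb.
  assert (P : forall n, 0 <= b n) by (intros i; eapply Rle_trans; [apply Cmod_ge_0 | apply H]).
  destruct n as [|n].
  - simpl. rewrite Cmod_0. pose proof (Series_nonneg_partial_le b 0 P Hb) as Q.
    rewrite sum_O in Q. specialize (P 0%nat). lra.
  - eapply Rle_trans; [|apply (Series_nonneg_partial_le b n P Hb)].
    induction n as [|n IH].
    + rewrite sum_O. simpl. rewrite Cplus_0_r. apply H.
    + rewrite (csum_seq_S a (S n)), sum_Sn. eapply Rle_trans; [apply Cmod_triangle|].
      apply Rplus_le_compat; [exact IH | apply H].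
Qed.

Lemma CSeries_Cmod_le (a : nat -> C) (b : nat -> R) :
  (forall n, Cmod (a n) <= b n) -> ex_series b -> Cmod (CSeries a) <= Series b.
Proof.
  intros H Hb. eapply Clim_Cmod_le.
  - apply CSeries_lim. now exists b.
  - intros n. now apply csum_Cmod_le_Series.
Qed.

Definition Zsummable (f : Z -> C) : Prop :=
  exists b : nat -> R, ex_series b /\
    forall n, Cmod (f (Z.of_nat n)) <= b n /\ Cmod (f (- Z.of_nat n - 1)%Z) <= b n.

Lemma Zsummable_pos f : Zsummable f -> Csummable (fun n => f (Z.of_nat n)).
Proof. intros [b [Hb H]]. exists b. split; trivial. apply H. Qed.

Lemma Zsummable_neg f : Zsummable f -> Csummable (fun n => f (- Z.of_nat n - 1)%Z).
Proof. intros [b [Hb H]]. exists b. split; trivial. apply H. Qed.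

Lemma Zsum_lim f : Zsummable f ->
  Clim (fun M => csum (fun i => f (Z.of_nat i)) (seq 0 M)
                 + csum (fun i => f (- Z.of_nat i - 1)%Z) (seq 0 M))%C (Zsum f).
Proof.
  intros H. apply Clim_plus; apply CSeries_lim; [now apply Zsummable_pos | now apply Zsummable_neg].
Qed.

Lemma Zsum_ext f g : (forall d, f d = g d) -> Zsum f = Zsum g.
Proof. intros H. unfold Zsum. f_equal; apply CSeries_ext; intros; apply H. Qed.

Lemma CSeries_S a : Csummable a -> CSeries a = (a 0%nat + CSeries (fun n => a (S n)))%C.
Proof.
  intros H. apply C_eq; simpl.
  - apply Series_incr_1. now apply Csummable_Re.
  - apply Series_incr_1. now apply Csummable_Im.
Qed.

(** The halves of [Zsum] start at [0] and at [-1], so reflection moves the term at [0] from one half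
    to the other; splitting off first terms compensates for this. *)
Lemma Zsum_opp f : Zsummable f -> Zsum (fun d => f (- d)%Z) = Zsum f.
Proof.
  intros H. unfold Zsum.
  rewrite (CSeries_S (fun n => f (Z.of_nat n)) (Zsummable_pos f H)).
  assert (E : CSeries (fun n => f (- Z.of_nat n)%Z)
     = (f 0%Z + CSeries (fun n => f (- Z.of_nat n - 1)%Z))%C).
  { rewrite CSeries_S.
    - f_equal. apply CSeries_ext. intros n. f_equal. lia.
    - destruct H as [b [Hb H]]. exists (fun n => match n with O => Cmod (f 0%Z) | S n => b n end).
      split.
      + now apply ex_series_incr_1.
      + intros [|n]; [apply Rle_refl|].
        replace (- Z.of_nat (S n))%Z with (- Z.of_nat n - 1)%Z by lia. apply H. }
  rewrite E. rewrite (CSeries_ext (fun n => f (- (- Z.of_nat n - 1))%Z) (fun n => f (Z.of_nat (S n)))).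
  - simpl Z.of_nat. ring.
  - intros n. f_equal. lia.
Qed.

Lemma Zsum_even f : Zsummable f -> (forall c, f (- c)%Z = f c) -> f 0%Z = 0%R ->
  Zsum f = (2%R * CSeries (fun n => f (Z.of_nat (S n))))%C.
Proof.
  intros H Hev H0. unfold Zsum.
  rewrite (CSeries_S (fun n => f (Z.of_nat n)) (Zsummable_pos f H)).
  rewrite (CSeries_ext (fun n => f (- Z.of_nat n - 1)%Z) (fun n => f (Z.of_nat (S n)))).
  - change (Z.of_nat 0) with 0%Z. rewrite H0. ring.
  - intros n. rewrite <- Hev. f_equal. lia.
Qed.

(** * Calculus of complex-valued functions of a real variable *)

(** Componentwise, so that [is_derive] and [auto_derive] do the work; the rules below restore
    complex notation. *)
Definition CD (f : R -> C) (x : R) (l : C) : Prop :=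
  is_derive (fun t => Re (f t)) x (Re l) /\ is_derive (fun t => Im (f t)) x (Im l).

Lemma CD_eq f x l l' : CD f x l -> l = l' -> CD f x l'.
Proof. now intros H <-. Qed.

Lemma CD_ext f g x l : (forall t, f t = g t) -> CD f x l -> CD g x l.
Proof.
  intros E [H1 H2].
  split; (eapply is_derive_ext; [|eassumption]); intros t; simpl; now rewrite E.
Qed.

Lemma CD_const c x : CD (fun _ => c) x 0%R.
Proof. split; simpl; apply (is_derive_const (V := R_NormedModule)). Qed.

Lemma CD_line y x : CD (fun t => (t, y)) x 1%R.
Proof.
  split; simpl; [apply (is_derive_id (K := R_AbsRing)) | apply (is_derive_const (V := R_NormedModule))].
Qed.

Lemma CD_plus f g x l l' : CD f x l -> CD g x l' -> CD (fun t => f t + g t)%C x (l + l')%C.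
Proof. intros [H1 H2] [H3 H4]; split; simpl; apply (is_derive_plus (V := R_NormedModule)); assumption. Qed.

Lemma CD_mult f g x l l' : CD f x l -> CD g x l' ->
  CD (fun t => f t * g t)%C x (l * g x + f x * l')%C.
Proof.
  intros [H1 H2] [H3 H4].
  pose proof (fun F G dF dG (a : is_derive F x dF) (b : is_derive G x dG) =>
    is_derive_mult (K := R_AbsRing) F G x dF dG a b Rmult_comm) as M.
  split; simpl.
  - eapply (eq_ind _ (is_derive _ x)).
    + exact (is_derive_minus (V := R_NormedModule) _ _ x _ _ (M _ _ _ _ H1 H3) (M _ _ _ _ H2 H4)).
    + unfold minus, plus, opp, mult; simpl. unfold Re, Im. ring.
  - eapply (eq_ind _ (is_derive _ x)).
    + exact (is_derive_plus (V := R_NormedModule) _ _ x _ _ (M _ _ _ _ H1 H4) (M _ _ _ _ H2 H3)).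
    + unfold plus, mult; simpl. unfold Re, Im. ring.
Qed.

Lemma CD_scal c f x l : CD f x l -> CD (fun t => c * f t)%C x (c * l)%C.
Proof.
  intros H. eapply CD_eq; [apply CD_mult; [apply CD_const | exact H] |]. cbv beta; ring.
Qed.

Lemma Cmod2_pos (z : C) : z <> 0%R -> 0 < Re z ^ 2 + Im z ^ 2.
Proof.
  intros H. rewrite <- Cmod2_alt. apply pow_lt. now apply Cmod_gt_0.
Qed.

Lemma is_derive_inv_parts (F G : R -> R) x dF dG :
  is_derive F x dF -> is_derive G x dG -> 0 < F x ^ 2 + G x ^ 2 ->
  is_derive (fun t => F t / (F t ^ 2 + G t ^ 2)) x
    ((dF * (G x ^ 2 - F x ^ 2) - 2 * F x * G x * dG) / (F x ^ 2 + G x ^ 2) ^ 2) /\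
  is_derive (fun t => - G t / (F t ^ 2 + G t ^ 2)) x
    ((dG * (G x ^ 2 - F x ^ 2) + 2 * F x * G x * dF) / (F x ^ 2 + G x ^ 2) ^ 2).
Proof.
  intros H1 H2 H0.
  assert (D1 := is_derive_unique _ _ _ H1). assert (D2 := is_derive_unique _ _ _ H2).
  assert (E1 := ex_intro _ _ H1 : ex_derive F x). assert (E2 := ex_intro _ _ H2 : ex_derive G x).
  split; (auto_derive; [repeat split; trivial; lra|]);
  change (Derive (fun x0 : R => F x0) x) with (Derive F x);
  change (Derive (fun x0 : R => G x0) x) with (Derive G x);
  rewrite D1, D2; field; lra.
Qed.

Lemma CD_inv f x l : CD f x l -> f x <> 0%R -> CD (fun t => / f t)%C x (- l / (f x * f x))%C.
Proof.
  intros [H1 H2] H0.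
  assert (E : (- l / (f x * f x))%C = (- l * (/ f x * / f x))%C) by (field; exact H0).
  apply Cmod2_pos in H0.
  rewrite E. clear E.
  destruct (is_derive_inv_parts _ _ x _ _ H1 H2 H0) as [K1 K2].
  split.
  - eapply (eq_ind _ (is_derive _ x)); [exact K1|].
    simpl. unfold Re, Im in *. field. lra.
  - eapply (eq_ind _ (is_derive _ x)); [exact K2|].
    simpl. unfold Re, Im in *. field. lra.
Qed.

Lemma CD_pow f x l n : CD f x l ->
  CD (fun t => f t ^ n)%C x (RtoC (INR n) * f x ^ (pred n) * l)%C.
Proof.
  intros H. induction n as [|n IH].
  - simpl. eapply CD_eq; [apply CD_const|]. ring.
  - simpl pred. eapply CD_eq; [exact (CD_mult _ _ _ _ _ H IH)|].
    rewrite S_INR, RtoC_plus. destruct n; simpl pred.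
    + simpl. ring.
    + rewrite !Cpow_S. ring.
Qed.

Definition twopii : C := (0, 2 * PI).

Lemma is_derive_e_parts (F G : R -> R) x dF dG :
  is_derive F x dF -> is_derive G x dG ->
  is_derive (fun t => exp (-2 * PI * G t) * cos (2 * PI * F t)) x
    (exp (-2 * PI * G x) * (-2 * PI * dG * cos (2 * PI * F x) - 2 * PI * dF * sin (2 * PI * F x))) /\
  is_derive (fun t => exp (-2 * PI * G t) * sin (2 * PI * F t)) x
    (exp (-2 * PI * G x) * (-2 * PI * dG * sin (2 * PI * F x) + 2 * PI * dF * cos (2 * PI * F x))).
Proof.
  intros H1 H2.
  assert (D1 := is_derive_unique _ _ _ H1). assert (D2 := is_derive_unique _ _ _ H2).
  assert (E1 := ex_intro _ _ H1 : ex_derive F x). assert (E2 := ex_intro _ _ H2 : ex_derive G x).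
  split; (auto_derive; [repeat split; trivial; lra|]);
  change (Derive (fun x0 : R => F x0) x) with (Derive F x);
  change (Derive (fun x0 : R => G x0) x) with (Derive G x);
  rewrite D1, D2; ring.
Qed.

Lemma CD_e f x l : CD f x l -> CD (fun t => e (f t)) x (twopii * l * e (f x))%C.
Proof.
  intros [H1 H2].
  destruct (is_derive_e_parts _ _ x _ _ H1 H2) as [K1 K2].
  split.
  - eapply (eq_ind _ (is_derive _ x)); [exact K1|].
    unfold twopii, e; simpl. unfold Re, Im in *. ring.
  - eapply (eq_ind _ (is_derive _ x)); [exact K2|].
    unfold twopii, e; simpl. unfold Re, Im in *. ring.
Qed.

Lemma e_plus z w : e (z + w)%C = (e z * e w)%C.
Proof.
  destruct z as [a b], w as [c d]. unfold e; simpl.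
  replace (-2 * PI * (b + d)) with (-2 * PI * b + -2 * PI * d) by ring.
  replace (2 * PI * (a + c)) with (2 * PI * a + 2 * PI * c) by ring.
  rewrite exp_plus, cos_plus, sin_plus. apply C_eq; simpl; ring.
Qed.

Lemma e_0 : e 0%R = 1%R.
Proof. unfold e; simpl. rewrite !Rmult_0_r, exp_0, cos_0, sin_0. apply C_eq; simpl; ring. Qed.

Lemma Cmod_e z : Cmod (e z) = exp (-2 * PI * Im z).
Proof.
  unfold e, Cmod; simpl.
  match goal with |- sqrt ?a = exp ?b => replace a with ((exp b) ^ 2) end.
  - rewrite sqrt_pow2; [reflexivity | left; apply exp_pos].
  - pose proof (sin2_cos2 (2 * PI * Re z)) as T. unfold Rsqr in T.
    match goal with |- ?E ^ 2 = _ => transitivity (E ^ 2 * (sin (2 * PI * Re z) * sin (2 * PI * Re z) + cos (2 * PI * Re z) * cos (2 * PI * Re z))); [rewrite T; ring | ring] end.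
Qed.

Lemma e_nz z : e z <> 0%R.
Proof. apply Cmod_gt_0. rewrite Cmod_e. apply exp_pos. Qed.

Lemma cos_sin_2PI_Z (k : Z) : cos (2 * PI * IZR k) = 1 /\ sin (2 * PI * IZR k) = 0.
Proof.
  assert (P : forall n : nat, cos (2 * PI * INR n) = 1 /\ sin (2 * PI * INR n) = 0).
  { intros n. replace (2 * PI * INR n) with (0 + 2 * INR n * PI) by ring.
    rewrite cos_period, sin_period, cos_0, sin_0. auto. }
  destruct (Z_le_gt_dec 0 k) as [H|H].
  - specialize (P (Z.to_nat k)). rewrite INR_IZR_INZ, Z2Nat.id in P; trivial.
  - specialize (P (Z.to_nat (- k))). rewrite INR_IZR_INZ, Z2Nat.id, opp_IZR in P by lia.
    replace (2 * PI * - IZR k) with (- (2 * PI * IZR k)) in P by ring.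
    rewrite cos_neg, sin_neg in P. destruct P; split; lra.
Qed.

Lemma e_Z (k : Z) : e (RtoC (IZR k)) = 1%R.
Proof.
  unfold e; simpl. destruct (cos_sin_2PI_Z k) as [-> ->].
  rewrite Rmult_0_r, exp_0. apply C_eq; simpl; ring.
Qed.

Lemma e_plus_Z z (k : Z) : e (z + RtoC (IZR k))%C = e z.
Proof. rewrite e_plus, e_Z. ring. Qed.

Lemma Cmod_e_R t : Cmod (e (RtoC t)) = 1.
Proof. rewrite Cmod_e. simpl. now rewrite Rmult_0_r, exp_0. Qed.

Definition Ccont (f : R -> C) : Prop :=
  forall x, continuous (fun t => Re (f t)) x /\ continuous (fun t => Im (f t)) x.

Lemma CD_Ccont f : (forall x, exists l, CD f x l) -> Ccont f.
Proof.
  intros H x. destruct (H x) as [l [H1 H2]].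
  split; apply (ex_derive_continuous (V := R_NormedModule)); eexists; eassumption.
Qed.

Definition CInt (f : R -> C) (a b : R) : C :=
  (RInt (fun x => Re (f x)) a b, RInt (fun x => Im (f x)) a b).

Definition Cint (f : R -> C) (a b : R) : Prop :=
  ex_RInt (fun x => Re (f x)) a b /\ ex_RInt (fun x => Im (f x)) a b.

Lemma Ccont_Cint f a b : Ccont f -> Cint f a b.
Proof.
  intros H. split; apply (ex_RInt_continuous (V := R_CompleteNormedModule)); intros x _.
  - exact (proj1 (H x)).
  - exact (proj2 (H x)).
Qed.

Lemma CInt_FTC F f a b : (forall x, CD F x (f x)) -> Ccont f -> CInt f a b = (F b - F a)%C.
Proof.
  intros H Hf. apply C_eq; simpl; apply is_RInt_unique.
  - apply (is_RInt_derive (V := R_CompleteNormedModule) (fun t => Re (F t))); intros; [exact (proj1 (H x)) | exact (proj1 (Hf x))].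
  - apply (is_RInt_derive (V := R_CompleteNormedModule) (fun t => Im (F t))); intros; [exact (proj2 (H x)) | exact (proj2 (Hf x))].
Qed.

Lemma CInt_ext f g a b : a <= b -> (forall x, a <= x <= b -> f x = g x) -> CInt f a b = CInt g a b.
Proof.
  intros Hab E. unfold CInt. f_equal; apply RInt_ext;
  rewrite Rmin_left, Rmax_right by lra; intros; rewrite E; trivial; lra.
Qed.

Lemma CInt_plus f g a b : Cint f a b -> Cint g a b ->
  CInt (fun x => f x + g x)%C a b = (CInt f a b + CInt g a b)%C.
Proof.
  intros [H1 H2] [H3 H4]. apply C_eq; simpl.
  - exact (RInt_plus (V := R_CompleteNormedModule) _ _ a b H1 H3).
  - exact (RInt_plus (V := R_CompleteNormedModule) _ _ a b H2 H4).
Qed.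

Lemma is_RInt_Cscal c f a b : Cint f a b ->
  is_RInt (fun x => Re (c * f x)%C) a b (Re (c * CInt f a b)%C) /\
  is_RInt (fun x => Im (c * f x)%C) a b (Im (c * CInt f a b)%C).
Proof.
  intros [H1 H2]. apply (RInt_correct (V := R_CompleteNormedModule)) in H1, H2. split; simpl.
  - apply (is_RInt_minus (V := R_NormedModule)); apply (is_RInt_scal (V := R_NormedModule)); assumption.
  - apply (is_RInt_plus (V := R_NormedModule)); apply (is_RInt_scal (V := R_NormedModule)); assumption.
Qed.

Lemma CInt_scal c f a b : Cint f a b -> CInt (fun x => c * f x)%C a b = (c * CInt f a b)%C.
Proof.
  intros H. destruct (is_RInt_Cscal c f a b H) as [H1 H2].
  apply C_eq; apply is_RInt_unique; assumption.
Qed.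

Lemma CInt_Chasles f a b c : Cint f a b -> Cint f b c -> (CInt f a b + CInt f b c)%C = CInt f a c.
Proof.
  intros [H1 H2] [H3 H4]. apply C_eq; simpl.
  - exact (RInt_Chasles (V := R_CompleteNormedModule) _ a b c H1 H3).
  - exact (RInt_Chasles (V := R_CompleteNormedModule) _ a b c H2 H4).
Qed.

Lemma CInt_shift f v a b : Ccont f -> CInt (fun x => f (x + v)) a b = CInt f (a + v) (b + v).
Proof.
  intros H.
  assert (K : forall g : R -> R, (forall x, continuous g x) ->
     RInt (fun x => g (x + v)) a b = RInt g (a + v) (b + v)).
  { intros g Hg.
    pose proof (RInt_comp_lin (V := R_CompleteNormedModule) g 1 v a b) as E.
    rewrite !Rmult_1_l in E. rewrite <- E.
    - apply RInt_ext. intros x _. unfold scal; simpl. unfold mult; simpl.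
      rewrite !Rmult_1_l. reflexivity.
    - apply (ex_RInt_continuous (V := R_CompleteNormedModule)). intros; apply Hg. }
  apply C_eq; simpl.
  - apply (K (fun x => Re (f x))). apply H.
  - apply (K (fun x => Im (f x))). apply H.
Qed.

(** Real and imaginary parts are bounded separately, which costs the factor [2]. The bound only
    serves domination and limits, never the final comparison. *)
Lemma CInt_Cmod_le f (g : R -> R) a b : a <= b -> Cint f a b -> ex_RInt g a b ->
  (forall x, a <= x <= b -> Cmod (f x) <= g x) -> Cmod (CInt f a b) <= 2 * RInt g a b.
Proof.
  intros Hab [H1 H2] Hg H.
  assert (K : forall h : R -> R, ex_RInt h a b -> (forall x, Rabs (h x) <= Cmod (f x)) ->
     Rabs (RInt h a b) <= RInt g a b).
  { intros h Hh Hle. eapply Rle_trans; [now apply abs_RInt_le|].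
    apply RInt_le; trivial.
    - now apply (ex_RInt_norm).
    - intros x Hx. eapply Rle_trans; [apply Hle | apply H; lra]. }
  eapply Rle_trans; [apply Cmod_le_Re_Im|].
  pose proof (K _ H1 (fun x => re_le_Cmod (f x))). pose proof (K _ H2 (fun x => Im_le_Cmod (f x))).
  simpl. lra.
Qed.

Lemma CInt_Cmod_le_const f K a b : a <= b -> Cint f a b ->
  (forall x, a <= x <= b -> Cmod (f x) <= K) -> Cmod (CInt f a b) <= 2 * ((b - a) * K).
Proof.
  intros Hab Hf H.
  eapply Rle_trans; [apply (CInt_Cmod_le f (fun _ => K)); trivial; apply ex_RInt_const|].
  rewrite RInt_const. apply Rle_refl.
Qed.

(** * Termwise integration *)

Lemma Series_tail_lim (b : nat -> R) : ex_series b ->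
  is_lim_seq (fun n => Series b - sum_n b n) 0.
Proof.
  intros H. apply Series_correct in H.
  replace (Finite 0) with (Finite (Series b - Series b)) by (f_equal; ring).
  apply is_lim_seq_minus'; [apply is_lim_seq_const | exact H].
Qed.

Lemma Series_tail_le (a b : nat -> R) n : (forall n, Rabs (a n) <= b n) -> ex_series b ->
  Rabs (Series a - sum_n a n) <= Series b - sum_n b n.
Proof.
  intros H Hb.
  assert (Ha : ex_series (fun n => Rabs (a n))).
  { apply (ex_series_le (V := R_CompleteNormedModule)) with b; trivial.
    intros i. unfold norm; simpl. unfold abs; simpl. now rewrite Rabs_Rabsolu. }
  assert (E : forall u, ex_series u -> Series u - sum_n u n = Series (fun i => u (S n + i)%nat)).
  { intros u Hu. rewrite (Series_incr_n u (S n)); [|lia|exact Hu].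
    rewrite sum_n_Reals. simpl pred. ring. }
  rewrite !E; trivial; [|now apply ex_series_Rabs].
  eapply Rle_trans; [apply Series_Rabs; now apply (ex_series_incr_n (fun n => Rabs (a n)) (S n))|].
  apply Series_le; [|now apply (ex_series_incr_n b (S n))].
  intros i. split; [apply Rabs_pos | apply H].
Qed.

(* Weierstrass M-test.  [filterlim_RInt] asks for uniform convergence on the whole line, hence the
   clamping of the variable to the interval. *)
Lemma is_RInt_Series (f : nat -> R -> R) (b : nat -> R) u v : u <= v ->
  (forall n x, u <= x <= v -> Rabs (f n x) <= b n) -> ex_series b ->
  (forall n, ex_RInt (f n) u v) ->
  is_RInt (fun x => Series (fun n => f n x)) u v (Series (fun n => RInt (f n) u v)).
Proof.
  intros Huv Hf Hb Hi.
  set (cl := fun x => Rmax u (Rmin v x)).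
  assert (Hcl : forall x, u <= cl x <= v).
  { intros x. unfold cl. split; [apply Rmax_l|]. apply Rmax_lub; [lra | apply Rmin_l]. }
  assert (Hid : forall x, u <= x <= v -> cl x = x).
  { intros x Hx. unfold cl. rewrite Rmin_right, Rmax_right by lra. reflexivity. }
  assert (Hib : forall n, is_RInt (fun x => f n (cl x)) u v (RInt (f n) u v)).
  { intros n. apply is_RInt_ext with (f n).
    - rewrite Rmin_left, Rmax_right by lra. intros x Hx. rewrite Hid by lra. reflexivity.
    - apply (RInt_correct (V := R_CompleteNormedModule)), Hi. }
  destruct (filterlim_RInt (V := R_CompleteNormedModule)
    (fun n x => sum_n (fun i => f i (cl x)) n) u v eventually _
    (fun x => Series (fun n => f n (cl x)))
    (fun n => sum_n (fun i => RInt (f i) u v) n)) as [I [HI1 HI2]].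
  - intros n. induction n as [|n IH].
    + rewrite sum_O. apply is_RInt_ext with (fun x => f 0%nat (cl x)); [|apply Hib].
      intros. now rewrite sum_O.
    + rewrite sum_Sn. apply is_RInt_ext with
        (fun x => plus (sum_n (fun i => f i (cl x)) n) (f (S n) (cl x))).
      * intros. now rewrite sum_Sn.
      * apply (is_RInt_plus (V := R_NormedModule)); [exact IH | apply Hib].
  - intros P [eps HP].
    pose proof (Series_tail_lim b Hb) as HL. apply is_lim_seq_spec in HL.
    destruct (HL eps) as [N HN].
    exists N. intros n Hn. apply HP. intros x.
    change (Rabs (sum_n (fun i => f i (cl x)) n - Series (fun n => f n (cl x))) < eps).
    specialize (HN n Hn). rewrite Rminus_0_r in HN.
    rewrite Rabs_minus_sym. eapply Rle_lt_trans; [|exact HN].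
    eapply Rle_trans; [|apply Rle_abs].
    apply Series_tail_le; [|exact Hb]. intros i. apply Hf, Hcl.
  - replace (Series (fun n => RInt (f n) u v)) with I.
    + apply is_RInt_ext with (fun x => Series (fun n => f n (cl x))); [|exact HI2].
      rewrite Rmin_left, Rmax_right by lra. intros x Hx. rewrite Hid by lra. reflexivity.
    + symmetry. apply is_series_unique. exact HI1.
Qed.

Lemma CInt_CSeries (f : nat -> R -> C) (b : nat -> R) u v : u <= v ->
  (forall n x, u <= x <= v -> Cmod (f n x) <= b n) -> ex_series b ->
  (forall n, Cint (f n) u v) ->
  Cint (fun x => CSeries (fun n => f n x)) u v /\
  CInt (fun x => CSeries (fun n => f n x)) u v = CSeries (fun n => CInt (f n) u v).
Proof.
  intros Huv Hf Hb Hi.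
  assert (H1 := is_RInt_Series (fun n x => Re (f n x)) b u v Huv
    (fun n x Hx => Rle_trans _ _ _ (re_le_Cmod (f n x)) (Hf n x Hx)) Hb (fun n => proj1 (Hi n))).
  assert (H2 := is_RInt_Series (fun n x => Im (f n x)) b u v Huv
    (fun n x Hx => Rle_trans _ _ _ (Im_le_Cmod (f n x)) (Hf n x Hx)) Hb (fun n => proj2 (Hi n))).
  split.
  - split; eexists; eassumption.
  - apply C_eq; simpl; apply is_RInt_unique; assumption.
Qed.

Lemma Cint_plus f g a b : Cint f a b -> Cint g a b -> Cint (fun x => f x + g x)%C a b.
Proof.
  intros [H1 H2] [H3 H4]. split; simpl; now apply (ex_RInt_plus (V := R_NormedModule)).
Qed.

Lemma CInt_Zsum (f : Z -> R -> C) (b : nat -> R) u v : u <= v ->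
  (forall n x, u <= x <= v -> Cmod (f (Z.of_nat n) x) <= b n /\
     Cmod (f (- Z.of_nat n - 1)%Z x) <= b n) -> ex_series b ->
  (forall d, Cint (f d) u v) ->
  Cint (fun x => Zsum (fun d => f d x)) u v /\
  CInt (fun x => Zsum (fun d => f d x)) u v = Zsum (fun d => CInt (f d) u v).
Proof.
  intros Huv Hf Hb Hi.
  destruct (CInt_CSeries (fun n => f (Z.of_nat n)) b u v Huv) as [I1 E1]; trivial.
  { intros n x Hx. now apply Hf. }
  destruct (CInt_CSeries (fun n => f (- Z.of_nat n - 1)%Z) b u v Huv) as [I2 E2]; trivial.
  { intros n x Hx. now apply Hf. }
  unfold Zsum. split.
  - now apply Cint_plus.
  - now rewrite CInt_plus, E1, E2.
Qed.

(** * Integrals along the line of height one *)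

(** An improper integral truncated at integers: the unfolding glues unit intervals, one for each
    translate of a row. *)
Definition line_int (f : R -> C) (B : C) : Prop :=
  Clim (fun M => CInt f (- INR M) (INR M)) B.

(** The majorant has the primitive [K * atan], which bounds its integral over any segment by
    [K * PI]. *)
Definition dominated (f : R -> C) (K : R) : Prop :=
  Ccont f /\ forall x, Cmod (f x) <= K / (1 + x ^ 2).

Lemma one_plus_sq_pos x : 0 < 1 + x ^ 2.
Proof. pose proof (pow2_ge_0 x). lra. Qed.

Lemma dominated_nonneg f K : dominated f K -> 0 <= K.
Proof.
  intros [_ H]. specialize (H 0). pose proof (Cmod_ge_0 (f 0)).
  replace (K / (1 + 0 ^ 2)) with K in H by (field; lra). lra.
Qed.

Lemma is_RInt_lorentz K a b : is_RInt (fun x => K / (1 + x ^ 2)) a b (K * atan b - K * atan a).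
Proof.
  apply (is_RInt_derive (V := R_CompleteNormedModule) (fun x => K * atan x)).
  - intros x _. pose proof (one_plus_sq_pos x). auto_derive; trivial.
    unfold Rsqr. field. nra.
  - intros x _. apply (ex_derive_continuous (V := R_NormedModule)).
    pose proof (one_plus_sq_pos x). auto_derive. lra.
Qed.

Lemma RInt_lorentz_le K a b : 0 <= K -> RInt (fun x => K / (1 + x ^ 2)) a b <= K * PI.
Proof.
  intros H. rewrite (is_RInt_unique _ _ _ _ (is_RInt_lorentz K a b)).
  pose proof (atan_bound a). pose proof (atan_bound b).
  replace (K * atan b - K * atan a) with (K * (atan b - atan a)) by ring.
  apply Rmult_le_compat_l; lra.
Qed.

Lemma ex_lim_monotone_RInt (h : R -> R) K : (forall x, continuous h x) -> (forall x, 0 <= h x) ->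
  (forall a b, a <= b -> RInt h a b <= K) ->
  ex_finite_lim_seq (fun M => RInt h (- INR M) (INR M)).
Proof.
  intros Hc H0 HK.
  assert (I : forall a b, ex_RInt h a b).
  { intros a b. apply (ex_RInt_continuous (V := R_CompleteNormedModule)). auto. }
  apply ex_finite_lim_seq_incr with K.
  - intros n. rewrite S_INR.
    rewrite <- (RInt_Chasles (V := R_CompleteNormedModule) h (- (INR n + 1)) (- INR n)) by apply I.
    rewrite <- (RInt_Chasles (V := R_CompleteNormedModule) h (- INR n) (INR n) (INR n + 1)) by apply I.
    unfold plus; simpl.
    assert (0 <= RInt h (- (INR n + 1)) (- INR n)) by (apply RInt_ge_0; auto; lra).
    assert (0 <= RInt h (INR n) (INR n + 1)) by (apply RInt_ge_0; auto; lra).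
    lra.
  - intros n. apply HK. pose proof (pos_INR n). lra.
Qed.

(** Monotone convergence needs a nonnegative integrand, so [h] is written as [(h + w) - w] with [w]
    the majorant; both parts have increasing bounded integrals. *)
Lemma ex_line_int_real (h : R -> R) K : 0 <= K -> (forall x, continuous h x) ->
  (forall x, Rabs (h x) <= K / (1 + x ^ 2)) ->
  exists l : R, is_lim_seq (fun M => RInt h (- INR M) (INR M)) l.
Proof.
  intros K0 Hc HK.
  set (w := fun x => K / (1 + x ^ 2)).
  assert (Hw : forall x, continuous w x).
  { intros x. apply (ex_derive_continuous (V := R_NormedModule)).
    unfold w. pose proof (one_plus_sq_pos x). auto_derive. lra. }
  assert (Iw : forall a b, ex_RInt w a b).
  { intros a b. apply (ex_RInt_continuous (V := R_CompleteNormedModule)). auto. }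
  assert (Ih : forall a b, ex_RInt h a b).
  { intros a b. apply (ex_RInt_continuous (V := R_CompleteNormedModule)). auto. }
  assert (Hwp : forall x, Rabs (h x) <= w x) by exact HK.
  assert (H1 : ex_finite_lim_seq (fun M => RInt (fun x => h x + w x) (- INR M) (INR M))).
  { apply ex_lim_monotone_RInt with (2 * (K * PI)).
    - intros x. now apply (continuous_plus (V := R_NormedModule)).
    - intros x. specialize (Hwp x). apply Rabs_le_between in Hwp. lra.
    - intros a b Hab. eapply Rle_trans.
      + apply (RInt_le _ (fun x => 2 * K / (1 + x ^ 2))); trivial.
        * now apply (ex_RInt_plus (V := R_NormedModule)).
        * eexists. apply is_RInt_lorentz.
        * intros x _. specialize (Hwp x). apply Rabs_le_between in Hwp. unfold w in *.
          unfold Rdiv in *. lra.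
      + rewrite <- Rmult_assoc. apply RInt_lorentz_le. lra. }
  assert (H2 : ex_finite_lim_seq (fun M => RInt w (- INR M) (INR M))).
  { apply ex_lim_monotone_RInt with (K * PI); trivial.
    - intros x. specialize (Hwp x). pose proof (Rabs_pos (h x)). lra.
    - intros a b _. now apply RInt_lorentz_le. }
  destruct H1 as [l1 H1], H2 as [l2 H2]. exists (l1 - l2).
  eapply is_lim_seq_ext; [|apply (is_lim_seq_minus' _ _ _ _ H1 H2)].
  intros n. simpl.
  rewrite (RInt_plus (V := R_CompleteNormedModule) h w) by trivial.
  unfold plus; simpl. ring.
Qed.

Lemma ex_line_int f K : dominated f K -> exists B, line_int f B.
Proof.
  intros D. assert (K0 := dominated_nonneg _ _ D). destruct D as [Hc HK].
  destruct (ex_line_int_real (fun x => Re (f x)) K) as [l1 H1]; trivial.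
  { apply Hc. } { intros x. eapply Rle_trans; [apply re_le_Cmod | apply HK]. }
  destruct (ex_line_int_real (fun x => Im (f x)) K) as [l2 H2]; trivial.
  { apply Hc. } { intros x. eapply Rle_trans; [apply Im_le_Cmod | apply HK]. }
  exists (l1, l2). now split.
Qed.

Lemma is_lim_seq_inv_sq K : is_lim_seq (fun M => K / (1 + INR M ^ 2)) 0.
Proof.
  apply is_lim_seq_abs_0.
  apply is_lim_seq_le_le with (u := fun _ => 0) (w := fun M => Rabs K * / (INR M + 1)).
  - intros n. split; [apply Rabs_pos|].
    pose proof (one_plus_sq_pos (INR n)) as P. pose proof (pos_INR n).
    unfold Rdiv. rewrite Rabs_mult. rewrite (Rabs_pos_eq (/ _)) by (left; now apply Rinv_0_lt_compat).
    apply Rmult_le_compat_l; [apply Rabs_pos|].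
    apply Rinv_le_contravar; [lra|].
    destruct n; [simpl; lra|]. rewrite S_INR in *. pose proof (pos_INR n). nra.
  - apply is_lim_seq_const.
  - replace (Finite 0) with (Finite (Rabs K * 0)) by (f_equal; ring).
    apply is_lim_seq_mult'; [apply is_lim_seq_const|].
    apply is_lim_seq_inv with (l := p_infty).
    + apply is_lim_seq_plus with (l1 := p_infty) (l2 := Finite 1);
        [apply is_lim_seq_INR | apply is_lim_seq_const | reflexivity].
    + discriminate.
Qed.

(** The window moves by [u], so only two end pieces of length [u] near [-M] and [M] change, and
    these are [O(1 / M^2)]. *)
Lemma line_int_shift f K B u : dominated f K -> 0 <= u <= 1 -> line_int f B ->
  Clim (fun M => CInt f (u - INR M) (u + INR M)) B.
Proof.
  intros D Hu H. assert (K0 := dominated_nonneg _ _ D). destruct D as [Hc HK].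
  assert (I : forall a b, Cint f a b) by (intros; now apply Ccont_Cint).
  assert (Z : forall v : nat -> R, (forall M, v M = - INR M \/ v M = INR M) ->
     Clim (fun M => CInt f (v M) (v M + u)) 0%R).
  { intros v Hv. apply Clim_0_le with (fun M => (6 * u * K) / (1 + INR M ^ 2)); [|apply is_lim_seq_inv_sq].
    intros M. pose proof (one_plus_sq_pos (INR M)) as PM.
    replace (6 * u * K / (1 + INR M ^ 2)) with (2 * ((v M + u - v M) * (3 * K / (1 + INR M ^ 2))))
      by (field; lra).
    apply CInt_Cmod_le_const; [lra | apply I |].
    intros x Hx. eapply Rle_trans; [apply HK|].
    pose proof (one_plus_sq_pos x) as Px. pose proof (pos_INR M).
    (* As [x] is within [1] of [M] or [-M], [M^2 <= 2 x^2 + 2]; this gives the factor [3]. *)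
    assert (Q : 1 + INR M ^ 2 <= 3 * (1 + x ^ 2)).
    { destruct (Hv M) as [E|E]; rewrite E in Hx; [|nra].
      assert (T : 0 <= x + INR M <= 1) by lra.
      pose proof (pow2_ge_0 (x + INR M + x)). assert ((x + INR M) ^ 2 <= 1) by nra. nra. }
    apply Rle_div_l; [exact Px|]. unfold Rdiv.
    replace (3 * K * / (1 + INR M ^ 2) * (1 + x ^ 2)) with (K * (3 * (1 + x ^ 2) * / (1 + INR M ^ 2))) by ring.
    rewrite <- (Rmult_1_r K) at 1. apply Rmult_le_compat_l; [exact K0|].
    apply (Rle_div_r 1 _ (1 + INR M ^ 2)); lra. }
  assert (Z1 := Z (fun M => INR M)). assert (Z2 := Z (fun M => - INR M)).
  apply Clim_ext with (u := fun M => (CInt f (- INR M) (INR M) +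
     (CInt f (INR M) (INR M + u) + (- 1)%R * CInt f (- INR M) (- INR M + u)))%C).
  - intros M.
    replace (u - INR M) with (- INR M + u) by ring. replace (u + INR M) with (INR M + u) by ring.
    rewrite <- (CInt_Chasles f (- INR M + u) (- INR M) (INR M + u)) by apply I.
    rewrite <- (CInt_Chasles f (- INR M) (INR M) (INR M + u)) by apply I.
    replace (CInt f (- INR M + u) (- INR M)) with ((- 1)%R * CInt f (- INR M) (- INR M + u))%C.
    + ring.
    + pose proof (CInt_Chasles f (- INR M) (- INR M + u) (- INR M) (I _ _) (I _ _)) as E.
      assert (E0 : CInt f (- INR M) (- INR M) = 0%R).
      { unfold CInt. rewrite !RInt_point. reflexivity. }
      rewrite E0 in E. apply C_eq; apply (f_equal Re) in E as E1; apply (f_equal Im) in E as E2;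
      unfold Cplus, Cmult, Re, Im in *; simpl in *; lra.
  - replace B with (B + (0%R + (-1)%R * 0%R))%C by ring.
    apply Clim_plus; [exact H|]. apply Clim_plus; [apply Z1; auto|].
    apply Clim_scal. apply Z2. auto.
Qed.

(** Tannery's theorem: cut both series where the tail of [b] is below [eps / 3] and let [M] grow in
    the finite part. *)
Lemma Clim_tannery (a : nat -> nat -> C) (l : nat -> C) (b : nat -> R) :
  ex_series b -> (forall r M, Cmod (a r M) <= b r) -> (forall r, Clim (a r) (l r)) ->
  Clim (fun M => CSeries (fun r => a r M)) (CSeries l).
Proof.
  intros Hb Hab Hl.
  assert (Hlb : forall r, Cmod (l r) <= b r) by (intros r; apply (Clim_Cmod_le (a r)); auto).
  assert (T : forall (a : nat -> nat -> R) (l : nat -> R), (forall r M, Rabs (a r M) <= b r) ->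
     (forall r, Rabs (l r) <= b r) -> (forall r, is_lim_seq (a r) (l r)) ->
     is_lim_seq (fun M => Series (fun r => a r M)) (Series l)).
  { clear a l Hab Hl Hlb. intros a l Ha Hl H.
    apply is_lim_seq_spec. intros eps.
    pose proof (Series_tail_lim b Hb) as HT. apply is_lim_seq_spec in HT.
    assert (He : 0 < eps / 3) by (destruct eps; simpl; lra).
    destruct (HT (mkposreal _ He)) as [R HR]. specialize (HR R (le_n R)).
    simpl in HR. rewrite Rminus_0_r in HR.
    assert (HS : is_lim_seq (fun M => sum_n (fun r => a r M) R) (sum_n l R)).
    { clear - H. induction R as [|R IH].
      - rewrite sum_O. eapply is_lim_seq_ext; [|apply H]. intros; simpl; now rewrite sum_O.
      - rewrite sum_Sn. eapply is_lim_seq_ext; [|apply (is_lim_seq_plus' _ _ _ _ IH (H (S R)))].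
        intros; simpl; now rewrite sum_Sn. }
    apply is_lim_seq_spec in HS. destruct (HS (mkposreal _ He)) as [M0 HM].
    exists M0. intros M HMM. specialize (HM M HMM). simpl in HM.
    pose proof (Series_tail_le (fun r => a r M) b R (fun r => Ha r M) Hb) as T1.
    pose proof (Series_tail_le l b R Hl Hb) as T2.
    pose proof (Rle_abs (Series b - sum_n b R)).
    apply Rabs_def1; [|];
    apply Rabs_def2 in HM; apply Rabs_le_between in T1, T2; lra. }
  split; simpl; apply T.
  - intros; eapply Rle_trans; [apply re_le_Cmod | apply Hab].
  - intros; eapply Rle_trans; [apply re_le_Cmod | apply Hlb].
  - intros r; apply Hl.
  - intros; eapply Rle_trans; [apply Im_le_Cmod | apply Hab].
  - intros; eapply Rle_trans; [apply Im_le_Cmod | apply Hlb].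
  - intros r; apply Hl.
Qed.

(** Two interchanges: the M-test on each segment, then Tannery's theorem in the length of the
    segment, with majorant [b r * (2 * PI)]. *)
Lemma line_int_CSeries (f : nat -> R -> C) (B : nat -> C) (b : nat -> R) :
  ex_series b -> (forall r, dominated (f r) (b r)) -> (forall r, line_int (f r) (B r)) ->
  line_int (fun x => CSeries (fun r => f r x)) (CSeries B).
Proof.
  intros Hb D H.
  assert (P : forall r, 0 <= b r) by (intros r; apply (dominated_nonneg _ _ (D r))).
  assert (Le : forall r x, Cmod (f r x) <= b r).
  { intros r x. eapply Rle_trans; [apply D|].
    pose proof (one_plus_sq_pos x). pose proof (pow2_ge_0 x).
    apply Rle_div_l; trivial. specialize (P r). nra. }
  assert (W : forall M, - INR M <= INR M) by (intros M; pose proof (pos_INR M); lra).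
  apply Clim_ext with (u := fun M => CSeries (fun r => CInt (f r) (- INR M) (INR M))).
  - intros M. symmetry. eapply CInt_CSeries; [apply W | | exact Hb |].
    + intros; apply Le.
    + intros r. apply Ccont_Cint, D.
  - apply Clim_tannery with (fun r => b r * (2 * PI)).
    + now apply ex_series_scal_r.
    + intros r M. eapply Rle_trans.
      * apply CInt_Cmod_le with (g := fun x => b r / (1 + x ^ 2)); trivial.
        -- apply Ccont_Cint, D.
        -- eexists. apply is_RInt_lorentz.
        -- intros x _. apply D.
      * pose proof (RInt_lorentz_le (b r) (- INR M) (INR M) (P r)). lra.
    + exact H.
Qed.

(** * The exponential as a power series *)

Lemma is_derive_zero_const (f : R -> R) : (forall t, is_derive f t 0) -> f 0 = f 1.
Proof.
  intros H. apply (eq_is_derive (V := R_NormedModule) f 0 1); [intros; apply H | lra].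
Qed.

(** Comparison with the series of [exp (A t)], which converges everywhere. *)
Lemma Rbar_lt_CV_radius (p : nat -> R) (A : R) : (forall r, Rabs (p r) <= A ^ r / INR (fact r)) ->
  forall t : R, Rbar_lt (Rabs t) (CV_radius p).
Proof.
  intros H t. apply Rbar_lt_le_trans with (Finite (Rabs t + 1)); [simpl; lra|].
  apply (proj1 (Lub_Rbar_correct (CV_disk p))). unfold CV_disk.
  apply (ex_series_le (V := R_CompleteNormedModule)) with
    (fun r => / INR (fact r) * (A * (Rabs t + 1)) ^ r).
  - intros r. unfold norm; simpl. unfold abs; simpl.
    rewrite Rabs_Rabsolu, Rabs_mult, <- RPow_abs, (Rabs_pos_eq (Rabs t + 1))
      by (pose proof (Rabs_pos t); lra).
    rewrite Rpow_mult_distr, <- Rmult_assoc.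
    apply Rmult_le_compat_r; [apply pow_le; pose proof (Rabs_pos t); lra|].
    rewrite Rmult_comm. apply H.
  - exists (exp (A * (Rabs t + 1))).
    pose proof (is_exp_Reals (A * (Rabs t + 1))) as E. apply is_pseries_R in E. exact E.
Qed.

Lemma ex_PSeries_of_radius p t : (forall t : R, Rbar_lt (Rabs t) (CV_radius p)) -> ex_pseries p t.
Proof. intros H. apply CV_radius_inside, H. Qed.

Lemma Re_Cmult (z w : C) : Re (z * w)%C = Re z * Re w - Im z * Im w.
Proof. reflexivity. Qed.

Lemma Im_Cmult (z w : C) : Im (z * w)%C = Re z * Im w + Im z * Re w.
Proof. reflexivity. Qed.

Lemma Im_pow_le (a : C) r : Rabs (Im (a ^ r)%C) <= Cmod a ^ r.
Proof. rewrite <- Cmod_pow. apply Im_le_Cmod. Qed.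

Lemma Re_pow_le (a : C) r : Rabs (Re (a ^ r)%C) <= Cmod a ^ r.
Proof. rewrite <- Cmod_pow. apply re_le_Cmod. Qed.

Lemma INR_fact_pos r : 0 < INR (fact r).
Proof. apply lt_0_INR, lt_O_fact. Qed.

(* [t |-> e(-t w) * sum (2 pi i w t)^r / r!] has derivative zero. *)
Lemma e_series (w : C) :
  e w = CSeries (fun r => RtoC (/ INR (fact r)) * (twopii * w) ^ r)%C.
Proof.
  set (a := (twopii * w)%C).
  set (p := fun r => Re (a ^ r)%C / INR (fact r)).
  set (q := fun r => Im (a ^ r)%C / INR (fact r)).
  assert (Hp : forall t : R, Rbar_lt (Rabs t) (CV_radius p)).
  { apply Rbar_lt_CV_radius with (Cmod a). intros r. unfold p, Rdiv.
    pose proof (INR_fact_pos r) as F. rewrite Rabs_mult, (Rabs_pos_eq (/ _)) by (left; now apply Rinv_0_lt_compat).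
    apply Rmult_le_compat_r; [left; now apply Rinv_0_lt_compat | apply Re_pow_le]. }
  assert (Hq : forall t : R, Rbar_lt (Rabs t) (CV_radius q)).
  { apply Rbar_lt_CV_radius with (Cmod a). intros r. unfold q, Rdiv.
    pose proof (INR_fact_pos r) as F. rewrite Rabs_mult, (Rabs_pos_eq (/ _)) by (left; now apply Rinv_0_lt_compat).
    apply Rmult_le_compat_r; [left; now apply Rinv_0_lt_compat | apply Im_pow_le]. }
  assert (Ep : forall r, PS_derive p r = Re a * p r - Im a * q r).
  { intros r. unfold PS_derive, p, q. rewrite fact_simpl, mult_INR, Cpow_S, Re_Cmult.
    pose proof (INR_fact_pos r). pose proof (pos_INR r). rewrite S_INR.
    field. lra. }
  assert (Eq : forall r, PS_derive q r = Re a * q r + Im a * p r).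
  { intros r. unfold PS_derive, p, q. rewrite fact_simpl, mult_INR, Cpow_S, Im_Cmult.
    pose proof (INR_fact_pos r). pose proof (pos_INR r). rewrite S_INR.
    field. lra. }
  set (E := fun t : R => (PSeries p t, PSeries q t) : C).
  assert (XP : forall t, ex_pseries p t) by (intros; now apply ex_PSeries_of_radius).
  assert (XQ : forall t, ex_pseries q t) by (intros; now apply ex_PSeries_of_radius).
  assert (DE : forall t, CD E t (a * E t)%C).
  { intros t. split; simpl.
    - eapply (eq_ind _ (is_derive _ t)); [apply is_derive_PSeries, Hp|].
      rewrite (PSeries_ext _ _ t Ep).
      transitivity (PSeries (PS_minus (PS_scal (Re a) p) (PS_scal (Im a) q)) t).
      + apply PSeries_ext. intros r. reflexivity.
      + rewrite PSeries_minus, !PSeries_scal; [reflexivity | |];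
        (apply ex_pseries_scal; [apply Rmult_comm | auto]).
    - eapply (eq_ind _ (is_derive _ t)); [apply is_derive_PSeries, Hq|].
      rewrite (PSeries_ext _ _ t Eq).
      transitivity (PSeries (PS_plus (PS_scal (Re a) q) (PS_scal (Im a) p)) t).
      + apply PSeries_ext. intros r. reflexivity.
      + rewrite PSeries_plus, !PSeries_scal; [reflexivity | |];
        (apply ex_pseries_scal; [apply Rmult_comm | auto]). }
  assert (D0 : forall t, CD (fun t => e (RtoC t * - w)%C * E t)%C t 0%R).
  { intros t. eapply CD_eq.
    - apply CD_mult; [|apply DE]. apply CD_e.
      apply (CD_ext (fun t => (- w) * (t, 0))%C).
      + intros u. unfold RtoC. ring.
      + apply CD_scal, CD_line.
    - unfold a. cbv beta. ring. }
  assert (E01 : (e (RtoC 0 * - w) * E 0 = e (RtoC 1 * - w) * E 1)%C).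
  { apply C_eq.
    - apply (is_derive_zero_const (fun t => Re (e (RtoC t * - w)%C * E t)%C)). intros t; apply D0.
    - apply (is_derive_zero_const (fun t => Im (e (RtoC t * - w)%C * E t)%C)). intros t; apply D0. }
  assert (E00 : E 0 = 1%R).
  { unfold E. rewrite !PSeries_0. unfold p, q. simpl. apply C_eq; simpl; field. }
  rewrite E00 in E01. replace (RtoC 0 * - w)%C with (RtoC 0) in E01 by ring.
  rewrite e_0 in E01.
  assert (EW : (e w * e (RtoC 1 * - w) = 1%R)%C).
  { rewrite <- e_plus. replace (w + RtoC 1 * - w)%C with (RtoC 0) by ring. apply e_0. }
  transitivity (E 1).
  - transitivity (e w * (e (RtoC 1 * - w) * E 1))%C.
    + rewrite <- E01. ring.
    + rewrite Cmult_assoc, EW. ring.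
  - unfold E, CSeries, PSeries. f_equal; apply Series_ext; intros r; unfold p, q;
    rewrite pow1; simpl; unfold Re, Im, Rdiv; ring.
Qed.

(** * The integrals of z^(-s) e(-nz) *)

Definition zpow_e (s n : nat) (x : R) : C := (/ ((x, 1)%R : C) ^ s * e (RtoC (- INR n) * (x, 1)%R))%C.

Lemma line_nz x : ((x, 1) : C) <> 0%R.
Proof. intros E. apply (f_equal Im) in E. simpl in E. lra. Qed.

Lemma Cmod_line_sq x : Cmod (x, 1) ^ 2 = 1 + x ^ 2.
Proof. rewrite Cmod2_alt. simpl. ring. Qed.

Lemma Cmod_line_ge_1 x : 1 <= Cmod (x, 1).
Proof.
  pose proof (Im_le_Cmod (x, 1)) as H. simpl in H. rewrite Rabs_R1 in H. exact H.
Qed.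

Lemma Cmod_line_pow_le s x : (2 <= s)%nat -> 1 + x ^ 2 <= Cmod (x, 1) ^ s.
Proof.
  intros H. rewrite <- Cmod_line_sq. apply Rle_pow; [apply Cmod_line_ge_1 | exact H].
Qed.

Lemma Cmod_zpow_e_le s n x : (2 <= s)%nat -> Cmod (zpow_e s n x) <= exp (2 * PI * INR n) / (1 + x ^ 2).
Proof.
  intros H. unfold zpow_e. pose proof (one_plus_sq_pos x).
  rewrite Cmod_mult, Cmod_inv, Cmod_pow, Cmod_e by apply Cpow_nz, line_nz.
  replace (-2 * PI * Im (RtoC (- INR n) * (x, 1)%R)%C) with (2 * PI * INR n) by (simpl; ring).
  rewrite Rmult_comm. apply Rmult_le_compat_l; [left; apply exp_pos|].
  apply Rinv_le_contravar; [lra | now apply Cmod_line_pow_le].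
Qed.

Lemma CD_zpow_e s n x : CD (zpow_e s n) x
  (RtoC (- INR s) * zpow_e (S s) n x + (- twopii * RtoC (INR n)) * zpow_e s n x)%C.
Proof.
  unfold zpow_e. eapply CD_eq.
  - apply CD_mult.
    + apply CD_inv; [apply CD_pow, CD_line | apply Cpow_nz, line_nz].
    + apply CD_e, CD_scal, CD_line.
  - cbv beta. pose proof (line_nz x) as L. pose proof (Cpow_nz _ (pred s) L) as L'.
    destruct s as [|s]; simpl pred in *.
    + simpl. rewrite !RtoC_opp. field. exact L.
    + rewrite !Cpow_S, !RtoC_opp. field. auto.
Qed.

Lemma zpow_e_cont s n : Ccont (zpow_e s n).
Proof. apply CD_Ccont. intros x. eexists. apply CD_zpow_e. Qed.

Lemma zpow_e_dominated s n : (2 <= s)%nat -> dominated (zpow_e s n) (exp (2 * PI * INR n)).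
Proof. intros H. split; [apply zpow_e_cont | intros; now apply Cmod_zpow_e_le]. Qed.

(** Integration by parts, that is, the integral of the derivative in [CD_zpow_e]; for [2 <= s] the
    boundary values are [O(1 / M^2)]. *)
Lemma line_int_zpow_e_S s n B : (2 <= s)%nat -> line_int (zpow_e s n) B ->
  line_int (zpow_e (S s) n) (RtoC (/ INR s) * (- twopii * RtoC (INR n)) * B)%C.
Proof.
  intros Hs H. assert (S0 : INR s <> 0) by (apply not_0_INR; lia).
  assert (I : forall s a b, Cint (zpow_e s n) a b) by (intros; apply Ccont_Cint, zpow_e_cont).
  apply Clim_ext with (u := fun M => (RtoC (/ INR s) * (- twopii * RtoC (INR n)) * CInt (zpow_e s n) (- INR M) (INR M)
     + (RtoC (- / INR s)) * (zpow_e s n (INR M) + RtoC (-1) * zpow_e s n (- INR M)))%C).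
  - intros M.
    assert (F : CInt (fun x => RtoC (- INR s) * zpow_e (S s) n x + (- twopii * RtoC (INR n)) * zpow_e s n x)%C
       (- INR M) (INR M) = (zpow_e s n (INR M) - zpow_e s n (- INR M))%C).
    { apply CInt_FTC; [intros x; apply CD_zpow_e|].
      apply CD_Ccont. intros x. eexists. apply CD_plus; apply CD_scal, CD_zpow_e. }
    rewrite CInt_plus, !CInt_scal in F; trivial.
    2, 3: apply Ccont_Cint, CD_Ccont; intros x; eexists; apply CD_scal, CD_zpow_e.
    set (J := CInt (zpow_e (S s) n) (- INR M) (INR M)) in *.
    replace (zpow_e s n (INR M) + RtoC (-1) * zpow_e s n (- INR M))%C
      with (zpow_e s n (INR M) - zpow_e s n (- INR M))%C by ring.
    rewrite <- F.
    assert (S1 : RtoC (INR s) <> 0%R) by (intros K; apply S0; now injection K).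
    rewrite !RtoC_opp, RtoC_inv by exact S0. field. exact S1.
  - replace (RtoC (/ INR s) * (- twopii * RtoC (INR n)) * B)%C with
      (RtoC (/ INR s) * (- twopii * RtoC (INR n)) * B + RtoC (- / INR s) * (0%R + RtoC (-1) * 0%R))%C by ring.
    apply Clim_plus; [now apply Clim_scal|]. apply Clim_scal.
    assert (L : forall v : nat -> R, (forall M, v M ^ 2 = INR M ^ 2) -> Clim (fun M => zpow_e s n (v M)) 0%R).
    { intros v Hv. apply Clim_0_le with (fun M => exp (2 * PI * INR n) / (1 + INR M ^ 2)).
      - intros M. rewrite <- Hv. now apply Cmod_zpow_e_le.
      - apply is_lim_seq_inv_sq. }
    apply Clim_plus; [now apply L|]. apply Clim_scal. apply L. intros M. ring.
Qed.

(** Reduces every exponent to the single unknown [kappa]. The factorial is the product of the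
    exponents [2, ..., 1 + r] divided out on the way. *)
Lemma line_int_zpow_e n kappa r : line_int (zpow_e 2 n) kappa ->
  line_int (zpow_e (2 + r) n) (RtoC (/ INR (fact (1 + r))) * (- twopii * RtoC (INR n)) ^ r * kappa)%C.
Proof.
  intros H. induction r as [|r IH].
  - simpl. replace (RtoC (/ 1) * RtoC 1 * kappa)%C with kappa; [exact H|].
    rewrite Rinv_1. ring.
  - replace (2 + S r)%nat with (S (2 + r)) by lia.
    replace (RtoC (/ INR (fact (1 + S r))) * (- twopii * RtoC (INR n)) ^ S r * kappa)%C with
      (RtoC (/ INR (2 + r)) * (- twopii * RtoC (INR n)) *
       (RtoC (/ INR (fact (1 + r))) * (- twopii * RtoC (INR n)) ^ r * kappa))%C.
    + apply line_int_zpow_e_S; [lia | exact IH].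
    + replace (1 + S r)%nat with (S (1 + r)) by lia.
      rewrite (fact_simpl (1 + r)), mult_INR, Rinv_mult, RtoC_mult, Cpow_S.
      change (S (1 + r)) with (2 + r)%nat. ring.
Qed.

(** * Nonvanishing of [kappa] *)

Lemma sin_sq_le y : sin y ^ 2 <= y ^ 2.
Proof.
  assert (P : forall y, 0 <= y -> sin y ^ 2 <= y ^ 2).
  { intros z [Hz|<-]; [|rewrite sin_0; lra].
    destruct (Rle_dec z 1) as [H1|H1].
    - assert (0 <= sin z) by (apply sin_ge_0; pose proof PI2_3_2; lra).
      pose proof (sin_lt_x z Hz). nra.
    - pose proof (SIN_bound z). nra. }
  destruct (Rle_dec 0 y) as [H|H]; [now apply P|].
  specialize (P (- y)). rewrite sin_neg in P.
  replace ((- sin y) ^ 2) with (sin y ^ 2) in P by ring.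
  replace ((- y) ^ 2) with (y ^ 2) in P by ring. apply P. lra.
Qed.

Lemma cos_ge_parabola y : 1 - y ^ 2 / 2 <= cos y.
Proof.
  replace y with (2 * (y / 2)) at 2 by field. rewrite cos_2a_sin.
  pose proof (sin_sq_le (y / 2)). nra.
Qed.

Lemma nonneg_of_derive_nonneg (f df : R -> R) x : (forall t, is_derive f t (df t)) ->
  (forall t, 0 <= df t) -> f 0 = 0 -> 0 <= x -> 0 <= f x.
Proof.
  intros H D H0 Hx.
  destruct (MVT_gen f 0 x df) as [c [_ E]].
  - intros; apply H.
  - intros t _. apply continuity_pt_filterlim, (ex_derive_continuous (V := R_NormedModule)).
    eexists. apply H.
  - specialize (D c). nra.
Qed.

(** The two differences vanish at [0] and have derivatives [t^4 / (1 + t^2)] and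
    [t^2 / (1 + t^2)]. *)
Lemma atan_bounds x : 0 <= x -> x - x ^ 3 / 3 <= atan x <= x.
Proof.
  intros Hx. split.
  - apply Rminus_le_0.
    apply (nonneg_of_derive_nonneg (fun t => atan t - (t - t ^ 3 / 3)) (fun t => t ^ 4 / (1 + t ^ 2))); trivial.
    + intros t. pose proof (one_plus_sq_pos t). auto_derive; trivial. unfold Rsqr. field. nra.
    + intros t. pose proof (one_plus_sq_pos t). apply Rdiv_le_0_compat; [|lra].
      replace (t ^ 4) with ((t ^ 2) ^ 2) by ring. apply pow2_ge_0.
    + rewrite atan_0. field.
  - apply Rminus_le_0.
    apply (nonneg_of_derive_nonneg (fun t => t - atan t) (fun t => t ^ 2 / (1 + t ^ 2))); trivial.
    + intros t. pose proof (one_plus_sq_pos t). auto_derive; trivial. unfold Rsqr. field. nra.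
    + intros t. pose proof (one_plus_sq_pos t). apply Rdiv_le_0_compat; [apply pow2_ge_0 | lra].
    + rewrite atan_0. ring.
Qed.

(* The constant [31/10] leaves a margin below the exponent [S - 3] for which
   [(1 - (S - 3) x^2) / (1 + x^2)^(S/2)] has integral zero. *)
Lemma cos_phase_ge (S T x : R) : 6 <= S -> Rabs (S - T) <= 1 ->
  1 - (S - 31 / 10) * x ^ 2 <= cos (S * atan x - T * x).
Proof.
  intros HS HT. apply Rabs_le_between in HT.
  assert (P : forall x, 0 <= x -> 1 - (S - 31 / 10) * x ^ 2 <= cos (S * atan x - T * x)).
  { clear x. intros x Hx.
    (* In the first case the left-hand side is at most [-1], so there is nothing to estimate. *)
    destruct (Rle_dec 2 ((S - 31 / 10) * x ^ 2)) as [Q|Q].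
    - pose proof (COS_bound (S * atan x - T * x)). lra.
    - eapply Rle_trans; [|apply cos_ge_parabola].
      pose proof (atan_bounds x Hx) as A.
      (* [S / (S - 31/10)] decreases in [S], and at [S = 6] twice its value is
         [12 / 2.9 < 4.138]. *)
      assert (Q1 : S * x ^ 2 <= 4138 / 1000) by nra.
      (* The phase is [(S - T) x - S (x - atan x)], and [1 + 4.138 / 3 < 2.38]. Half of [2.38^2] is
         below [2.9 <= S - 31/10], which is what the parabola bound for the cosine requires. *)
      assert (B : Rabs (S * atan x - T * x) <= 238 / 100 * x).
      { apply Rabs_le.
        assert (S * (x - atan x) <= S * (x ^ 3 / 3)) by nra.
        assert (S * x ^ 3 <= 4138 / 1000 * x) by (replace (S * x ^ 3) with (S * x ^ 2 * x) by ring; nra).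
        assert (0 <= S * (x - atan x)) by nra.
        assert (- x <= (S - T) * x <= x) by nra.
        nra. }
      assert (B2 : (S * atan x - T * x) ^ 2 <= (238 / 100 * x) ^ 2).
      { apply pow_maj_Rabs with (n := 2%nat). exact B. }
      nra. }
  destruct (Rle_dec 0 x) as [H|H]; [now apply P|].
  specialize (P (- x)). rewrite atan_opp in P.
  replace (S * - atan x - T * - x) with (- (S * atan x - T * x)) in P by ring.
  rewrite cos_neg in P. replace ((- x) ^ 2) with (x ^ 2) in P by ring. apply P. lra.
Qed.

Lemma e_nat_mul z (h : nat) : (e z ^ h)%C = e (RtoC (INR h) * z)%C.
Proof.
  induction h as [|h IH].
  - simpl (_ ^ 0)%C. simpl INR. replace (RtoC 0 * z)%C with (RtoC 0) by ring. now rewrite e_0.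
  - rewrite Cpow_S, IH, <- e_plus, S_INR, RtoC_plus. f_equal. ring.
Qed.

Lemma cos_sin_2atan x : cos (2 * atan x) = (1 - x ^ 2) / (1 + x ^ 2) /\
  sin (2 * atan x) = 2 * x / (1 + x ^ 2).
Proof.
  pose proof (one_plus_sq_pos x) as P.
  assert (S : sqrt (1 + x ^ 2) * sqrt (1 + x ^ 2) = 1 + x ^ 2) by (apply sqrt_sqrt; lra).
  assert (S0 : sqrt (1 + x ^ 2) <> 0) by (intros E; rewrite E in S; lra).
  rewrite cos_2a, sin_2a, cos_atan, sin_atan.
  unfold Rsqr. replace (1 + x * x) with (1 + x ^ 2) by ring.
  set (r := sqrt (1 + x ^ 2)) in *. rewrite <- S.
  split; field; exact S0.
Qed.

(** The argument of [x + i] is [pi/2 - atan x]. Squaring turns the right angle into a sign, so even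
    powers have a polar form without a choice of branch. *)
Lemma line_sq_polar x : (((x, 1)%R : C) ^ 2 * e (RtoC (atan x / PI)) = RtoC (- (1 + x ^ 2)))%C.
Proof.
  pose proof (one_plus_sq_pos x) as P. pose proof PI_RGT_0.
  unfold e. simpl (Re _). simpl (Im _).
  replace (2 * PI * (atan x / PI)) with (2 * atan x) by (field; lra).
  destruct (cos_sin_2atan x) as [-> ->].
  rewrite Rmult_0_r, exp_0. apply C_eq; simpl; field; nra.
Qed.

Lemma zpow_e_polar h n x :
  zpow_e (2 * h) n x = (RtoC ((-1) ^ h) * (RtoC (/ (1 + x ^ 2) ^ h) *
    e (INR h * atan x / PI - INR n * x, - INR n)%R))%C.
Proof.
  pose proof (one_plus_sq_pos x) as P. pose proof (line_nz x) as L.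
  unfold zpow_e.
  replace (INR h * atan x / PI - INR n * x, - INR n)%R with
    (RtoC (INR h) * RtoC (atan x / PI) + RtoC (- INR n) * (x, 1)%R)%C
    by (apply C_eq; simpl; field; apply PI_neq0).
  rewrite e_plus, <- e_nat_mul.
  assert (E : (/ ((x, 1)%R : C) ^ (2 * h) = RtoC ((-1) ^ h) * RtoC (/ (1 + x ^ 2) ^ h) * e (RtoC (atan x / PI)) ^ h)%C).
  { rewrite Cpow_mult_r.
    assert (N2 : (((x, 1)%R : C) ^ 2)%C <> 0%R) by now apply Cpow_nz.
    rewrite <- (Cpow_inv _ h N2).
    replace (/ ((x, 1)%R : C) ^ 2)%C with (RtoC (- / (1 + x ^ 2)) * e (RtoC (atan x / PI)))%C.
    - rewrite Cpow_mult_l, <- RtoC_pow, <- RtoC_mult. f_equal. f_equal.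
      replace (- / (1 + x ^ 2)) with (-1 * / (1 + x ^ 2)) by ring.
      now rewrite Rpow_mult_distr, pow_inv.
    - pose proof (line_sq_polar x) as Q.
      apply (f_equal (fun w => RtoC (- / (1 + x ^ 2)) * w * / ((x, 1)%R : C) ^ 2)%C) in Q.
      rewrite <- RtoC_mult in Q.
      replace (- / (1 + x ^ 2) * - (1 + x ^ 2)) with 1 in Q by (field; lra).
      rewrite Cmult_1_l in Q. rewrite <- Q. field. exact L. }
  rewrite E. ring.
Qed.

(** The phase is [S atan x - T x] with [S = 2 h] and [T = 2 pi n], the shape treated by
    [cos_phase_ge]; it is nearly stationary at [0] when [S] is close to [T]. *)
Lemma Re_zpow_e h n x :
  (-1) ^ h * Re (zpow_e (2 * h) n x) =
  exp (2 * PI * INR n) * (/ (1 + x ^ 2) ^ h * cos (2 * INR h * atan x - 2 * PI * INR n * x)).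
Proof.
  rewrite zpow_e_polar. unfold e. simpl (Re (_, _)). simpl (Im (_, _)).
  replace (-2 * PI * - INR n) with (2 * PI * INR n) by ring.
  replace (2 * PI * (INR h * atan x / PI - INR n * x)) with (2 * INR h * atan x - 2 * PI * INR n * x)
    by (field; apply PI_neq0).
  assert (E : (-1) ^ h * (-1) ^ h = 1).
  { rewrite <- Rpow_mult_distr. replace (-1 * -1) with 1 by ring. apply pow1. }
  simpl. transitivity (((-1) ^ h * (-1) ^ h) * (/ (1 + x * (x * 1)) ^ h * (exp (2 * PI * INR n) * cos (2 * INR h * atan x - 2 * PI * INR n * x)))).
  - ring.
  - rewrite E. ring.
Qed.

(** With [h - 1] in place of [h] the coefficient becomes [2 h - 3]. The primitive is odd and
    nonnegative on the right, so the weighted parabola has a nonnegative integral over [[-M, M]],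
    tending to zero. *)
Lemma is_derive_odd_primitive h x : is_derive (fun t => t / (1 + t ^ 2) ^ h) x
  ((1 - (2 * INR h - 1) * x ^ 2) * / (1 + x ^ 2) ^ S h).
Proof.
  pose proof (one_plus_sq_pos x) as P. assert (P' := pow_lt _ h P).
  auto_derive; [simpl in *; lra|].
  destruct h as [|h].
  - simpl. field. simpl in P. nra.
  - pose proof (pow_lt _ h P). rewrite S_INR. simpl pred.
    simpl in *. field. split; nra.
Qed.

Lemma exists_even_near n : (1 <= n)%nat -> exists h : nat, 3 <= INR h /\ Rabs (2 * INR h - 2 * PI * INR n) <= 1.
Proof.
  intros Hn. apply le_INR in Hn. simpl in Hn.
  pose proof PI2_3_2 as Hpi.
  (* [up y] lies in [(y, y + 1]], so the shift by one half makes it an integer within [1/2] of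
     [pi n]; [pi > 3] then makes it at least [3]. *)
  set (y := PI * INR n - / 2).
  assert (Hy : 5 / 2 < y) by (unfold y; nra).
  destruct (archimed y) as [A1 A2].
  assert (U : (2 < up y)%Z) by (apply lt_IZR; simpl; lra).
  exists (Z.to_nat (up y)). rewrite INR_IZR_INZ, Z2Nat.id by lia.
  split.
  - apply IZR_le. lia.
  - apply Rabs_le. unfold y in *. lra.
Qed.

(** If [kappa] were zero, so would be the integral with exponent [2 h], by [line_int_zpow_e]. Yet
    its real part, up to sign, stays above a positive constant by the cosine bound. *)
Lemma line_int_zpow_e_nz n kappa : (1 <= n)%nat -> line_int (zpow_e 2 n) kappa -> kappa <> 0%R.
Proof.
  intros Hn H K0. destruct (exists_even_near n Hn) as [h [Hh Hnear]].
  assert (Hh' : (3 <= h)%nat) by (apply INR_le; simpl; lra).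
  set (w := fun x => / (1 + x ^ 2) ^ h).
  assert (wpos : forall x, 0 < w x) by (intros; apply Rinv_0_lt_compat, pow_lt, one_plus_sq_pos).
  assert (wc : forall x, continuous w x).
  { intros x. apply (ex_derive_continuous (V := R_NormedModule)).
    pose proof (pow_lt _ h (one_plus_sq_pos x)) as P. unfold w. auto_derive. simpl in *. lra. }
  set (W := fun x => (-1) ^ h * Re (zpow_e (2 * h) n x)).
  (* [p] is the part of integral at least zero, and [g] is the surplus from the gap between [31/10]
     and [3]; the strict positivity comes from [g] alone. *)
  set (g := fun x => / 10 * (x ^ 2 * w x)).
  set (p := fun x => (1 - (2 * INR h - 3) * x ^ 2) * w x).
  assert (Wc : forall x, continuous W x).
  { intros x. apply (continuous_mult (K := R_AbsRing)); [apply continuous_const | exact (proj1 (zpow_e_cont (2 * h) n x))]. }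
  assert (gc : forall x, continuous g x).
  { intros x. apply (continuous_mult (K := R_AbsRing)); [apply continuous_const|].
    apply (continuous_mult (K := R_AbsRing)); [|apply wc].
    apply (ex_derive_continuous (V := R_NormedModule)). auto_derive. trivial. }
  assert (pc : forall x, continuous p x).
  { intros x. apply (continuous_mult (K := R_AbsRing)); [|apply wc].
    apply (ex_derive_continuous (V := R_NormedModule)). auto_derive. trivial. }
  assert (I : forall f : R -> R, (forall x, continuous f x) -> forall a b, ex_RInt f a b).
  { intros f Hf a b. apply (ex_RInt_continuous (V := R_CompleteNormedModule)). auto. }
  assert (g0 : forall x, 0 <= g x).
  { intros x. unfold g. pose proof (wpos x). pose proof (pow2_ge_0 x). nra. }
  set (G := RInt g 0 1).
  assert (Gpos : 0 < G).
  { apply RInt_gt_0; [lra | | intros; apply gc].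
    intros x Hx. unfold g. pose proof (wpos x). assert (0 < x ^ 2) by (apply pow_lt; lra).
    apply Rmult_lt_0_compat; [lra|]. now apply Rmult_lt_0_compat. }
  set (A := exp (2 * PI * INR n)). assert (Apos : 0 < A) by apply exp_pos.
  assert (Low : forall M, (1 <= M)%nat -> A * G <= RInt W (- INR M) (INR M)).
  { intros M HM. apply le_INR in HM. simpl in HM.
    assert (P0 : 0 <= RInt p (- INR M) (INR M)).
    { destruct h as [|h']; [lia|].
      assert (E : is_RInt p (- INR M) (INR M)
         (INR M / (1 + INR M ^ 2) ^ h' - - INR M / (1 + (- INR M) ^ 2) ^ h')).
      { apply is_RInt_ext with (fun x => (1 - (2 * INR h' - 1) * x ^ 2) * / (1 + x ^ 2) ^ S h').
        - intros x _. unfold p, w. rewrite S_INR. f_equal. ring.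
        - apply (is_RInt_derive (V := R_CompleteNormedModule) (fun t => t / (1 + t ^ 2) ^ h')).
          + intros; apply is_derive_odd_primitive.
          + intros x _. eapply continuous_ext; [|apply (pc x)].
            intros y. unfold p, w. rewrite S_INR. f_equal. ring. }
      rewrite (is_RInt_unique _ _ _ _ E).
      replace ((- INR M) ^ 2) with (INR M ^ 2) by ring.
      pose proof (pow_lt _ h' (one_plus_sq_pos (INR M))).
      assert (0 <= INR M / (1 + INR M ^ 2) ^ h') by (apply Rdiv_le_0_compat; lra).
      unfold Rdiv in *. lra. }
    assert (G1 : G <= RInt g (- INR M) (INR M)).
    { rewrite <- (RInt_Chasles (V := R_CompleteNormedModule) g (- INR M) 0 (INR M)) by auto.
      rewrite <- (RInt_Chasles (V := R_CompleteNormedModule) g 0 1 (INR M)) by auto.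
      fold G. unfold plus; simpl.
      assert (0 <= RInt g (- INR M) 0) by (apply RInt_ge_0; auto; lra).
      assert (0 <= RInt g 1 (INR M)) by (apply RInt_ge_0; auto; lra). lra. }
    apply Rle_trans with (RInt (fun x => A * (p x + g x)) (- INR M) (INR M)).
    - rewrite (RInt_scal (V := R_CompleteNormedModule)) with (f := fun x => p x + g x).
      + rewrite (RInt_plus (V := R_CompleteNormedModule)) by auto.
        unfold scal, plus; simpl. unfold mult; simpl. nra.
      + apply (ex_RInt_plus (V := R_NormedModule)); auto.
    - apply RInt_le; [lra | | auto |].
      + apply I. intros x. apply (continuous_mult (K := R_AbsRing)); [apply continuous_const|].
        apply (continuous_plus (V := R_NormedModule)); auto.
      + intros x _. unfold W. rewrite Re_zpow_e. fold A. fold (w x).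
        apply Rmult_le_compat_l; [lra|].
        replace (p x + g x) with (w x * (1 - (2 * INR h - 31 / 10) * x ^ 2)) by (unfold p, g; field).
        apply Rmult_le_compat_l; [left; apply wpos|].
        apply cos_phase_ge; [lra | exact Hnear]. }
  assert (Lim : is_lim_seq (fun M => RInt W (- INR M) (INR M)) 0).
  { pose proof (line_int_zpow_e n kappa (2 * h - 2) H) as L.
    replace (2 + (2 * h - 2))%nat with (2 * h)%nat in L by lia.
    rewrite K0 in L. destruct L as [L _].
    apply is_lim_seq_ext with (fun M => (-1) ^ h * Re (CInt (zpow_e (2 * h) n) (- INR M) (INR M))).
    - intros M. symmetry. apply (RInt_scal (V := R_CompleteNormedModule)).
      apply I. intros x. exact (proj1 (zpow_e_cont (2 * h) n x)).
    - replace 0 with ((-1) ^ h * Re (RtoC (/ INR (fact (1 + (2 * h - 2)))) * (- twopii * RtoC (INR n)) ^ (2 * h - 2) * 0%R)%C).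
      + apply is_lim_seq_mult'; [apply is_lim_seq_const | exact L].
      + rewrite Cmult_0_r. simpl. ring. }
  assert (C0 : A * G <= 0).
  { apply (is_lim_seq_le_loc (fun _ => A * G) (fun M => RInt W (- INR M) (INR M)) (A * G) 0).
    (* The lower bound holds once the segment contains [[0, 1]], hence only from [M = 1] on. *)
    - exists 1%nat. exact Low.
    - apply is_lim_seq_const.
    - exact Lim. }
  nra.
Qed.

(** * The Bessel-type function sum (-X)^r / (r! (nu+r)!) *)

Definition psi_coef (nu r : nat) : R := (-1) ^ r / (INR (fact r) * INR (fact (nu + r))).

(* [J_nu(x) = (x/2)^nu * psi nu (x^2/4)]. *)
Definition psi (nu : nat) (X : R) : R := PSeries (psi_coef nu) X.

Lemma INR_fact_ge_1 r : 1 <= INR (fact r).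
Proof. apply (le_INR 1). apply lt_O_fact. Qed.

Lemma psi_radius nu (t : R) : Rbar_lt (Rabs t) (CV_radius (psi_coef nu)).
Proof.
  apply Rbar_lt_CV_radius with 1. intros r. unfold psi_coef, Rdiv.
  pose proof (INR_fact_ge_1 r). pose proof (INR_fact_ge_1 (nu + r)).
  rewrite pow1, Rabs_mult, pow_1_abs, !Rmult_1_l.
  rewrite Rabs_pos_eq by (left; apply Rinv_0_lt_compat; nra).
  apply Rinv_le_contravar; nra.
Qed.

Lemma ex_psi nu X : ex_pseries (psi_coef nu) X.
Proof. apply CV_radius_inside, psi_radius. Qed.

Lemma psi_0 nu : psi nu 0 = / INR (fact nu).
Proof.
  unfold psi. rewrite PSeries_0. unfold psi_coef. rewrite Nat.add_0_r. simpl.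
  pose proof (INR_fact_ge_1 nu). field. lra.
Qed.

Lemma is_derive_psi nu X : is_derive (psi nu) X (- psi (S nu) X).
Proof.
  eapply (eq_ind _ (is_derive _ X)); [apply is_derive_PSeries, psi_radius|].
  unfold psi. rewrite <- PSeries_opp. apply PSeries_ext. intros r.
  unfold PS_derive, PS_opp, psi_coef, opp; simpl opp.
  replace (nu + S r)%nat with (S nu + r)%nat by lia.
  rewrite (fact_simpl r), mult_INR, <- tech_pow_Rmult.
  pose proof (INR_fact_ge_1 r). pose proof (INR_fact_ge_1 (S nu + r)). pose proof (pos_INR r).
  rewrite S_INR. simpl. field. simpl in *. lra.
Qed.

(** The recurrence [J_nu + J_(nu+2) = (2 (nu+1) / x) J_(nu+1)] after division by [(x/2)^nu], checked
    on coefficients. *)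
Lemma psi_rec nu X : psi nu X + X * psi (2 + nu) X = INR (S nu) * psi (S nu) X.
Proof.
  unfold psi. rewrite <- PSeries_incr_1, <- PSeries_scal, <- PSeries_plus.
  - apply PSeries_ext. intros r.
    change (psi_coef nu r + PS_incr_1 (psi_coef (2 + nu)) r = INR (S nu) * psi_coef (S nu) r).
    unfold psi_coef. destruct r as [|r].
    + simpl PS_incr_1. rewrite !Nat.add_0_r, fact_simpl, mult_INR, S_INR.
      pose proof (INR_fact_ge_1 nu). pose proof (pos_INR nu).
      unfold zero; simpl. field. lra.
    + change (PS_incr_1 (fun r => (-1) ^ r / (INR (fact r) * INR (fact (2 + nu + r)))) (S r))
        with ((-1) ^ r / (INR (fact r) * INR (fact (2 + nu + r)))).
      replace (2 + nu + r)%nat with (S (S (nu + r))) by lia.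
      replace (nu + S r)%nat with (S (nu + r)) by lia.
      replace (S nu + S r)%nat with (S (S (nu + r))) by lia.
      rewrite !(fact_simpl (S (nu + r))), !(fact_simpl (nu + r)), (fact_simpl r).
      rewrite !mult_INR, !S_INR, plus_INR, <- tech_pow_Rmult.
      pose proof (INR_fact_ge_1 r). pose proof (INR_fact_ge_1 (nu + r)).
      pose proof (pos_INR r). pose proof (pos_INR nu).
      field. repeat split; lra.
  - apply ex_psi.
  - apply ex_pseries_incr_1, ex_psi.
Qed.

Lemma fact_add_ge nu r : INR (fact nu) * (INR nu + 1) ^ r <= INR (fact (nu + r)).
Proof.
  induction r as [|r IH].
  - rewrite Nat.add_0_r. simpl. lra.
  - replace (nu + S r)%nat with (S (nu + r)) by lia.
    rewrite fact_simpl, mult_INR, S_INR, plus_INR. simpl.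
    pose proof (INR_fact_ge_1 (nu + r)). pose proof (pos_INR r). pose proof (pos_INR nu).
    assert (0 <= INR (fact nu) * (INR nu + 1) ^ r).
    { apply Rmult_le_pos; [apply pos_INR | apply pow_le; lra]. }
    nra.
Qed.

(** The terms are dominated by a geometric series of ratio [q = X / (nu + 1) <= 1/4], so everything
    after the first term is at most [q / (1 - q) <= 1/3] of it. *)
Lemma psi_large nu X : 0 <= X -> 4 * X <= INR nu + 1 ->
  Rabs (psi nu X - / INR (fact nu)) <= / 3 * / INR (fact nu).
Proof.
  intros HX H. pose proof (INR_fact_ge_1 nu) as F. pose proof (pos_INR nu).
  set (q := X / (INR nu + 1)).
  assert (Hq0 : 0 <= q) by (apply Rdiv_le_0_compat; lra).
  assert (Hq : q <= / 4) by (apply Rle_div_l; lra).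
  assert (Hq1 : Rabs q < 1) by (rewrite Rabs_pos_eq; lra).
  pose proof (Series_tail_le (fun r => psi_coef nu r * X ^ r) (fun r => / INR (fact nu) * q ^ r) 0) as T.
  rewrite !sum_O in T. rewrite Series_scal_l, Series_geom in T by exact Hq1.
  unfold psi, PSeries.
  replace (/ INR (fact nu)) with (psi_coef nu 0 * X ^ 0) at 1.
  2: { unfold psi_coef. rewrite Nat.add_0_r. simpl. field. lra. }
  eapply Rle_trans; [apply T|].
  - intros r. unfold psi_coef, q, Rdiv.
    rewrite !Rabs_mult, pow_1_abs, Rmult_1_l.
    pose proof (INR_fact_ge_1 r). pose proof (fact_add_ge nu r) as G.
    assert (Pn : 0 < (INR nu + 1) ^ r) by (apply pow_lt; lra).
    rewrite Rpow_mult_distr, pow_inv, (Rabs_pos_eq (X ^ r)) by now apply pow_le.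
    replace (/ INR (fact nu) * (X ^ r * / (INR nu + 1) ^ r)) with
      (/ (INR (fact nu) * (INR nu + 1) ^ r) * X ^ r) by (field; lra).
    apply Rmult_le_compat_r; [now apply pow_le|].
    assert (P1 : 0 < INR (fact nu) * (INR nu + 1) ^ r) by (apply Rmult_lt_0_compat; lra).
    rewrite Rabs_pos_eq by (left; apply Rinv_0_lt_compat; nra).
    apply Rinv_le_contravar; nra.
  - apply (ex_series_scal_l (/ INR (fact nu)) (fun r => q ^ r)). now apply ex_series_geom.
  - simpl. rewrite Rmult_1_r.
    assert (P : 0 < / INR (fact nu)) by (apply Rinv_0_lt_compat; lra).
    assert (/ (1 - q) <= 4 / 3) by (replace (4 / 3) with (/ (3 / 4)) by field; apply Rinv_le_contravar; lra).
    nra.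
Qed.

(** In the recurrence, the ratio at [nu + 1] and [4 X <= (nu+1)(nu+2)] make [X psi_(nu+2)] at most
    half of [(nu+1) psi_(nu+1)]; the other half remains for [psi_nu]. The factor [2] also fits the
    start: it is the quotient of the bounds [4/3] and [2/3] from [psi_large]. *)
Lemma psi_ratio X nu : 0 <= X -> 4 * X <= (INR nu + 1) * (INR nu + 2) ->
  0 < psi (S nu) X /\ (INR nu + 1) * psi (S nu) X <= 2 * psi nu X.
Proof.
  intros HX.
  (* The descent starts at an order so large that [psi_large] applies; [d] is the distance to it. *)
  assert (D : forall d nu, 4 * X <= INR (nu + d) + 1 -> 4 * X <= (INR nu + 1) * (INR nu + 2) ->
    0 < psi (S nu) X /\ (INR nu + 1) * psi (S nu) X <= 2 * psi nu X).
  { clear nu. intros d. induction d as [|d IH]; intros nu Hd H.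
    - rewrite Nat.add_0_r in Hd.
      pose proof (psi_large nu X HX Hd) as P0.
      assert (Hd1 : 4 * X <= INR (S nu) + 1) by (rewrite S_INR; lra).
      pose proof (psi_large (S nu) X HX Hd1) as P1.
      pose proof (INR_fact_ge_1 nu) as F. pose proof (pos_INR nu).
      apply Rabs_le_between in P0, P1.
      rewrite fact_simpl, mult_INR, S_INR, Rinv_mult in P1.
      assert (Q0 : 0 < / INR (fact nu)) by (apply Rinv_0_lt_compat; lra).
      assert (Q1 : 0 < / (INR nu + 1)) by (apply Rinv_0_lt_compat; lra).
      assert (Q : 0 < / (INR nu + 1) * / INR (fact nu)) by now apply Rmult_lt_0_compat.
      split; [lra|].
      assert (B : psi (S nu) X <= 4 / 3 * (/ (INR nu + 1) * / INR (fact nu))) by lra.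
      apply Rmult_le_compat_l with (r := INR nu + 1) in B; [|lra].
      replace ((INR nu + 1) * (4 / 3 * (/ (INR nu + 1) * / INR (fact nu)))) with (4 / 3 * / INR (fact nu)) in B
        by (field; lra).
      lra.
    - pose proof (pos_INR nu).
      destruct (IH (S nu)) as [I1 I2].
      + replace (S nu + d)%nat with (nu + S d)%nat by lia. exact Hd.
      + rewrite S_INR. nra.
      + pose proof (psi_rec nu X) as R. simpl (2 + nu)%nat in R. rewrite !S_INR in *.
        assert (P : 0 < psi (S nu) X).
        { assert (0 < (INR nu + 1 + 1) * psi (S (S nu)) X) by (apply Rmult_lt_0_compat; lra). lra. }
        split; [exact P|].
        assert (J : X * psi (S (S nu)) X * (INR nu + 2) <= 2 * X * psi (S nu) X) by nra.
        assert (K : 2 * X * psi (S nu) X <= (INR nu + 1) * (INR nu + 2) / 2 * psi (S nu) X).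
        { apply Rmult_le_compat_r; lra. }
        assert (L : X * psi (S (S nu)) X <= (INR nu + 1) / 2 * psi (S nu) X).
        { apply Rmult_le_reg_r with (INR nu + 2); lra. }
        lra. }
  intros H.
  destruct (INR_unbounded (4 * X)) as [d Hd].
  apply (D d nu); [|exact H]. rewrite plus_INR. pose proof (pos_INR nu). lra.
Qed.

(** [psi_ratio] says that [psi_nu] decreases while [psi_nu(t) exp(2 t / (nu+1))] does not. It holds
    on all of [[0, X]], since its condition weakens as the argument shrinks; both functions equal
    [1 / nu!] at [0]. *)
Lemma psi_bounds X nu : 0 <= X -> 4 * X <= (INR nu + 1) * (INR nu + 2) ->
  0 < psi nu X <= / INR (fact nu) /\ exp (- (2 * X / (INR nu + 1))) * / INR (fact nu) <= psi nu X.
Proof.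
  intros HX H. pose proof (pos_INR nu) as N0.
  assert (Low : exp (- (2 * X / (INR nu + 1))) * / INR (fact nu) <= psi nu X).
  { set (f := fun t => psi nu t * exp (2 * t / (INR nu + 1))).
    set (df := fun t => - psi (S nu) t * exp (2 * t / (INR nu + 1)) +
         psi nu t * (2 / (INR nu + 1) * exp (2 * t / (INR nu + 1)))).
    assert (Df : forall t, is_derive f t (df t)).
    { intros t. apply (is_derive_mult (K := R_AbsRing) (psi nu) (fun t => exp (2 * t / (INR nu + 1)))); [apply is_derive_psi | | exact Rmult_comm].
      auto_derive; trivial. unfold Rdiv. ring. }
    destruct (MVT_gen f 0 X df) as [c [Hc E]].
    - intros t _. apply Df.
    - intros t _. apply continuity_pt_filterlim, (ex_derive_continuous (V := R_NormedModule)).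
      eexists. apply Df.
    - unfold f, df in E.
      rewrite Rmin_left, Rmax_right in Hc by exact HX.
      destruct (psi_ratio c nu) as [P1 P2]; [lra | nra |].
      pose proof (exp_pos (2 * c / (INR nu + 1))) as Ec.
      assert (D0 : 0 <= - psi (S nu) c * exp (2 * c / (INR nu + 1)) +
         psi nu c * (2 / (INR nu + 1) * exp (2 * c / (INR nu + 1)))).
      { replace (_ + _) with (exp (2 * c / (INR nu + 1)) * / (INR nu + 1) * (2 * psi nu c - (INR nu + 1) * psi (S nu) c))
          by (field; lra).
        apply Rmult_le_pos; [|lra]. apply Rmult_le_pos; [lra | left; apply Rinv_0_lt_compat; lra]. }
      rewrite psi_0 in E.
      replace (2 * 0 / (INR nu + 1)) with 0 in E by (field; lra). rewrite exp_0 in E.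
      rewrite exp_Ropp. pose proof (exp_pos (2 * X / (INR nu + 1))) as EX.
      rewrite Rmult_comm. apply (Rle_div_l (/ INR (fact nu)) (psi nu X) (exp (2 * X / (INR nu + 1)))); [exact EX|].
      nra. }
  assert (Fp : 0 < / INR (fact nu)) by (apply Rinv_0_lt_compat; pose proof (INR_fact_ge_1 nu); lra).
  split; [split|exact Low].
  - eapply Rlt_le_trans; [|exact Low]. apply Rmult_lt_0_compat; [apply exp_pos | exact Fp].
  - destruct (MVT_gen (psi nu) 0 X (fun t => - psi (S nu) t)) as [c [Hc E]].
    + intros t _. apply is_derive_psi.
    + intros t _. apply continuity_pt_filterlim, (ex_derive_continuous (V := R_NormedModule)).
      eexists. apply is_derive_psi.
    + rewrite Rmin_left, Rmax_right in Hc by exact HX.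
      destruct (psi_ratio c nu) as [P1 P2]; [lra | nra |].
      rewrite psi_0 in E. nra.
Qed.

Lemma CSeries_scal c a : Csummable a -> CSeries (fun r => c * a r)%C = (c * CSeries a)%C.
Proof.
  intros H. apply CSeries_unique.
  apply Clim_ext with (u := fun n => (c * csum a (seq 0 n))%C).
  - intros n. now rewrite csum_scal.
  - apply Clim_scal. now apply CSeries_lim.
Qed.

Lemma CSeries_RtoC (a : nat -> R) : CSeries (fun r => RtoC (a r)) = RtoC (Series a).
Proof.
  unfold CSeries, RtoC. f_equal. apply is_series_unique.
  change (is_lim_seq (sum_n (fun _ : nat => 0)) 0).
  apply is_lim_seq_ext with (fun _ => 0); [|apply is_lim_seq_const].
  intros n. rewrite sum_n_const. ring.
Qed.

Lemma ex_series_pow_fact (A : R) : ex_series (fun r => A ^ r / INR (fact r)).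
Proof.
  exists (exp A). pose proof (is_exp_Reals A) as E. apply is_pseries_R in E.
  eapply is_series_ext; [|exact E]. intros r. simpl. unfold Rdiv. ring.
Qed.

Lemma line_int_scal c f B : Ccont f -> line_int f B -> line_int (fun x => c * f x)%C (c * B)%C.
Proof.
  intros Hc H. unfold line_int.
  apply Clim_ext with (u := fun M => (c * CInt f (- INR M) (INR M))%C).
  - intros M. symmetry. apply CInt_scal. now apply Ccont_Cint.
  - now apply Clim_scal.
Qed.

Lemma twopii_sq : (twopii * twopii)%C = RtoC (- (4 * PI ^ 2)).
Proof. unfold twopii. apply C_eq; simpl; ring. Qed.

Lemma Cmod_twopii : Cmod twopii = 2 * PI.
Proof.
  replace twopii with (RtoC (2 * PI) * Ci)%C by (apply C_eq; simpl; ring).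
  rewrite Cmod_mult, Cmod_Ci, Cmod_R, Rabs_pos_eq; [ring | pose proof PI_RGT_0; lra].
Qed.

(** * The kernel z^(-k) e(-y/z) e(-nz) *)

(** What a row [(c, d)] becomes after the translation [z -> z + d/c], with [y = m / c^2]; constants
    and the phase are split off. *)
Definition bessel_kernel (k n : nat) (y x : R) : C :=
  (zpow_e k n x * e (RtoC (- y) * / (x, 1)%R))%C.

Lemma bessel_kernel_cont k n y : Ccont (bessel_kernel k n y).
Proof.
  apply CD_Ccont. intros x. eexists. apply CD_mult; [apply CD_zpow_e|].
  apply CD_e, CD_scal, CD_inv; [apply CD_line | apply line_nz].
Qed.

Lemma Cmod_e_neg_inv_le y x : 0 <= y -> Cmod (e (RtoC (- y) * / (x, 1)%R)%C) <= 1.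
Proof.
  intros Hy. rewrite Cmod_e. apply Rle_trans with (exp 0); [|rewrite exp_0; lra]. pose proof (one_plus_sq_pos x) as P.
  replace (-2 * PI * Im (RtoC (- y) * / (x, 1)%R)%C) with (- (2 * PI * (y * / (1 + x ^ 2)))).
  - assert (0 <= 2 * PI * (y * / (1 + x ^ 2))).
    { apply Rmult_le_pos; [pose proof PI_RGT_0; lra|].
      apply Rmult_le_pos; [exact Hy | left; now apply Rinv_0_lt_compat]. }
    destruct (Req_dec (2 * PI * (y * / (1 + x ^ 2))) 0) as [->|]; [rewrite Ropp_0; lra|].
    left. apply exp_increasing. lra.
  - simpl. field. nra.
Qed.

Lemma bessel_kernel_dominated k n y : (2 <= k)%nat -> 0 <= y ->
  dominated (bessel_kernel k n y) (exp (2 * PI * INR n)).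
Proof.
  intros Hk Hy. split; [apply bessel_kernel_cont|].
  intros x. unfold bessel_kernel. rewrite Cmod_mult.
  pose proof (Cmod_zpow_e_le k n x Hk). pose proof (Cmod_e_neg_inv_le y x Hy).
  pose proof (Cmod_ge_0 (zpow_e k n x)). nra.
Qed.

(** Expanding [e(-y/z)] in powers of [1/z] leaves only integrands whose integrals are multiples of
    [kappa]. *)
Lemma bessel_kernel_series k n y x : (2 <= k)%nat -> 0 <= y -> bessel_kernel k n y x =
  CSeries (fun r => RtoC (/ INR (fact r)) * (twopii * RtoC (- y)) ^ r * zpow_e (k + r) n x)%C.
Proof.
  intros Hk Hy. unfold bessel_kernel. rewrite e_series, <- CSeries_scal.
  - apply CSeries_ext. intros r. unfold zpow_e.
    pose proof (line_nz x) as L. pose proof (Cpow_nz _ k L). pose proof (Cpow_nz _ r L).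
    rewrite Cpow_add_r, (Cmult_assoc twopii), (Cpow_mult_l (twopii * RtoC (- y)) (/ (x, 1)%R)), Cpow_inv by exact L.
    field. auto.
  - exists (fun r => (2 * PI * y) ^ r / INR (fact r)). split; [apply ex_series_pow_fact|].
    intros r. pose proof (INR_fact_pos r) as F.
    rewrite Cmod_mult, Cmod_R, Cmod_pow, Rabs_pos_eq by (left; now apply Rinv_0_lt_compat).
    rewrite Rmult_comm. apply Rmult_le_compat_r; [left; now apply Rinv_0_lt_compat|].
    apply pow_incr. split; [apply Cmod_ge_0|].
    rewrite !Cmod_mult, Cmod_twopii, Cmod_R, Rabs_Ropp, Rabs_pos_eq, Cmod_inv by (trivial; apply line_nz).
    pose proof (Cmod_line_ge_1 x). pose proof PI_RGT_0.
    pose proof (Rinv_le_contravar 1 (Cmod (x, 1)) Rlt_0_1 (Cmod_line_ge_1 x)) as Q. rewrite Rinv_1 in Q.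
    rewrite <- Rmult_assoc. rewrite <- (Rmult_1_r (2 * PI * y)) at 2.
    apply Rmult_le_compat_l; [|lra]. apply Rmult_le_pos; lra.
Qed.

(** Each power of [-2 pi i y] from the expansion meets one of [-2 pi i n] from the integrals, giving
    [(-4 pi^2 y n)^r]; the factorials [r!] and [(k-1+r)!] are those of [psi]. *)
Lemma line_int_bessel_kernel k n y kappa : (2 <= k)%nat -> 0 <= y -> line_int (zpow_e 2 n) kappa ->
  line_int (bessel_kernel k n y)
    ((- twopii * RtoC (INR n)) ^ (k - 2) * kappa * RtoC (psi (k - 1) (4 * PI ^ 2 * y * INR n)))%C.
Proof.
  intros Hk Hy H.
  set (X := 4 * PI ^ 2 * y * INR n).
  set (D := ((- twopii * RtoC (INR n)) ^ (k - 2) * kappa)%C).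
  set (f := fun r x => (RtoC (/ INR (fact r)) * (twopii * RtoC (- y)) ^ r * zpow_e (k + r) n x)%C).
  set (B := fun r => (D * RtoC (psi_coef (k - 1) r * X ^ r))%C).
  assert (HB : forall r, line_int (f r) (B r)).
  { intros r. replace (B r) with (RtoC (/ INR (fact r)) * (twopii * RtoC (- y)) ^ r *
      (RtoC (/ INR (fact (1 + (k - 2 + r)))) * (- twopii * RtoC (INR n)) ^ (k - 2 + r) * kappa))%C.
    - apply line_int_scal; [apply zpow_e_cont|].
      replace (k + r)%nat with (2 + (k - 2 + r))%nat by lia. now apply line_int_zpow_e.
    - unfold B, D, psi_coef, X.
      replace (1 + (k - 2 + r))%nat with (k - 1 + r)%nat by lia.
      rewrite Cpow_add_r.
      replace ((-1) ^ r / (INR (fact r) * INR (fact (k - 1 + r))) * (4 * PI ^ 2 * y * INR n) ^ r)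
        with (/ INR (fact r) * / INR (fact (k - 1 + r)) * (- (4 * PI ^ 2) * y * INR n) ^ r).
      + rewrite !RtoC_mult, RtoC_pow, !RtoC_mult, <- twopii_sq.
        transitivity (RtoC (/ INR (fact r)) * RtoC (/ INR (fact (k - 1 + r))) * kappa *
          (- twopii * RtoC (INR n)) ^ (k - 2) * ((twopii * RtoC (- y)) ^ r * (- twopii * RtoC (INR n)) ^ r))%C; [ring|].
        rewrite <- Cpow_mult_l.
        replace (twopii * RtoC (- y) * (- twopii * RtoC (INR n)))%C with
          (twopii * twopii * RtoC y * RtoC (INR n))%C by (rewrite RtoC_opp; ring).
        ring.
      + replace (- (4 * PI ^ 2) * y * INR n) with (-1 * (4 * PI ^ 2 * y * INR n)) by ring.
        rewrite (Rpow_mult_distr (-1)). field. split; apply INR_fact_neq_0. }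
  assert (EB : CSeries B = (D * RtoC (psi (k - 1) X))%C).
  { unfold B. rewrite CSeries_scal, CSeries_RtoC; [reflexivity|].
    exists (fun r => Rabs (psi_coef (k - 1) r * X ^ r)). split.
    - apply (CV_disk_inside (psi_coef (k - 1)) X), psi_radius.
    - intros r. rewrite Cmod_R. apply Rle_refl. }
  rewrite <- EB.
  set (b := fun r => (2 * PI * y) ^ r / INR (fact r) * exp (2 * PI * INR n)).
  pose proof (line_int_CSeries f B b) as L.
  eapply Clim_ext; [|apply L].
  - intros M. apply CInt_ext; [pose proof (pos_INR M); lra|].
    intros x _. symmetry. now apply bessel_kernel_series.
  - apply ex_series_scal_r, ex_series_pow_fact.
  - intros r. split.
    + apply CD_Ccont. intros x. eexists. apply CD_scal, CD_zpow_e.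
    + intros x. unfold f, b. rewrite !Cmod_mult, Cmod_pow, Cmod_mult, Cmod_twopii, !Cmod_R.
      rewrite Rabs_Ropp, (Rabs_pos_eq y) by exact Hy.
      pose proof (INR_fact_pos r) as F. rewrite Rabs_pos_eq by (left; now apply Rinv_0_lt_compat).
      pose proof (Cmod_zpow_e_le (k + r) n x ltac:(lia)) as Z.
      assert (P : 0 <= / INR (fact r) * (2 * PI * y) ^ r).
      { apply Rmult_le_pos; [left; now apply Rinv_0_lt_compat|]. apply pow_le.
        pose proof PI_RGT_0. nra. }
      eapply Rle_trans; [apply Rmult_le_compat_l; [exact P | exact Z]|].
      unfold Rdiv. right. ring.
  - exact HB.
Qed.

(** * Summing over the rows with a fixed first entry *)

Definition row_phase (m n : nat) (c d : Z) : C :=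
  if Z.eqb (Z.gcd c d) 1
  then e (RtoC ((INR m * IZR (fst (complete_row c d)) + INR n * IZR d) / IZR c))
  else RtoC 0.

Lemma complete_row_spec c d : Z.gcd c d = 1%Z ->
  (fst (complete_row c d) * d - snd (complete_row c d) * c = 1)%Z.
Proof.
  intros H. unfold complete_row.
  apply (epsilon_spec (inhabits (0%Z, 0%Z)) (fun ab => (fst ab * d - snd ab * c = 1)%Z)).
  destruct (Z.gcd_bezout c d 1 H) as [u [v E]].
  exists (v, (- u)%Z). simpl. lia.
Qed.

(** Rests on [gamma z = a/c - 1 / (c^2 (z + d/c))] and [c z + d = c (z + d/c)]. *)
Lemma poincare_term_eq k m N n c d x : (0 < c)%Z -> (c mod Z.of_nat N = 0)%Z ->
  (poincare_term k m N (x, 1) c d * e (RtoC (- INR n) * (x, 1)%R))%C =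
  (RtoC (/ IZR c ^ k) * row_phase m n c d * bessel_kernel k n (INR m / IZR c ^ 2) (x + IZR d / IZR c))%C.
Proof.
  intros Hc HN. unfold poincare_term, row_phase. rewrite HN. simpl (Z.eqb 0 0).
  destruct (Z.eqb_spec (Z.gcd c d) 1) as [G|G]; cbv beta iota zeta delta [andb]; [|ring].
  pose proof (complete_row_spec c d G) as R.
  set (a := fst (complete_row c d)) in *. set (b := snd (complete_row c d)) in *.
  assert (Rr : IZR a * IZR d - IZR b * IZR c = 1) by (rewrite <- !mult_IZR, <- minus_IZR; now f_equal).
  assert (c0 : IZR c <> 0) by (apply not_0_IZR; lia).
  assert (Cc0 : RtoC (IZR c) <> 0%R) by (intros E; apply c0; now injection E).
  set (zu := (x + IZR d / IZR c, 1) : C).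
  assert (zu0 : zu <> 0%R) by apply line_nz.
  assert (Ez : ((x, 1) : C) = (zu - RtoC (IZR d / IZR c))%C) by (apply C_eq; simpl; ring).
  assert (Ed : RtoC (IZR d) = (RtoC (IZR c) * RtoC (IZR d / IZR c))%C).
  { rewrite <- RtoC_mult. f_equal. now field. }
  assert (Ej : (RtoC (IZR c) * (x, 1)%R + RtoC (IZR d))%C = (RtoC (IZR c) * zu)%C).
  { rewrite Ez, Ed. ring. }
  rewrite Ej, Defs_Cpow_eq.
  assert (Eg : (RtoC (INR m) * ((RtoC (IZR a) * (x, 1)%R + RtoC (IZR b)) / (RtoC (IZR c) * zu)))%C =
     (RtoC (INR m * IZR a / IZR c) + RtoC (- (INR m / IZR c ^ 2)) * / zu)%C).
  { assert (Eb : RtoC (IZR b) = ((RtoC (IZR a) * RtoC (IZR d) - RtoC 1) / RtoC (IZR c))%C).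
    { rewrite <- RtoC_mult, <- RtoC_minus, <- RtoC_div by exact c0. f_equal. rewrite <- Rr. field. exact c0. }
    rewrite Ez, Eb.
    replace (RtoC (INR m * IZR a / IZR c)) with (RtoC (INR m) * RtoC (IZR a) / RtoC (IZR c))%C
      by (now rewrite RtoC_div, RtoC_mult by exact c0).
    replace (RtoC (- (INR m / IZR c ^ 2))) with (- (RtoC (INR m) / (RtoC (IZR c) * RtoC (IZR c))))%C.
    2: { rewrite <- RtoC_mult, <- RtoC_div, <- RtoC_opp by nra. f_equal. field. exact c0. }
    replace (RtoC (IZR d / IZR c)) with (RtoC (IZR d) / RtoC (IZR c))%C by (now rewrite RtoC_div by exact c0).
    field. auto. }
  rewrite Eg, e_plus.
  assert (En : e (RtoC (- INR n) * (x, 1)%R)%C = (e (RtoC (- INR n) * zu) * e (RtoC (INR n * IZR d / IZR c)))%C).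
  { rewrite <- e_plus. f_equal. rewrite Ez. apply C_eq; simpl; field; exact c0. }
  rewrite En.
  replace (e (RtoC ((INR m * IZR a + INR n * IZR d) / IZR c))) with
    (e (RtoC (INR m * IZR a / IZR c)) * e (RtoC (INR n * IZR d / IZR c)))%C.
  2: { rewrite <- e_plus, <- RtoC_plus. f_equal. f_equal. field. exact c0. }
  unfold bessel_kernel, zpow_e. fold zu.
  rewrite Cpow_mult_l, RtoC_inv, RtoC_pow by (apply pow_nonzero; exact c0).
  pose proof (Cpow_nz _ k Cc0). pose proof (Cpow_nz _ k zu0).
  field. auto.
Qed.

(** The rows for [i] and [c L + i] are completed by independent choices of [epsilon]; their upper
    left entries are both inverses of [i] modulo [c], hence congruent, which is all that the phase
    sees. *)
Lemma row_phase_periodic m n c i L : (0 < c)%Z ->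
  row_phase m n c (c * L + i) = row_phase m n c i.
Proof.
  intros Hc. unfold row_phase.
  replace (Z.gcd c (c * L + i)) with (Z.gcd c i).
  2: { rewrite Z.add_comm, (Z.mul_comm c L). symmetry. apply Z.gcd_add_mult_diag_r. }
  destruct (Z.eqb_spec (Z.gcd c i) 1) as [G|G]; [|reflexivity].
  assert (G' : Z.gcd c (c * L + i) = 1%Z).
  { rewrite Z.add_comm, (Z.mul_comm c L). now rewrite Z.gcd_add_mult_diag_r. }
  pose proof (complete_row_spec c i G) as R1. pose proof (complete_row_spec c _ G') as R2.
  set (a := fst (complete_row c i)) in *. set (a' := fst (complete_row c (c * L + i))) in *.
  set (b := snd (complete_row c i)) in *. set (b' := snd (complete_row c (c * L + i))) in *.
  assert (Dv : exists q, (a' = a + q * c)%Z).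
  { assert (D : (c | a' - a)%Z).
    { apply Z.gauss with i; [|exact G].
      exists (b' - b - a' * L)%Z. lia. }
    destruct D as [q Q]. exists q. lia. }
  destruct Dv as [q ->].
  assert (c0 : IZR c <> 0) by (apply not_0_IZR; lia).
  rewrite <- (e_plus_Z (RtoC ((INR m * IZR a + INR n * IZR i) / IZR c)) (Z.of_nat m * q + Z.of_nat n * L)).
  rewrite <- RtoC_plus. f_equal. f_equal.
  rewrite !plus_IZR, !mult_IZR, <- !INR_IZR_INZ. field. exact c0.
Qed.

(** The classical [S(m, n; c)]: the upper left entry of a completed row is an inverse of [d] modulo
    [c]. *)
Definition kloosterman (m n : nat) (c : nat) : C :=
  csum (fun i => row_phase m n (Z.of_nat c) (Z.of_nat i)) (seq 0 c).

Lemma Ccont_shift f v : Ccont f -> Ccont (fun x => f (x + v)).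
Proof.
  intros H x.
  assert (S : continuous (fun x : R => x + v) x).
  { apply (ex_derive_continuous (V := R_NormedModule)). auto_derive. trivial. }
  split.
  - apply (continuous_comp (fun x => x + v) (fun t => Re (f t))); [exact S | exact (proj1 (H (x + v)))].
  - apply (continuous_comp (fun x => x + v) (fun t => Im (f t))); [exact S | exact (proj2 (H (x + v)))].
Qed.

Lemma CInt_unit_steps g u M : Ccont g ->
  csum (fun l => CInt g (u + INR l) (u + INR l + 1) + CInt g (u - INR l - 1) (u - INR l))%C (seq 0 M)
  = CInt g (u - INR M) (u + INR M).
Proof.
  intros Hg. assert (I : forall a b, Cint g a b) by (intros; now apply Ccont_Cint).
  induction M as [|M IH].
  - simpl. rewrite Rminus_0_r, Rplus_0_r. unfold CInt. now rewrite !RInt_point.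
  - rewrite csum_seq_S, IH, S_INR.
    rewrite <- (CInt_Chasles g (u - (INR M + 1)) (u - INR M) (u + (INR M + 1))) by apply I.
    rewrite <- (CInt_Chasles g (u - INR M) (u + INR M) (u + (INR M + 1))) by apply I.
    replace (u - (INR M + 1)) with (u - INR M - 1) by ring.
    replace (u + (INR M + 1)) with (u + INR M + 1) by ring.
    ring.
Qed.

(** Unfolding: the rows [d = c L + i] have the same phase and integrate one kernel over the unit
    intervals starting at [i/c + L], which tile the line. *)
Lemma Zsum_rows k m N n (c : nat) B : (1 <= c)%nat -> (2 <= k)%nat -> (Z.of_nat c mod Z.of_nat N = 0)%Z ->
  line_int (bessel_kernel k n (INR m / INR c ^ 2)) B ->
  let F := fun d => CInt (fun x => poincare_term k m N (x, 1) (Z.of_nat c) d * e (RtoC (- INR n) * (x, 1)%R))%C 0 1 in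
  Zsummable F -> Zsum F = (RtoC (/ INR c ^ k) * kloosterman m n c * B)%C.
Proof.
  intros Hc Hk HN HB F HF.
  set (g := bessel_kernel k n (INR m / INR c ^ 2)) in *.
  assert (gc : Ccont g) by apply bessel_kernel_cont.
  assert (y0 : 0 <= INR m / INR c ^ 2).
  { apply Rdiv_le_0_compat; [apply pos_INR|]. apply pow_lt, lt_0_INR. lia. }
  assert (c0 : 0 < INR c) by (apply lt_0_INR; lia).
  set (w := row_phase m n (Z.of_nat c)).
  assert (HFd : forall d, F d = (RtoC (/ INR c ^ k) * w d * CInt g (IZR d / INR c)%R (IZR d / INR c + 1)%R)%C).
  { intros d. unfold F.
    assert (E : forall x, (poincare_term k m N (x, 1) (Z.of_nat c) d * e (RtoC (- INR n) * (x, 1)%R))%C =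
       (RtoC (/ INR c ^ k) * w d * g (x + IZR d / INR c)%R)%C).
    { intros x. rewrite poincare_term_eq by (trivial; lia). rewrite <- INR_IZR_INZ. reflexivity. }
    rewrite (CInt_ext _ _ 0 1 Rle_0_1 (fun x _ => E x)).
    rewrite CInt_scal, CInt_shift; trivial.
    - now rewrite Rplus_0_l, (Rplus_comm 1).
    - now apply Ccont_Cint, Ccont_shift. }
  assert (HFp : forall (L : Z) (i : nat), F (Z.of_nat c * L + Z.of_nat i)%Z =
     (RtoC (/ INR c ^ k) * w (Z.of_nat i) * CInt g (INR i / INR c + IZR L)%R (INR i / INR c + IZR L + 1)%R)%C).
  { intros L i. rewrite HFd. unfold w. rewrite row_phase_periodic by lia.
    replace (IZR (Z.of_nat c * L + Z.of_nat i) / INR c) with (INR i / INR c + IZR L); [reflexivity|].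
    rewrite plus_IZR, mult_IZR, <- !INR_IZR_INZ. field. lra. }
  (* Partial sums are compared along [c * M], where both halves consist of whole blocks of
     residues. *)
  eapply Clim_unique.
  - apply (Clim_subseq (fun M => csum (fun i => F (Z.of_nat i)) (seq 0 M) +
      csum (fun i => F (- Z.of_nat i - 1)%Z) (seq 0 M))%C _ (fun M => (c * M)%nat)); [intros M; nia|].
    apply Zsum_lim, HF.
  - apply Clim_ext with (u := fun M => csum (fun i => RtoC (/ INR c ^ k) * w (Z.of_nat i) *
       CInt g (INR i / INR c - INR M)%R (INR i / INR c + INR M)%R)%C (seq 0 c)).
    + intros M. symmetry. rewrite !csum_seq_mul, <- csum_plus.
      transitivity (csum (fun l => csum (fun i => RtoC (/ INR c ^ k) * w (Z.of_nat i) *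
         (CInt g (INR i / INR c + INR l)%R (INR i / INR c + INR l + 1)%R +
          CInt g (INR i / INR c - INR l - 1)%R (INR i / INR c - INR l)%R))%C (seq 0 c)) (seq 0 M)).
      * apply csum_ext.
        (* Reversing a negative block turns its rows into [c (-l-1) + i], so that index [i] means
           the residue [i] in both halves. *)
        intros l _. rewrite <- (csum_rev_seq (fun i => F (- Z.of_nat (c * l + i) - 1)%Z)), <- csum_plus.
        apply csum_ext. intros i Hi. apply in_seq in Hi.
        replace (Z.of_nat (c * l + i)) with (Z.of_nat c * Z.of_nat l + Z.of_nat i)%Z by lia.
        replace (- Z.of_nat (c * l + (c - 1 - i)) - 1)%Z with (Z.of_nat c * (- Z.of_nat l - 1) + Z.of_nat i)%Z by lia.
        rewrite !HFp, minus_IZR, opp_IZR, <- INR_IZR_INZ.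
        replace (INR i / INR c + (- INR l - 1)) with (INR i / INR c - INR l - 1) by ring.
        replace (INR i / INR c - INR l - 1 + 1) with (INR i / INR c - INR l) by ring.
        ring.
      * rewrite csum_swap. apply csum_ext. intros i _.
        rewrite csum_scal, CInt_unit_steps by exact gc. reflexivity.
    + replace (RtoC (/ INR c ^ k) * kloosterman m n c * B)%C with
        (csum (fun i => RtoC (/ INR c ^ k) * w (Z.of_nat i) * B)%C (seq 0 c)).
      * apply Clim_csum. intros i Hi. apply in_seq in Hi. apply Clim_scal.
        eapply line_int_shift; [apply bessel_kernel_dominated; eassumption | | exact HB].
        split; [apply Rdiv_le_0_compat; [apply pos_INR | exact c0]|].
        apply Rle_div_l; [exact c0|]. rewrite Rmult_1_l. apply le_INR. lia.
      * unfold kloosterman. fold w.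
        rewrite (csum_ext _ (fun i => RtoC (/ INR c ^ k) * B * w (Z.of_nat i))%C) by (intros; ring).
        rewrite csum_scal. ring.
Qed.

(** * Fourier coefficients as sums over rows *)

Lemma exp_monotone x y : x <= y -> exp x <= exp y.
Proof. intros [H| ->]; [left; now apply exp_increasing | apply Rle_refl]. Qed.

Lemma automorphy_nz (c d : Z) x : Z.gcd c d = 1%Z ->
  (RtoC (IZR c) * (x, 1)%R + RtoC (IZR d))%C <> 0%R.
Proof.
  intros G E. pose proof (f_equal Im E) as E1. pose proof (f_equal Re E) as E2.
  simpl in E1, E2.
  assert (C0 : c = 0%Z) by (apply eq_IZR; lra). subst c.
  assert (D0 : d = 0%Z) by (apply eq_IZR; simpl in *; lra). subst d. discriminate.
Qed.

Lemma Cmod_automorphy_sq (c d : Z) x :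
  Cmod (RtoC (IZR c) * (x, 1)%R + RtoC (IZR d))%C ^ 2 = (IZR c * x + IZR d) ^ 2 + IZR c ^ 2.
Proof. rewrite Cmod2_alt. simpl. ring. Qed.

Lemma IZR_sq_ge_1 (c : Z) : c <> 0%Z -> 1 <= IZR c ^ 2.
Proof.
  intros H. replace (IZR c ^ 2) with (IZR (c * c)) by (rewrite mult_IZR; ring).
  apply IZR_le. nia.
Qed.

(** A product bound, so that the sums over [c] and [d] are dominated separately; each factor uses
    two powers of the automorphy factor, hence [4 <= k]. *)
Lemma Cmod_automorphy_pow_ge (c d : Z) x k : Z.gcd c d = 1%Z -> 0 <= x <= 1 -> (4 <= k)%nat ->
  (1 + IZR c ^ 2) * (1 + IZR d ^ 2) / 128 <=
  Cmod (RtoC (IZR c) * (x, 1)%R + RtoC (IZR d))%C ^ k.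
Proof.
  intros G Hx Hk. set (J := Cmod _).
  assert (J2 : J ^ 2 = (IZR c * x + IZR d) ^ 2 + IZR c ^ 2) by apply Cmod_automorphy_sq.
  assert (J0 : 0 <= J) by apply Cmod_ge_0.
  assert (CD : 1 <= IZR c ^ 2 \/ (IZR c = 0 /\ IZR d ^ 2 = 1)).
  { destruct (Z.eq_dec c 0) as [->|H]; [right|left; now apply IZR_sq_ge_1].
    rewrite Z.gcd_0_l in G. split; [reflexivity|].
    assert (H : d = 1%Z \/ d = (-1)%Z) by lia. destruct H as [-> | ->]; simpl; ring. }
  assert (J1 : 1 <= J ^ 2).
  { rewrite J2. destruct CD as [H|[H1 H2]].
    - pose proof (pow2_ge_0 (IZR c * x + IZR d)). lra.
    - rewrite H1. replace ((0 * x + IZR d) ^ 2 + 0 ^ 2) with (IZR d ^ 2) by ring. lra. }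
  assert (J1' : 1 <= J) by nra.
  (* From [d = (c x + d) - c x] and [x^2 <= 1]. Squaring the factor [8] gives [64], and
     [1 + c^2 <= 2 c^2] for [c <> 0] doubles it to [128]. *)
  assert (Q : (IZR c ^ 2 + IZR d ^ 2) / 8 <= J ^ 2).
  { rewrite J2. set (C := IZR c). set (D := IZR d).
    assert (Cx : (C * x) ^ 2 <= C ^ 2).
    { replace ((C * x) ^ 2) with (C ^ 2 * x ^ 2) by ring.
      pose proof (pow2_ge_0 C). assert (x ^ 2 <= 1) by nra. nra. }
    pose proof (pow2_ge_0 (3 * (C * x) + 2 * D)).
    pose proof (pow2_ge_0 (C * x)). pose proof (pow2_ge_0 C). pose proof (pow2_ge_0 D).
    pose proof (pow2_ge_0 (2 * (C * x) + D)). nra. }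
  apply Rle_trans with (J ^ 4).
  - replace (J ^ 4) with (J ^ 2 * J ^ 2) by ring.
    pose proof (pow2_ge_0 (IZR c)). pose proof (pow2_ge_0 (IZR d)).
    apply Rle_trans with ((IZR c ^ 2 + IZR d ^ 2) / 8 * ((IZR c ^ 2 + IZR d ^ 2) / 8)).
    + destruct CD as [H1|[H1 H2]].
      * set (C := IZR c ^ 2) in *. set (D := IZR d ^ 2) in *. nra.
      * rewrite H1, H2. lra.
    + apply Rmult_le_compat; lra.
  - apply Rle_pow; [exact J1' | exact Hk].
Qed.

Lemma Cmod_poincare_term_le k m N c d x : 0 <= x <= 1 -> (4 <= k)%nat ->
  Cmod (poincare_term k m N (x, 1) c d) <= 128 / ((1 + IZR c ^ 2) * (1 + IZR d ^ 2)).
Proof.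
  intros Hx Hk.
  assert (P : 0 < (1 + IZR c ^ 2) * (1 + IZR d ^ 2)) by (apply Rmult_lt_0_compat; apply one_plus_sq_pos).
  unfold poincare_term.
  destruct (Z.eqb (c mod Z.of_nat N) 0 && Z.eqb (Z.gcd c d) 1)%bool eqn:B.
  - apply Bool.andb_true_iff in B as [_ G]. apply Z.eqb_eq in G.
    pose proof (complete_row_spec c d G) as R.
    set (a := fst (complete_row c d)) in *. set (b := snd (complete_row c d)) in *. cbv zeta.
    pose proof (automorphy_nz c d x G) as Jnz.
    pose proof (Cmod_automorphy_pow_ge c d x k G Hx Hk) as L.
    pose proof (Cmod_automorphy_sq c d x) as J2.
    set (j := (RtoC (IZR c) * (x, 1)%R + RtoC (IZR d))%C) in *.
    rewrite Defs_Cpow_eq, Cmod_mult, Cmod_inv, Cmod_pow, Cmod_e by now apply Cpow_nz.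
    assert (J2p : 0 < Cmod j ^ 2) by (apply pow_lt; now apply Cmod_gt_0).
    (* Determinant one gives [Im (gamma z) = Im z / |j|^2], so the exponential has modulus at most
       [1]. *)
    assert (I : 0 <= Im (RtoC (INR m) * ((RtoC (IZR a) * (x, 1)%R + RtoC (IZR b)) / j))%C).
    { assert (Rr : IZR a * IZR d - IZR b * IZR c = 1) by (rewrite <- !mult_IZR, <- minus_IZR; now f_equal).
      replace (Im (RtoC (INR m) * ((RtoC (IZR a) * (x, 1)%R + RtoC (IZR b)) / j))%C) with
        (INR m * ((IZR a * IZR d - IZR b * IZR c) / Cmod j ^ 2)).
      - rewrite Rr. apply Rmult_le_pos; [apply pos_INR | apply Rdiv_le_0_compat; lra].
      - rewrite J2 in *. unfold j. simpl. field. simpl in J2p. nra. }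
    assert (E1 : exp (-2 * PI * Im (RtoC (INR m) * ((RtoC (IZR a) * (x, 1)%R + RtoC (IZR b)) / j))%C) <= 1).
    { apply Rle_trans with (exp 0); [|rewrite exp_0; lra].
      apply exp_monotone. pose proof PI_RGT_0. nra. }
    assert (P' : 0 < (1 + IZR c ^ 2) * (1 + IZR d ^ 2) / 128) by lra.
    apply Rle_trans with (/ Cmod j ^ k * 1).
    + apply Rmult_le_compat_l; [|exact E1]. left. apply Rinv_0_lt_compat. lra.
    + rewrite Rmult_1_r. replace (128 / ((1 + IZR c ^ 2) * (1 + IZR d ^ 2))) with
        (/ ((1 + IZR c ^ 2) * (1 + IZR d ^ 2) / 128)) by (field; split; nra).
      apply Rinv_le_contravar; assumption.
  - rewrite Cmod_0. apply Rdiv_le_0_compat; lra.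
Qed.

Lemma poincare_term_cont k m N c d : Ccont (fun x => poincare_term k m N (x, 1) c d).
Proof.
  unfold poincare_term.
  destruct (Z.eqb (c mod Z.of_nat N) 0 && Z.eqb (Z.gcd c d) 1)%bool eqn:B.
  - apply Bool.andb_true_iff in B as [_ G]. apply Z.eqb_eq in G.
    apply CD_Ccont. intros x. pose proof (automorphy_nz c d x G) as J.
    assert (CJ : forall a b : Z, exists l, CD (fun x => (RtoC (IZR a) * (x, 1)%R + RtoC (IZR b))%C) x l).
    { intros a b. eexists. apply CD_plus; [apply CD_scal, CD_line | apply CD_const]. }
    destruct (CJ c d) as [l1 H1].
    destruct (CJ (fst (complete_row c d)) (snd (complete_row c d))) as [l2 H2].
    eexists.
    apply (CD_ext (fun x => (/ (RtoC (IZR c) * (x, 1)%R + RtoC (IZR d)) ^ k *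
      e (RtoC (INR m) * ((RtoC (IZR (fst (complete_row c d))) * (x, 1)%R + RtoC (IZR (snd (complete_row c d)))) *
         / (RtoC (IZR c) * (x, 1)%R + RtoC (IZR d)))))%C)).
    + intros t. rewrite <- (Defs_Cpow_eq _ k); reflexivity.
    + apply CD_mult.
      * apply CD_inv; [apply CD_pow; exact H1 | now apply Cpow_nz].
      * apply CD_e, CD_scal, CD_mult; [exact H2 | apply CD_inv; [exact H1 | exact J]].
  - apply CD_Ccont. intros x. eexists. apply CD_const.
Qed.

Lemma Ccont_mult f g : Ccont f -> Ccont g -> Ccont (fun x => f x * g x)%C.
Proof.
  intros Hf Hg x. destruct (Hf x), (Hg x). split.
  - apply (continuous_minus (V := R_NormedModule)); apply (continuous_mult (K := R_AbsRing)); assumption.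
  - apply (continuous_plus (V := R_NormedModule)); apply (continuous_mult (K := R_AbsRing)); assumption.
Qed.

Lemma e_line_cont (t : R) : Ccont (fun x => e (RtoC t * (x, 1)%R)%C).
Proof. apply CD_Ccont. intros x. eexists. apply CD_e, CD_scal, CD_line. Qed.

(** Majorises inverse squares with an explicit sum: first for [inv_sq], later for the rows beyond
    the main one, where the value [1] matters. *)
Lemma is_series_telescope : is_series (fun i => / (INR i + 1) - / (INR i + 2)) 1.
Proof.
  change (is_lim_seq (sum_n (fun i => / (INR i + 1) - / (INR i + 2))) 1).
  apply is_lim_seq_ext with (fun n => 1 - / (INR n + 2)).
  - intros n. induction n as [|n IH].
    + rewrite sum_O. simpl. field.
    + rewrite sum_Sn, <- IH, S_INR. unfold plus; simpl.
      pose proof (pos_INR n). field. lra.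
  - replace (Finite 1) with (Finite (1 - 0)) by (f_equal; ring).
    apply is_lim_seq_minus'; [apply is_lim_seq_const|].
    apply is_lim_seq_inv with (l := p_infty); [|discriminate].
    apply is_lim_seq_plus with (l1 := p_infty) (l2 := Finite 2);
      [apply is_lim_seq_INR | apply is_lim_seq_const | reflexivity].
Qed.

Definition inv_sq (i : nat) : R := / (1 + INR i ^ 2).

Lemma inv_sq_pos i : 0 < inv_sq i.
Proof. apply Rinv_0_lt_compat, one_plus_sq_pos. Qed.

Lemma ex_series_inv_sq : ex_series inv_sq.
Proof.
  apply (ex_series_le (V := R_CompleteNormedModule)) with (fun i => 4 * (/ (INR i + 1) - / (INR i + 2))).
  - intros i. unfold norm; simpl. unfold abs; simpl.
    rewrite Rabs_pos_eq by (left; apply inv_sq_pos).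
    pose proof (pos_INR i) as P. unfold inv_sq.
    replace (4 * (/ (INR i + 1) - / (INR i + 2))) with (/ ((INR i + 1) * (INR i + 2) / 4)) by (field; lra).
    apply Rinv_le_contravar; [apply Rdiv_lt_0_compat; nra | nra].
  - apply (ex_series_scal_l 4 (fun i => / (INR i + 1) - / (INR i + 2))). eexists. apply is_series_telescope.
Qed.

Lemma inv_sq_nat i : / (1 + IZR (Z.of_nat i) ^ 2) = inv_sq i.
Proof. unfold inv_sq. now rewrite <- INR_IZR_INZ. Qed.

Lemma inv_sq_neg i : / (1 + IZR (- Z.of_nat i - 1) ^ 2) <= inv_sq i.
Proof.
  unfold inv_sq. rewrite minus_IZR, opp_IZR, <- INR_IZR_INZ. pose proof (pos_INR i).
  apply Rinv_le_contravar; nra.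
Qed.

Lemma Zsummable_of_inv_sq (f : Z -> C) K : 0 <= K -> (forall d, Cmod (f d) <= K * / (1 + IZR d ^ 2)) ->
  Zsummable f /\ Cmod (Zsum f) <= 2 * (K * Series inv_sq).
Proof.
  intros HK H.
  assert (B : forall n, Cmod (f (Z.of_nat n)) <= K * inv_sq n /\ Cmod (f (- Z.of_nat n - 1)%Z) <= K * inv_sq n).
  { intros n. split.
    - rewrite <- inv_sq_nat. apply H.
    - eapply Rle_trans; [apply H|]. apply Rmult_le_compat_l; [exact HK | apply inv_sq_neg]. }
  assert (S : ex_series (fun n => K * inv_sq n)) by apply (ex_series_scal_l K inv_sq), ex_series_inv_sq.
  split; [exists (fun n => K * inv_sq n); auto|].
  unfold Zsum. eapply Rle_trans; [apply Cmod_triangle|].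
  rewrite <- Series_scal_l.
  pose proof (CSeries_Cmod_le _ _ (fun n => proj1 (B n)) S).
  pose proof (CSeries_Cmod_le _ _ (fun n => proj2 (B n)) S). lra.
Qed.

Lemma Zsum_scal f (c : C) : Zsummable f -> (Zsum f * c)%C = Zsum (fun d => f d * c)%C.
Proof.
  intros H. unfold Zsum. rewrite Cmult_plus_distr_r. f_equal.
  - rewrite Cmult_comm, <- CSeries_scal by now apply Zsummable_pos.
    apply CSeries_ext. intros; ring.
  - rewrite Cmult_comm, <- CSeries_scal by now apply Zsummable_neg.
    apply CSeries_ext. intros; ring.
Qed.

Lemma Zsum_zero (f : Z -> C) : (forall d, f d = 0%R) -> Zsum f = 0%R.
Proof.
  intros H. rewrite (Zsum_ext f (fun _ => RtoC 0) H). unfold Zsum.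
  rewrite (CSeries_unique (fun _ => RtoC 0) 0%R); [ring|].
  apply Clim_ext with (u := fun _ => RtoC 0); [|apply Clim_const].
  intros n. symmetry. now apply csum_zero.
Qed.

Definition row_coef (k m N n : nat) (c d : Z) : C :=
  CInt (fun x => poincare_term k m N (x, 1) c d * e (RtoC (- INR n) * (x, 1)%R))%C 0 1.

Lemma Cmod_row_term_le k m N n c d x : 0 <= x <= 1 -> (4 <= k)%nat ->
  Cmod (poincare_term k m N (x, 1) c d * e (RtoC (- INR n) * (x, 1)%R))%C <=
  128 * exp (2 * PI * INR n) * / (1 + IZR c ^ 2) * / (1 + IZR d ^ 2).
Proof.
  intros Hx Hk. rewrite Cmod_mult, Cmod_e.
  replace (-2 * PI * Im (RtoC (- INR n) * (x, 1)%R)%C) with (2 * PI * INR n) by (simpl; ring).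
  pose proof (one_plus_sq_pos (IZR c)). pose proof (one_plus_sq_pos (IZR d)).
  replace (128 * exp (2 * PI * INR n) * / (1 + IZR c ^ 2) * / (1 + IZR d ^ 2)) with
    (128 / ((1 + IZR c ^ 2) * (1 + IZR d ^ 2)) * exp (2 * PI * INR n)) by (field; lra).
  apply Rmult_le_compat_r; [left; apply exp_pos | now apply Cmod_poincare_term_le].
Qed.

Lemma row_term_Cint k m N n c d :
  Cint (fun x => poincare_term k m N (x, 1) c d * e (RtoC (- INR n) * (x, 1)%R))%C 0 1.
Proof. apply Ccont_Cint, Ccont_mult; [apply poincare_term_cont | apply e_line_cont]. Qed.

Lemma Cmod_row_coef_le k m N n c d : (4 <= k)%nat ->
  Cmod (row_coef k m N n c d) <=
  256 * exp (2 * PI * INR n) * / (1 + IZR c ^ 2) * / (1 + IZR d ^ 2).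
Proof.
  intros Hk. eapply Rle_trans.
  - apply (CInt_Cmod_le_const _ (128 * exp (2 * PI * INR n) * / (1 + IZR c ^ 2) * / (1 + IZR d ^ 2)));
      [lra | apply row_term_Cint | intros; now apply Cmod_row_term_le].
  - right. ring.
Qed.

Lemma exp_inv_sq_nonneg K n (c : Z) : 0 <= K -> 0 <= K * exp (2 * PI * INR n) * / (1 + IZR c ^ 2).
Proof.
  intros HK. pose proof (exp_pos (2 * PI * INR n)).
  apply Rmult_le_pos; [nra | left; apply Rinv_0_lt_compat, one_plus_sq_pos].
Qed.

Lemma Zsummable_row_coef k m N n c : (4 <= k)%nat -> Zsummable (row_coef k m N n c).
Proof.
  intros Hk. eapply Zsummable_of_inv_sq; [apply exp_inv_sq_nonneg with (K := 256); lra|].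
  intros d. now apply Cmod_row_coef_le.
Qed.

Lemma Zsummable_row_sums k m N n : (4 <= k)%nat -> Zsummable (fun c => Zsum (row_coef k m N n c)).
Proof.
  intros Hk. pose proof (Rlt_le _ _ (exp_pos (2 * PI * INR n))) as E0.
  assert (S0 : 0 <= Series inv_sq).
  { eapply Rle_trans; [|apply (Series_nonneg_partial_le inv_sq 0);
      [intros; left; apply inv_sq_pos | apply ex_series_inv_sq]]. rewrite sum_O; left; apply inv_sq_pos. }
  apply Zsummable_of_inv_sq with (K := 2 * (256 * exp (2 * PI * INR n) * Series inv_sq)).
  - apply Rmult_le_pos; [lra|]. apply Rmult_le_pos; [lra | exact S0].
  - intros c. eapply Rle_trans.
    + apply Zsummable_of_inv_sq with (K := 256 * exp (2 * PI * INR n) * / (1 + IZR c ^ 2)).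
      * apply exp_inv_sq_nonneg. lra.
      * intros d. now apply Cmod_row_coef_le.
    + right. ring.
Qed.

(** Termwise integration twice, over [d] for fixed [c] and then over [c]; the product majorant makes
    each row sum [O(1 / (1 + c^2))]. *)
Lemma pcoef_eq k m N n : (4 <= k)%nat ->
  pcoef k m N n = Zsum (fun c => Zsum (row_coef k m N n c)).
Proof.
  intros Hk.
  set (f := fun c d x => (poincare_term k m N (x, 1) c d * e (RtoC (- INR n) * (x, 1)%R))%C).
  assert (S0 : 0 <= Series inv_sq).
  { eapply Rle_trans; [|apply (Series_nonneg_partial_le inv_sq 0);
      [intros; left; apply inv_sq_pos | apply ex_series_inv_sq]]. rewrite sum_O; left; apply inv_sq_pos. }
  set (A := 128 * exp (2 * PI * INR n)).
  assert (A0 : 0 <= A) by (unfold A; pose proof (exp_pos (2 * PI * INR n)); lra).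
  assert (Ac : forall c : Z, 0 <= A * / (1 + IZR c ^ 2)).
  { intros c. apply exp_inv_sq_nonneg. lra. }
  assert (Row : forall c, Cint (fun x => Zsum (fun d => f c d x)) 0 1 /\
     CInt (fun x => Zsum (fun d => f c d x)) 0 1 = Zsum (row_coef k m N n c)).
  { intros c. apply (CInt_Zsum (f c) (fun i => A * / (1 + IZR c ^ 2) * inv_sq i)); [lra | | |].
    - intros i x Hx. split.
      + rewrite <- inv_sq_nat. now apply Cmod_row_term_le.
      + eapply Rle_trans; [now apply Cmod_row_term_le|].
        apply Rmult_le_compat_l; [apply Ac | apply inv_sq_neg].
    - apply (ex_series_scal_l _ inv_sq), ex_series_inv_sq.
    - intros d. apply row_term_Cint. }
  assert (Sd : forall c x, 0 <= x <= 1 -> Zsummable (fun d => f c d x) /\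
     Cmod (Zsum (fun d => f c d x)) <= 2 * (A * Series inv_sq) * / (1 + IZR c ^ 2)).
  { intros c x Hx.
    destruct (Zsummable_of_inv_sq (fun d => f c d x) (A * / (1 + IZR c ^ 2)) (Ac c)) as [H1 H2].
    - intros d. now apply Cmod_row_term_le.
    - split; [exact H1|]. eapply Rle_trans; [exact H2|]. right. ring. }
  set (A2 := 2 * (A * Series inv_sq)) in *.
  assert (A20 : 0 <= A2) by (unfold A2; apply Rmult_le_pos; [lra|]; now apply Rmult_le_pos).
  destruct (CInt_Zsum (fun c x => Zsum (fun d => f c d x)) (fun i => A2 * inv_sq i) 0 1 Rle_0_1) as [_ E].
  - intros i x Hx. split.
    + rewrite <- inv_sq_nat. now apply Sd.
    + eapply Rle_trans; [now apply Sd|]. apply Rmult_le_compat_l; [exact A20 | apply inv_sq_neg].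
  - apply (ex_series_scal_l _ inv_sq), ex_series_inv_sq.
  - intros c. apply Row.
  - rewrite (Zsum_ext _ _ (fun c => proj2 (Row c))) in E. rewrite <- E.
    change (pcoef k m N n) with
      (CInt (fun x => Poincare k m N (x, 1) * e (RtoC (- INR n) * (x, 1)%R))%C 0 1).
    apply CInt_ext; [lra|]. intros x Hx.
    unfold Poincare.
    set (u := e (RtoC (- INR n) * (x, 1)%R)%C).
    assert (u0 : u <> 0%R) by apply e_nz.
    (* Moving the factor [u] inside both sums needs the summability of the terms without it. *)
    assert (St : forall c, Zsummable (fun d => poincare_term k m N (x, 1) c d) /\
       Cmod (Zsum (fun d => poincare_term k m N (x, 1) c d)) <= 2 * (128 * Series inv_sq) * / (1 + IZR c ^ 2)).
    { intros c.
      destruct (Zsummable_of_inv_sq (fun d => poincare_term k m N (x, 1) c d) (128 * / (1 + IZR c ^ 2))) as [H1 H2].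
      - apply Rmult_le_pos; [lra | left; apply Rinv_0_lt_compat, one_plus_sq_pos].
      - intros d. eapply Rle_trans; [now apply Cmod_poincare_term_le|].
        right. pose proof (one_plus_sq_pos (IZR c)). pose proof (one_plus_sq_pos (IZR d)). field. lra.
      - split; [exact H1|]. eapply Rle_trans; [exact H2|]. right. ring. }
    rewrite Zsum_scal.
    + apply Zsum_ext. intros c. rewrite Zsum_scal by apply St. reflexivity.
    + eapply Zsummable_of_inv_sq; [|intros c; apply St]. apply Rmult_le_pos; lra.
Qed.

(** [-gamma] acts as [gamma], and [k] is even. The chosen top rows differ from opposite ones by a
    multiple [q] of the bottom row, which shifts [gamma z] by the integer [q]. *)
Lemma poincare_term_opp k m N x c d : Nat.Even k -> (1 <= N)%nat ->
  poincare_term k m N (x, 1) (- c) (- d) = poincare_term k m N (x, 1) c d.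
Proof.
  intros [h Hk] HN. unfold poincare_term.
  assert (EN : Z.eqb ((- c) mod Z.of_nat N) 0 = Z.eqb (c mod Z.of_nat N) 0).
  { apply Bool.eq_iff_eq_true. rewrite !Z.eqb_eq, !Z.mod_divide by lia. apply Z.divide_opp_r. }
  rewrite EN, Z.gcd_opp_l, Z.gcd_opp_r.
  destruct (Z.eqb (c mod Z.of_nat N) 0); [|reflexivity].
  destruct (Z.eqb_spec (Z.gcd c d) 1) as [G|G]; [|reflexivity]. cbv beta iota zeta delta [andb].
  assert (G' : Z.gcd (- c) (- d) = 1%Z) by now rewrite Z.gcd_opp_l, Z.gcd_opp_r.
  pose proof (complete_row_spec c d G) as R1. pose proof (complete_row_spec _ _ G') as R2.
  pose proof (automorphy_nz c d x G) as J.
  set (a := fst (complete_row c d)) in *. set (b := snd (complete_row c d)) in *.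
  set (a' := fst (complete_row (- c) (- d))) in *. set (b' := snd (complete_row (- c) (- d))) in *.
  assert (Ej : (RtoC (IZR (- c)) * (x, 1)%R + RtoC (IZR (- d)))%C = (- (RtoC (IZR c) * (x, 1)%R + RtoC (IZR d)))%C).
  { rewrite !opp_IZR, !RtoC_opp. ring. }
  rewrite Ej. set (j := (RtoC (IZR c) * (x, 1)%R + RtoC (IZR d))%C) in *.
  (* The determinant of the two top rows, as Cramer's rule gives it. *)
  set (q := (b * a' - a * b')%Z).
  assert (Qa : (a' = - a - q * c)%Z).
  { assert (E : (q * c = a' * (b * c) - a * (b' * c))%Z) by (unfold q; ring).
    replace (b * c)%Z with (a * d - 1)%Z in E by lia.
    replace (b' * c)%Z with (a' * d + 1)%Z in E by lia. lia. }
  assert (Qb : (b' = - b - q * d)%Z).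
  { assert (E : (q * d = b * (a' * d) - b' * (a * d))%Z) by (unfold q; ring).
    replace (a * d)%Z with (b * c + 1)%Z in E by lia.
    replace (a' * d)%Z with (b' * c - 1)%Z in E by lia. lia. }
  clearbody q. f_equal.
  - f_equal. rewrite !Defs_Cpow_eq. subst k. rewrite !Cpow_mult_r. f_equal. simpl. ring.
  - rewrite <- (e_plus_Z (RtoC (INR m) * ((RtoC (IZR a) * (x, 1)%R + RtoC (IZR b)) / j)) (Z.of_nat m * q)).
    f_equal. rewrite mult_IZR, <- INR_IZR_INZ, RtoC_mult.
    assert (Ea : (RtoC (IZR a') * (x, 1)%R + RtoC (IZR b'))%C =
      (- (RtoC (IZR a) * (x, 1)%R + RtoC (IZR b)) - RtoC (IZR q) * j)%C).
    { rewrite Qa, Qb. unfold j. rewrite !minus_IZR, !opp_IZR, !mult_IZR, !RtoC_minus, !RtoC_opp, !RtoC_mult. ring. }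
    rewrite Ea. field. exact J.
Qed.

Lemma CInt_zero f a b : a <= b -> (forall x, a <= x <= b -> f x = RtoC 0) -> CInt f a b = RtoC 0.
Proof.
  intros Hab H. rewrite (CInt_ext f (fun _ => RtoC 0) a b Hab H).
  unfold CInt. simpl. rewrite RInt_const. apply C_eq; simpl; unfold scal; simpl; unfold mult; simpl; ring.
Qed.

Lemma row_sum_even k m N n c : Nat.Even k -> (4 <= k)%nat -> (1 <= N)%nat ->
  Zsum (row_coef k m N n (- c)) = Zsum (row_coef k m N n c).
Proof.
  intros He Hk HN. rewrite <- (Zsum_opp (row_coef k m N n (- c))) by now apply Zsummable_row_coef.
  apply Zsum_ext. intros d. unfold row_coef. apply CInt_ext; [lra|].
  intros x _. now rewrite poincare_term_opp.
Qed.

Lemma row_sum_zero k m N n c : (c mod Z.of_nat N <> 0)%Z -> Zsum (row_coef k m N n c) = RtoC 0.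
Proof.
  intros H. apply Zsum_zero. intros d. apply CInt_zero; [lra|].
  intros x _. unfold poincare_term.
  destruct (Z.eqb_spec (c mod Z.of_nat N) 0) as [E|E]; [contradiction|]. simpl andb. cbv iota. ring.
Qed.

(** The diagonal term: coprimality forces [d = 1] or [d = -1], and the integrand is a constant times
    [e((m-n) z)], whose primitive has period one. *)
Lemma row_sum_0 k m N n : m <> n -> Zsum (row_coef k m N n 0) = RtoC 0.
Proof.
  intros Hmn. apply Zsum_zero. intros d. unfold row_coef.
  destruct (Z.eq_dec (Z.gcd 0 d) 1) as [G|G].
  2: { apply CInt_zero; [lra|]. intros x _. unfold poincare_term.
       destruct (Z.eqb_spec (Z.gcd 0 d) 1); [contradiction|].
       rewrite Bool.andb_false_r. ring. }
  destruct (Z.eqb (0 mod Z.of_nat N) 0) eqn:EN.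
  2: { apply CInt_zero; [lra|]. intros x _. unfold poincare_term. rewrite EN. simpl andb. cbv iota. ring. }
  pose proof (complete_row_spec 0 d G) as R.
  set (a := fst (complete_row 0 d)) in *. set (b := snd (complete_row 0 d)) in *.
  assert (Hd : d = 1%Z \/ d = (-1)%Z) by (rewrite Z.gcd_0_l in G; lia).
  assert (D0 : RtoC (IZR d) <> 0%R).
  { intros E. injection E as E. destruct Hd as [-> | ->]; simpl in E; lra. }
  set (K := (/ (RtoC (IZR d)) ^ k * e (RtoC (INR m * IZR b * IZR d)))%C).
  set (t := INR m - INR n).
  assert (T0 : t <> 0) by (unfold t; intros E; apply Hmn, INR_eq; lra).
  assert (CT0 : RtoC t <> 0%R) by (intros E; apply T0; now injection E).
  assert (P0 : twopii <> 0%R).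
  { intros E. apply (f_equal Im) in E. simpl in E. pose proof PI_RGT_0. lra. }
  rewrite (CInt_ext _ (fun x => K * e (RtoC t * (x, 1)%R))%C); [|lra|].
  2: { intros x _. unfold poincare_term. rewrite EN. destruct (Z.eqb_spec (Z.gcd 0 d) 1); [|contradiction].
       cbv beta iota zeta delta [andb]. fold a b. rewrite Defs_Cpow_eq.
       replace (RtoC (IZR 0) * (x, 1)%R + RtoC (IZR d))%C with (RtoC (IZR d)) by ring.
       unfold K. rewrite <- !Cmult_assoc, <- !e_plus. f_equal. f_equal.
       assert (Ead : (a * d = 1)%Z) by lia.
       apply (f_equal IZR) in Ead. rewrite mult_IZR in Ead.
       assert (Edd : IZR d * IZR d = 1) by (destruct Hd as [-> | ->]; simpl; ring).
       assert (Ea : IZR a = IZR d).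
       { transitivity (IZR a * (IZR d * IZR d)); [rewrite Edd; ring|].
         rewrite <- Rmult_assoc, Ead. ring. }
       rewrite Ea.
       assert (Ei : (/ RtoC (IZR d))%C = RtoC (IZR d)).
       { rewrite <- RtoC_inv.
         - f_equal. destruct Hd as [-> | ->]; simpl; field.
         - intros E. apply D0. now rewrite E. }
       unfold Cdiv. rewrite Ei.
       transitivity (RtoC (INR m) * (RtoC (IZR d * IZR d) * (x, 1)%R + RtoC (IZR b) * RtoC (IZR d)) + RtoC (- INR n) * (x, 1)%R)%C.
       - rewrite RtoC_mult. ring.
       - rewrite Edd. unfold t. rewrite RtoC_minus, RtoC_opp, !RtoC_mult. ring. }
  rewrite CInt_scal by apply Ccont_Cint, e_line_cont.
  rewrite (CInt_FTC (fun x => / (twopii * RtoC t) * e (RtoC t * (x, 1)%R))%C).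
  - replace (RtoC t * (1, 1)%R)%C with (RtoC t * (0, 1)%R + RtoC (IZR (Z.of_nat m - Z.of_nat n)))%C.
    + rewrite e_plus_Z. ring.
    + rewrite minus_IZR, <- !INR_IZR_INZ. apply C_eq; simpl; unfold t; ring.
  - intros x. eapply CD_eq; [apply CD_scal, CD_e, CD_scal, CD_line|].
    cbv beta. field. auto.
  - apply e_line_cont.
Qed.

Lemma pcoef_offdiag k m N n : Nat.Even k -> (4 <= k)%nat -> (1 <= N)%nat -> m <> n ->
  pcoef k m N n = (2%R * CSeries (fun i => Zsum (row_coef k m N n (Z.of_nat (S i)))))%C.
Proof.
  intros He Hk HN Hmn. rewrite pcoef_eq by exact Hk.
  apply (Zsum_even (fun c => Zsum (row_coef k m N n c))).
  - now apply Zsummable_row_sums.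
  - intros c. now apply row_sum_even.
  - now apply row_sum_0.
Qed.

(** Prepares the contradiction in [pcoef_nonzero]: if the coefficient vanishes, the row of smallest
    positive [c] must be cancelled by all others. *)
Lemma pcoef_partial_sums k m N n : Nat.Even k -> (4 <= k)%nat -> (1 <= N)%nat -> m <> n ->
  pcoef k m N n = RtoC 0 ->
  Clim (fun M => csum (fun j => Zsum (row_coef k m N n (Z.of_nat (N * S j)))) (seq 0 M)) (RtoC 0).
Proof.
  intros He Hk HN Hmn H0. rewrite pcoef_offdiag in H0 by trivial.
  set (h := fun i => Zsum (row_coef k m N n (Z.of_nat (S i)))) in *.
  assert (E0 : CSeries h = RtoC 0).
  { transitivity (/ 2%R * (2%R * CSeries h))%C.
    - field.
    - rewrite H0. ring. }
  (* Index [i] stands for [c = i + 1], so the multiple of [N] is the last entry of each block. *)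
  assert (LastN : forall g : nat -> C, csum g (seq 0 N) = (csum g (seq 0 (N - 1)) + g (N - 1)%nat)%C).
  { intros g. rewrite <- csum_seq_S. f_equal. f_equal. lia. }
  rewrite <- E0.
  apply Clim_ext with (u := fun M => csum h (seq 0 (N * M))).
  - intros M. rewrite csum_seq_mul. apply csum_ext. intros l _.
    rewrite LastN.
    rewrite csum_zero.
    + unfold h. replace (S (N * l + (N - 1))) with (N * S l)%nat by lia. ring.
    + intros i Hi. apply in_seq in Hi. unfold h. apply row_sum_zero.
      replace (Z.of_nat (S (N * l + i))) with (Z.of_nat (S i) + Z.of_nat l * Z.of_nat N)%Z by lia.
      rewrite Z.mod_add, Z.mod_small by lia. lia.
  - apply (Clim_subseq (fun M => csum h (seq 0 M)) (CSeries h) (fun M => (N * M)%nat)).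
    + intros M. nia.
    + apply CSeries_lim.
      destruct (Zsummable_row_sums k m N n Hk) as [b [Hb Hle]].
      exists (fun i => b (S i)). split; [now apply ex_series_incr_1 in Hb|]. intros i. exact (proj1 (Hle (S i))).
Qed.

(** * Exponential sums *)

Lemma csum_pick {A} (f : A -> C) (l : list A) a : NoDup l -> In a l ->
  (forall b, In b l -> b <> a -> f b = RtoC 0) -> csum f l = f a.
Proof.
  induction 1 as [|b l Hb Hl IH]; intros Ha H; [destruct Ha|].
  simpl. destruct Ha as [<-|Ha].
  - rewrite csum_zero; [ring|]. intros c Hc. apply H; [now right|]. intros ->. contradiction.
  - rewrite IH; [|exact Ha | intros c Hc Hca; apply H; [now right | exact Hca]].
    rewrite (H b (or_introl eq_refl)); [ring|]. intros ->. contradiction.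
Qed.

Lemma NoDup_list_prod {A B} (l : list A) (l' : list B) : NoDup l -> NoDup l' -> NoDup (list_prod l l').
Proof.
  intros H H'. induction H as [|a l Ha Hl IH]; simpl; [constructor|].
  apply NoDup_app; [| exact IH |].
  - apply NoDup_map_NoDup_ForallPairs; [|exact H']. intros x y _ _ E. now injection E.
  - intros [x y] H1 H2. apply in_map_iff in H1 as [z [E _]]. injection E as <- _.
    apply in_prod_iff in H2. now destruct H2.
Qed.

(** The residues [M u + p v] are distinct modulo [p * M] by Gauss's lemma, and there are as many of
    them as residues. *)
Lemma csum_periodic_CRT (F : Z -> C) (p M : nat) : (1 <= p)%nat -> (1 <= M)%nat ->
  Z.gcd (Z.of_nat p) (Z.of_nat M) = 1%Z ->
  (forall t q, F (t + q * Z.of_nat (p * M))%Z = F t) ->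
  csum (fun t => F (Z.of_nat t)) (seq 0 (p * M)) =
  csum (fun u => csum (fun v => F (Z.of_nat M * Z.of_nat u + Z.of_nat p * Z.of_nat v)%Z) (seq 0 M)) (seq 0 p).
Proof.
  intros Hp HM G HF.
  set (h := fun uv : nat * nat => ((M * fst uv + p * snd uv) mod (p * M))%nat).
  assert (Per : Permutation (map h (list_prod (seq 0 p) (seq 0 M))) (seq 0 (p * M))).
  { apply NoDup_Permutation_bis.
    - apply NoDup_map_NoDup_ForallPairs; [|apply NoDup_list_prod; apply seq_NoDup].
      intros [u v] [u' v'] H1 H2 E. apply in_prod_iff in H1, H2.
      rewrite !in_seq in H1, H2. unfold h in E. simpl fst in E. simpl snd in E.
      apply (f_equal Z.of_nat) in E. rewrite !Nat2Z.inj_mod in E.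
      assert (E2 : exists q, (Z.of_nat (M * u + p * v) - Z.of_nat (M * u' + p * v') = q * Z.of_nat (p * M))%Z).
      { exists (Z.of_nat (M * u + p * v) / Z.of_nat (p * M) - Z.of_nat (M * u' + p * v') / Z.of_nat (p * M))%Z.
        pose proof (Z.div_mod (Z.of_nat (M * u + p * v)) (Z.of_nat (p * M)) ltac:(nia)).
        pose proof (Z.div_mod (Z.of_nat (M * u' + p * v')) (Z.of_nat (p * M)) ltac:(nia)). nia. }
      destruct E2 as [q E2]. rewrite !Nat2Z.inj_add, !Nat2Z.inj_mul in E2.
      set (P := Z.of_nat p) in *. set (Q := Z.of_nat M) in *.
      assert (D1 : (P | Z.of_nat u - Z.of_nat u')%Z).
      { apply Z.gauss with Q; [|exact G]. exists (q * Q - (Z.of_nat v - Z.of_nat v'))%Z. lia. }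
      assert (D2 : (Q | Z.of_nat v - Z.of_nat v')%Z).
      { apply Z.gauss with P; [|now rewrite Z.gcd_comm]. exists (q * P - (Z.of_nat u - Z.of_nat u'))%Z. lia. }
      destruct D1 as [x1 D1], D2 as [x2 D2].
      assert (x1 = 0%Z) by nia. assert (x2 = 0%Z) by nia. f_equal; lia.
    - rewrite length_map, length_prod, !length_seq. lia.
    - intros t Ht. apply in_map_iff in Ht as [uv [<- _]]. apply in_seq.
      pose proof (Nat.mod_upper_bound (M * fst uv + p * snd uv) (p * M) ltac:(nia)). unfold h. lia. }
  rewrite <- (csum_perm _ _ _ Per), csum_map, csum_list_prod.
  apply csum_ext. intros u _. apply csum_ext. intros v _. unfold h. simpl fst. simpl snd.
  rewrite <- (HF (Z.of_nat ((M * u + p * v) mod (p * M))) (Z.of_nat ((M * u + p * v) / (p * M)))).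
  f_equal. pose proof (Nat.div_mod (M * u + p * v) (p * M) ltac:(nia)). lia.
Qed.

Definition frac (a c : Z) : C := e (RtoC (IZR a / IZR c)).

Lemma frac_period a c q : c <> 0%Z -> frac (a + q * c) c = frac a c.
Proof.
  intros H. apply not_0_IZR in H. unfold frac.
  rewrite <- (e_plus_Z (RtoC (IZR a / IZR c)) q), <- RtoC_plus. f_equal. f_equal.
  rewrite plus_IZR, mult_IZR. now field.
Qed.

Lemma frac_add a b c : c <> 0%Z -> frac (a + b) c = (frac a c * frac b c)%C.
Proof.
  intros H. apply not_0_IZR in H. unfold frac. rewrite <- e_plus, <- RtoC_plus. f_equal. f_equal.
  rewrite plus_IZR. now field.
Qed.

Lemma frac_cancel a b c : b <> 0%Z -> c <> 0%Z -> frac (b * a) (b * c) = frac a c.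
Proof.
  intros Hb Hc. apply not_0_IZR in Hb, Hc. unfold frac. f_equal. f_equal.
  rewrite !mult_IZR. field. auto.
Qed.

Lemma Cmod_frac a c : Cmod (frac a c) = 1.
Proof. apply Cmod_e_R. Qed.

Lemma frac_0 c : frac 0 c = 1%R.
Proof. unfold frac. unfold Rdiv. rewrite Rmult_0_l. apply e_0. Qed.

Lemma frac_1_neq_1 p : (2 <= p)%Z -> frac 1 p <> 1%R.
Proof.
  intros Hp E. apply IZR_le in Hp. apply (f_equal Re) in E. unfold frac, e in E. simpl in E.
  rewrite Rmult_0_r, exp_0, Rmult_1_l in E.
  replace (2 * PI * (1 / IZR p)) with (2 * (PI * / IZR p)) in E by (field; lra).
  rewrite cos_2a_sin in E.
  assert (H : 0 < PI * / IZR p < PI).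
  { pose proof PI_RGT_0. split.
    - apply Rmult_lt_0_compat; [lra | apply Rinv_0_lt_compat; lra].
    - rewrite <- (Rmult_1_r PI) at 2. apply Rmult_lt_compat_l; [lra|].
      rewrite <- Rinv_1. apply Rinv_lt_contravar; lra. }
  pose proof (sin_gt_0 _ (proj1 H) (proj2 H)). nra.
Qed.

(** With [u m + v p = 1], the [u]-th power of [frac m p] is [frac 1 p], which is not [1]. *)
Lemma frac_neq_1 m p : (2 <= p)%Z -> Z.gcd m p = 1%Z -> frac m p <> 1%R.
Proof.
  intros Hp G E. destruct (Z.gcd_bezout m p 1 G) as [u [v B]].
  apply (frac_1_neq_1 p Hp).
  replace (frac 1 p) with (frac (u * m + v * p) p) by now rewrite B. rewrite frac_period by lia.
  assert (P : forall n : nat, frac (Z.of_nat n * m) p = 1%R).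
  { induction n as [|n IH]; [apply frac_0|].
    replace (Z.of_nat (S n) * m)%Z with (Z.of_nat n * m + m)%Z by lia.
    rewrite frac_add, IH, E by lia. ring. }
  (* Replaces [u] by the nonnegative [u + |u| p], so that it becomes a natural exponent. *)
  rewrite <- (frac_period (u * m) p (Z.abs u * m)) by lia.
  replace (u * m + Z.abs u * m * p)%Z with (Z.of_nat (Z.to_nat (u + Z.abs u * p)) * m)%Z; [apply P|].
  rewrite Z2Nat.id by nia. ring.
Qed.

Lemma csum_frac_complete m (p : nat) : (2 <= p)%nat -> Z.gcd m (Z.of_nat p) = 1%Z ->
  csum (fun u => frac (m * Z.of_nat u) (Z.of_nat p)) (seq 0 p) = RtoC 0.
Proof.
  intros Hp G. set (z := frac m (Z.of_nat p)).
  assert (Z1 : z <> 1%R) by (apply frac_neq_1; [lia | exact G]).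
  assert (T : forall M, ((z - 1%R) * csum (fun u => frac (m * Z.of_nat u) (Z.of_nat p)) (seq 0 M))%C =
    (frac (m * Z.of_nat M) (Z.of_nat p) - 1%R)%C).
  { induction M as [|M IH].
    - simpl csum. rewrite Z.mul_0_r, frac_0. ring.
    - rewrite csum_seq_S, Cmult_plus_distr_l, IH.
      replace (m * Z.of_nat (S M))%Z with (m + m * Z.of_nat M)%Z by lia.
      rewrite frac_add by lia. fold z. ring. }
  specialize (T p).
  replace (m * Z.of_nat p)%Z with (0 + m * Z.of_nat p)%Z in T by lia.
  rewrite frac_period, frac_0 in T by lia.
  assert (Nz : (z - 1%R)%C <> 0%R).
  { intros E. apply Z1. replace z with ((z - 1%R) + 1%R)%C by ring. rewrite E. ring. }
  set (S := csum _ _) in *.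
  replace S with (/ (z - 1%R) * ((z - 1%R) * S))%C by (field; exact Nz).
  rewrite T. ring.
Qed.

(* For [J = 1], [a = 0] this is the Ramanujan sum [c_N(m)]. *)
Definition coprime_sum (m : Z) (N : nat) (J a : Z) : C :=
  csum (fun t => if Z.eqb (Z.gcd (J * Z.of_nat t + a) (Z.of_nat N)) 1
                 then frac (m * Z.of_nat t) (Z.of_nat N) else RtoC 0) (seq 0 N).

Lemma gcd_mul_1_iff x a b : (Z.gcd x (a * b) = 1 <-> Z.gcd x a = 1 /\ Z.gcd x b = 1)%Z.
Proof.
  rewrite !Zgcd_1_rel_prime. split.
  - intros H. split.
    + apply rel_prime_sym, rel_prime_div with (a * b)%Z; [now apply rel_prime_sym|]. exists b. ring.
    + apply rel_prime_sym, rel_prime_div with (a * b)%Z; [now apply rel_prime_sym|]. exists a. ring.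
  - intros [H1 H2]. now apply rel_prime_mult.
Qed.

Lemma gcd_add_mul x y q : Z.gcd (x + q * y) y = Z.gcd x y.
Proof. rewrite Z.gcd_comm, Z.gcd_add_mult_diag_r. apply Z.gcd_comm. Qed.

(** Under [t = M u + p v] both the character and the coprimality condition split. The condition
    acquires the factors [M] and [p] on [J], which is why [J] is a free parameter. *)
Lemma coprime_sum_mul m p M J a : (1 <= p)%nat -> (1 <= M)%nat ->
  Z.gcd (Z.of_nat p) (Z.of_nat M) = 1%Z ->
  coprime_sum m (p * M) J a =
  (coprime_sum m p (J * Z.of_nat M) a * coprime_sum m M (J * Z.of_nat p) a)%C.
Proof.
  intros Hp HM G. unfold coprime_sum.
  set (F := fun t : Z => if Z.eqb (Z.gcd (J * t + a) (Z.of_nat (p * M))) 1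
                 then frac (m * t) (Z.of_nat (p * M)) else RtoC 0).
  transitivity (csum (fun t => F (Z.of_nat t)) (seq 0 (p * M))); [reflexivity|].
  rewrite (csum_periodic_CRT F p M Hp HM G).
  - rewrite Cmult_comm, <- csum_scal. apply csum_ext. intros u _.
    rewrite Cmult_comm, <- csum_scal. apply csum_ext. intros v _.
    unfold F. set (U := Z.of_nat u). set (V := Z.of_nat v). rewrite Nat2Z.inj_mul.
    set (P := Z.of_nat p) in *. set (Q := Z.of_nat M) in *.
    assert (P0 : P <> 0%Z) by (unfold P; lia). assert (Q0 : Q <> 0%Z) by (unfold Q; lia).
    assert (E1 : Z.gcd (J * (Q * U + P * V) + a) P = Z.gcd (J * Q * U + a) P).
    { rewrite <- (gcd_add_mul (J * Q * U + a) P (J * V)). f_equal. ring. }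
    assert (E2 : Z.gcd (J * (Q * U + P * V) + a) Q = Z.gcd (J * P * V + a) Q).
    { rewrite <- (gcd_add_mul (J * P * V + a) Q (J * U)). f_equal. ring. }
    destruct (Z.eqb_spec (Z.gcd (J * (Q * U + P * V) + a) (P * Q)) 1) as [H|H].
    + apply gcd_mul_1_iff in H as [H1 H2]. rewrite E1 in H1. rewrite E2 in H2.
      rewrite H1, H2. simpl (1 =? 1)%Z. cbv iota.
      replace (m * (Q * U + P * V))%Z with (Q * (m * U) + P * (m * V))%Z by ring.
      rewrite frac_add by nia. rewrite frac_cancel by trivial.
      rewrite (Z.mul_comm P Q), frac_cancel by trivial. reflexivity.
    + destruct (Z.eqb_spec (Z.gcd (J * Q * U + a) P) 1) as [H1|H1]; [|ring].
      destruct (Z.eqb_spec (Z.gcd (J * P * V + a) Q) 1) as [H2|H2]; [|ring].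
      exfalso. apply H, gcd_mul_1_iff. now rewrite E1, E2.
  - intros t q. unfold F.
    replace (J * (t + q * Z.of_nat (p * M)) + a)%Z with ((J * t + a) + (J * q) * Z.of_nat (p * M))%Z by ring.
    rewrite gcd_add_mul.
    replace (m * (t + q * Z.of_nat (p * M)))%Z with (m * t + (m * q) * Z.of_nat (p * M))%Z by ring.
    rewrite frac_period by nia. reflexivity.
Qed.

Lemma prime_gcd_not_1 p x : prime p -> (Z.gcd x p <> 1)%Z -> (p | x)%Z.
Proof.
  intros Hp H. destruct (Zdivide_dec p x) as [D|D]; [exact D|].
  exfalso. apply H. rewrite Zgcd_1_rel_prime. apply rel_prime_sym. now apply prime_rel_prime.
Qed.

Lemma prime_gcd_1 p x : prime p -> Z.gcd x p = 1%Z -> ~ (p | x)%Z.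
Proof.
  intros Hp H D. assert (D1 : (p | 1)%Z) by (rewrite <- H; apply Z.gcd_greatest; [exact D | apply Z.divide_refl]).
  apply Z.divide_1_r_nonneg in D1; [|apply prime_ge_2 in Hp; lia]. subst. now apply not_prime_1.
Qed.

Lemma coprime_sum_prime m (p : nat) J a : prime (Z.of_nat p) -> Z.gcd m (Z.of_nat p) = 1%Z ->
  Cmod (coprime_sum m p J a) <= 1 /\
  (Z.gcd J (Z.of_nat p) = 1%Z -> Cmod (coprime_sum m p J a) = 1).
Proof.
  intros Hp Hm. pose proof (prime_ge_2 _ Hp) as P2. set (P := Z.of_nat p) in *.
  assert (P0 : P <> 0%Z) by lia.
  pose proof (csum_frac_complete m p ltac:(lia) Hm) as Full. fold P in Full.
  destruct (Z.eq_dec (Z.gcd J P) 1) as [G|G].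
  - assert (K : Cmod (coprime_sum m p J a) = 1); [|split; [lra | auto]].
    destruct (Z.gcd_bezout J P 1 G) as [x [y B]].
    (* The only root of [J t + a] modulo [p]; [x] inverts [J] by Bezout. Its term is the one missing
       from the complete sum. *)
    set (u0 := Z.to_nat ((- a * x) mod P)).
    assert (U0 : (Z.of_nat u0 = (- a * x) mod P)%Z).
    { unfold u0. rewrite Z2Nat.id; [reflexivity|]. apply Z.mod_pos_bound. lia. }
    assert (Root : forall u : nat, (u < p)%nat -> (P | J * Z.of_nat u + a)%Z <-> u = u0).
    { intros u Hu. pose proof (Z.mod_pos_bound (- a * x) P ltac:(lia)) as Hb.
      pose proof (Z.div_mod (- a * x) P P0) as Dm. rewrite <- U0 in Dm, Hb.
      assert (R0 : (P | J * Z.of_nat u0 + a)%Z).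
      { exists (a * y - J * ((- a * x) / P))%Z.
        replace (Z.of_nat u0) with (- a * x - P * ((- a * x) / P))%Z by lia.
        transitivity (a * (1 - x * J) - J * P * ((- a * x) / P))%Z; [ring|].
        replace (1 - x * J)%Z with (y * P)%Z by lia. ring. }
      split; [|now intros ->].
      intros R. assert (D : (P | Z.of_nat u - Z.of_nat u0)%Z).
      { apply Z.gauss with J; [|now rewrite Z.gcd_comm].
        replace (J * (Z.of_nat u - Z.of_nat u0))%Z with ((J * Z.of_nat u + a) - (J * Z.of_nat u0 + a))%Z by ring.
        now apply Z.divide_sub_r. }
      destruct D as [q D]. assert (q = 0%Z) by (unfold P in *; nia). lia. }
    assert (Hu0 : (u0 < p)%nat).
    { pose proof (Z.mod_pos_bound (- a * x) P ltac:(lia)). unfold P in *. lia. }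
    replace (coprime_sum m p J a) with (- frac (m * Z.of_nat u0) P)%C; [rewrite Cmod_opp; apply Cmod_frac|].
    assert (Pick : csum (fun t => if Nat.eqb t u0 then frac (m * Z.of_nat t) P else RtoC 0) (seq 0 p)
       = frac (m * Z.of_nat u0) P).
    { rewrite (csum_pick _ _ u0).
      - now rewrite Nat.eqb_refl.
      - apply seq_NoDup.
      - apply in_seq. lia.
      - intros b _ Hb. apply Nat.eqb_neq in Hb. now rewrite Hb. }
    assert (Split : (coprime_sum m p J a + csum (fun t => if Nat.eqb t u0 then frac (m * Z.of_nat t) P else RtoC 0) (seq 0 p))%C = RtoC 0).
    { refine (eq_trans _ Full). unfold coprime_sum. rewrite <- csum_plus. apply csum_ext.
      intros t Ht. apply in_seq in Ht. fold P.
      destruct (Z.eqb_spec (Z.gcd (J * Z.of_nat t + a) P) 1) as [H|H].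
      - apply prime_gcd_1 in H; [|exact Hp]. rewrite Root in H by lia.
        apply Nat.eqb_neq in H. rewrite H. cbv beta iota.  ring.
      - apply prime_gcd_not_1 in H; [|exact Hp]. rewrite Root in H by lia.
        subst t. rewrite Nat.eqb_refl. cbv beta iota. ring. }
    rewrite Pick in Split.
    replace (coprime_sum m p J a) with ((coprime_sum m p J a + frac (m * Z.of_nat u0) P) - frac (m * Z.of_nat u0) P)%C by ring.
    rewrite Split. ring.
  - split; [|contradiction].
    apply prime_gcd_not_1 in G; [|exact Hp]. destruct G as [q Q].
    replace (coprime_sum m p J a) with (RtoC 0); [rewrite Cmod_0; lra|].
    unfold coprime_sum. fold P.
    rewrite (csum_ext _ (fun t => (if Z.eqb (Z.gcd a P) 1 then RtoC 1 else RtoC 0) * frac (m * Z.of_nat t) P)%C).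
    + rewrite csum_scal, Full. ring.
    + intros t _. replace (J * Z.of_nat t + a)%Z with (a + (q * Z.of_nat t) * P)%Z by (rewrite Q; ring).
      rewrite gcd_add_mul. destruct (Z.eqb (Z.gcd a P) 1); ring.
Qed.

Lemma exists_prime_divisor (N : nat) : (2 <= N)%nat -> exists p, prime (Z.of_nat p) /\ Nat.divide p N.
Proof.
  induction N as [N IH] using lt_wf_ind. intros H.
  destruct (prime_dec (Z.of_nat N)) as [Hp|Hp].
  - exists N. split; [exact Hp | apply Nat.divide_refl].
  - destruct (not_prime_divide (Z.of_nat N) ltac:(lia) Hp) as [q [Hq D]].
    destruct (IH (Z.to_nat q) ltac:(lia) ltac:(lia)) as [p [Pp Dp]].
    exists p. split; [exact Pp|]. apply Nat.divide_trans with (Z.to_nat q); [exact Dp|].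
    destruct D as [r D]. exists (Z.to_nat r). nia.
Qed.

(** Strong induction on [N], one prime at a time; square-freeness makes the cofactor prime to it.
    [J] varies because each step multiplies it by the other factor. *)
Lemma coprime_sum_bound m (N : nat) J a : (1 <= N)%nat -> squarefree N -> Z.gcd m (Z.of_nat N) = 1%Z ->
  Cmod (coprime_sum m N J a) <= 1 /\
  (Z.gcd J (Z.of_nat N) = 1%Z -> Cmod (coprime_sum m N J a) = 1).
Proof.
  revert J. induction N as [N IH] using lt_wf_ind. intros J HN Sq Hm.
  destruct (Nat.eq_dec N 1) as [->|N1].
  - assert (E : coprime_sum m 1 J a = RtoC 1).
    { unfold coprime_sum. simpl. rewrite Z.gcd_1_r. simpl. rewrite Z.mul_0_r, frac_0. ring. }
    rewrite E, Cmod_1. split; [lra | auto].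
  - destruct (exists_prime_divisor N ltac:(lia)) as [p [Hp [M D]]].
    pose proof (prime_ge_2 _ Hp) as P2.
    assert (HM : (1 <= M)%nat) by (destruct M; lia).
    rewrite Nat.mul_comm in D. subst N.
    assert (G : Z.gcd (Z.of_nat p) (Z.of_nat M) = 1%Z).
    { rewrite Z.gcd_comm. destruct (Z.eq_dec (Z.gcd (Z.of_nat M) (Z.of_nat p)) 1) as [E|E]; [exact E|].
      apply prime_gcd_not_1 in E; [|exact Hp]. destruct E as [q E].
      exfalso. apply (Sq p Hp). exists (Z.to_nat q). nia. }
    assert (SqM : squarefree M).
    { intros r Hr [s Ds]. apply (Sq r Hr). exists (p * s)%nat. rewrite Ds. ring. }
    rewrite Nat2Z.inj_mul, gcd_mul_1_iff in Hm. destruct Hm as [Hm1 Hm2].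
    rewrite coprime_sum_mul, Cmod_mult by (trivial; lia).
    destruct (coprime_sum_prime m p (J * Z.of_nat M) a Hp Hm1) as [A1 A2].
    destruct (IH M ltac:(nia) (J * Z.of_nat p)%Z HM SqM Hm2) as [B1 B2].
    pose proof (Cmod_ge_0 (coprime_sum m p (J * Z.of_nat M) a)).
    pose proof (Cmod_ge_0 (coprime_sum m M (J * Z.of_nat p) a)).
    split; [nra|].
    rewrite Nat2Z.inj_mul, gcd_mul_1_iff. intros [J1 J2].
    rewrite A2, B2; [lra | |].
    + rewrite Z.gcd_comm, gcd_mul_1_iff, (Z.gcd_comm _ J). split; [exact J2|]. now rewrite Z.gcd_comm.
    + rewrite Z.gcd_comm, gcd_mul_1_iff, (Z.gcd_comm _ J). auto.
Qed.

(** Reduced modulo [c], the chosen inverse becomes canonical, so that inversion is an involution on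
    a list of residues. *)
Definition inv_mod (c i : nat) : nat :=
  Z.to_nat (fst (complete_row (Z.of_nat c) (Z.of_nat i)) mod Z.of_nat c).

Definition is_unit_mod (c i : nat) : bool := Z.eqb (Z.gcd (Z.of_nat c) (Z.of_nat i)) 1.

Lemma of_nat_inv_mod c i : (1 <= c)%nat ->
  Z.of_nat (inv_mod c i) = (fst (complete_row (Z.of_nat c) (Z.of_nat i)) mod Z.of_nat c)%Z.
Proof. intros H. unfold inv_mod. rewrite Z2Nat.id; [reflexivity|]. apply Z.mod_pos_bound. lia. Qed.

Lemma inv_mod_lt c i : (1 <= c)%nat -> (inv_mod c i < c)%nat.
Proof.
  intros H. apply Nat2Z.inj_lt. rewrite of_nat_inv_mod by exact H. apply Z.mod_pos_bound. lia.
Qed.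

Lemma inv_mod_spec c i : (1 <= c)%nat -> is_unit_mod c i = true ->
  (Z.of_nat c | Z.of_nat (inv_mod c i) * Z.of_nat i - 1)%Z.
Proof.
  intros H U. apply Z.eqb_eq in U. pose proof (complete_row_spec _ _ U) as R.
  rewrite of_nat_inv_mod by exact H.
  set (a := fst (complete_row (Z.of_nat c) (Z.of_nat i))) in *.
  set (b := snd (complete_row (Z.of_nat c) (Z.of_nat i))) in *.
  pose proof (Z.div_mod a (Z.of_nat c) ltac:(lia)) as D.
  exists (b - a / Z.of_nat c * Z.of_nat i)%Z.
  replace (a mod Z.of_nat c)%Z with (a - Z.of_nat c * (a / Z.of_nat c))%Z by lia.
  transitivity (a * Z.of_nat i - 1 - Z.of_nat c * (a / Z.of_nat c) * Z.of_nat i)%Z; [ring|].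
  replace (a * Z.of_nat i - 1)%Z with (b * Z.of_nat c)%Z by lia. ring.
Qed.

Lemma gcd_1_of_inverse c x y : (c | x * y - 1)%Z -> Z.gcd c x = 1%Z.
Proof. intros [q E]. apply Z.bezout_1_gcd. exists (- q)%Z, y. lia. Qed.

Lemma is_unit_inv_mod c i : (1 <= c)%nat -> is_unit_mod c i = true -> is_unit_mod c (inv_mod c i) = true.
Proof.
  intros H U. apply Z.eqb_eq. eapply gcd_1_of_inverse. now apply inv_mod_spec.
Qed.

Lemma divide_sub_of_inverse c a x y : Z.gcd c a = 1%Z -> (c | x * a - 1)%Z -> (c | y * a - 1)%Z ->
  (c | x - y)%Z.
Proof.
  intros G Hx Hy. apply Z.gauss with a; [|exact G].
  replace (a * (x - y))%Z with ((x * a - 1) - (y * a - 1))%Z by ring. now apply Z.divide_sub_r.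
Qed.

Lemma inv_mod_inv_mod c i : (i < c)%nat -> is_unit_mod c i = true -> inv_mod c (inv_mod c i) = i.
Proof.
  intros Hi U. assert (H : (1 <= c)%nat) by lia.
  pose proof (is_unit_inv_mod c i H U) as U'.
  pose proof (inv_mod_spec c _ H U') as S'. pose proof (inv_mod_spec c i H U) as S.
  pose proof (inv_mod_lt c (inv_mod c i) H).
  assert (D : (Z.of_nat c | Z.of_nat (inv_mod c (inv_mod c i)) - Z.of_nat i)%Z).
  { apply divide_sub_of_inverse with (Z.of_nat (inv_mod c i)).
    - now apply Z.eqb_eq.
    - exact S'.
    - rewrite Z.mul_comm. exact S. }
  destruct D as [q D]. assert (q = 0%Z) by nia. lia.
Qed.

Lemma frac_congr a b c : c <> 0%Z -> (c | a - b)%Z -> frac a c = frac b c.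
Proof.
  intros Hc [q E]. replace a with (b + q * c)%Z by lia. now apply frac_period.
Qed.

Lemma row_phase_frac m n c i : (1 <= c)%nat ->
  row_phase m n (Z.of_nat c) (Z.of_nat i) =
  if is_unit_mod c i
  then (frac (Z.of_nat m * Z.of_nat (inv_mod c i)) (Z.of_nat c) * frac (Z.of_nat n * Z.of_nat i) (Z.of_nat c))%C
  else RtoC 0.
Proof.
  intros H. unfold row_phase. fold (is_unit_mod c i).
  destruct (is_unit_mod c i); [|reflexivity].
  rewrite <- frac_add by lia.
  set (a := fst (complete_row (Z.of_nat c) (Z.of_nat i))).
  transitivity (frac (Z.of_nat m * a + Z.of_nat n * Z.of_nat i) (Z.of_nat c)).
  - unfold frac. f_equal. f_equal. now rewrite plus_IZR, !mult_IZR, <- !INR_IZR_INZ.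
  - apply frac_congr; [lia|]. rewrite of_nat_inv_mod by exact H. fold a.
    pose proof (Z.div_mod a (Z.of_nat c) ltac:(lia)) as D.
    exists (Z.of_nat m * (a / Z.of_nat c))%Z.
    replace (a mod Z.of_nat c)%Z with (a - Z.of_nat c * (a / Z.of_nat c))%Z by lia. ring.
Qed.

(* Reindexing by the inverse moves the character to the frequency [m]. *)
Lemma kloosterman_inverse m n c : (1 <= c)%nat -> kloosterman m n c =
  csum (fun a => if is_unit_mod c a
     then (frac (Z.of_nat m * Z.of_nat a) (Z.of_nat c) * frac (Z.of_nat n * Z.of_nat (inv_mod c a)) (Z.of_nat c))%C
     else RtoC 0) (seq 0 c).
Proof.
  intros H. unfold kloosterman.
  rewrite (csum_ext _ _ _ (fun i _ => row_phase_frac m n c i H)), !csum_if.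
  set (U := filter (is_unit_mod c) (seq 0 c)).
  assert (HU : forall i, In i U <-> (i < c)%nat /\ is_unit_mod c i = true).
  { intros i. unfold U. rewrite filter_In, in_seq. intuition lia. }
  assert (Per : Permutation (map (inv_mod c) U) U).
  { apply NoDup_Permutation_bis.
    - apply NoDup_map_NoDup_ForallPairs; [|apply NoDup_filter, seq_NoDup].
      intros a b Ha Hb E. apply HU in Ha, Hb.
      rewrite <- (inv_mod_inv_mod c a), <- (inv_mod_inv_mod c b) by tauto. now rewrite E.
    - now rewrite length_map.
    - intros a Ha. apply in_map_iff in Ha as [b [<- Hb]]. apply HU in Hb. apply HU.
      split; [now apply inv_mod_lt | now apply is_unit_inv_mod]. }
  rewrite <- (csum_perm _ _ _ Per), csum_map.
  apply csum_ext. intros i Hi. apply HU in Hi. now rewrite inv_mod_inv_mod.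
Qed.

Lemma is_unit_mod_split j N a l : (1 <= j)%nat -> (1 <= N)%nat ->
  is_unit_mod (j * N) (j * l + a) =
  (Z.eqb (Z.gcd (Z.of_nat a) (Z.of_nat j)) 1 &&
   Z.eqb (Z.gcd (Z.of_nat j * Z.of_nat l + Z.of_nat a) (Z.of_nat N)) 1)%bool.
Proof.
  intros Hj HN. unfold is_unit_mod. apply Bool.eq_iff_eq_true.
  rewrite Bool.andb_true_iff, !Z.eqb_eq, Z.gcd_comm, Nat2Z.inj_mul, gcd_mul_1_iff.
  rewrite Nat2Z.inj_add, Nat2Z.inj_mul.
  replace (Z.gcd (Z.of_nat j * Z.of_nat l + Z.of_nat a) (Z.of_nat j)) with (Z.gcd (Z.of_nat a) (Z.of_nat j)).
  - reflexivity.
  - rewrite <- (gcd_add_mul (Z.of_nat a) (Z.of_nat j) (Z.of_nat l)). f_equal. ring.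
Qed.

(** Since [N] divides [n], the factor with the inverse is [e(n' x / j)] and depends only on the
    class modulo [j]. The other factor splits off [e(m a0 / (j N))], leaving [e(m l / N)] under the
    condition of [coprime_sum]; [w] collects the two constants. *)
Lemma residue_class_sum m n' N j a0 : (1 <= j)%nat -> (1 <= N)%nat -> Z.gcd (Z.of_nat a0) (Z.of_nat j) = 1%Z ->
  exists w, Cmod w = 1 /\
  csum (fun l => if is_unit_mod (j * N) (j * l + a0)
     then (frac (Z.of_nat m * Z.of_nat (j * l + a0)) (Z.of_nat (j * N)) *
           frac (Z.of_nat (N * n') * Z.of_nat (inv_mod (j * N) (j * l + a0))) (Z.of_nat (j * N)))%C
     else RtoC 0) (seq 0 N) = (w * coprime_sum (Z.of_nat m) N (Z.of_nat j) (Z.of_nat a0))%C.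
Proof.
  intros Hj HN G.
  destruct (Z.gcd_bezout (Z.of_nat a0) (Z.of_nat j) 1 G) as [v [y B]].
  set (J := Z.of_nat j) in *. set (Q := Z.of_nat N) in *.
  assert (J0 : J <> 0%Z) by (unfold J; lia). assert (Q0 : Q <> 0%Z) by (unfold Q; lia).
  exists (frac (Z.of_nat m * Z.of_nat a0) (J * Q) * frac (Z.of_nat n' * v) J)%C. split.
  { rewrite Cmod_mult, !Cmod_frac. ring. }
  unfold coprime_sum. rewrite <- csum_scal. apply csum_ext. intros l _.
  destruct (is_unit_mod (j * N) (j * l + a0)) eqn:U.
  - pose proof (inv_mod_spec (j * N) _ ltac:(nia) U) as [q E].
    rewrite is_unit_mod_split in U by trivial. fold J Q in U. rewrite G in U. simpl in U. fold Q J.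
    rewrite U.
    replace (Z.of_nat (j * N)) with (J * Q)%Z in * by (unfold J, Q; lia).
    replace (Z.of_nat (N * n')) with (Q * Z.of_nat n')%Z by (unfold Q; lia).
    replace (Z.of_nat (j * l + a0)) with (J * Z.of_nat l + Z.of_nat a0)%Z in * by (unfold J; lia).
    set (x := Z.of_nat (inv_mod (j * N) (j * l + a0))) in *.
    assert (Ex : frac (Q * Z.of_nat n' * x) (J * Q) = frac (Z.of_nat n' * v) J).
    { rewrite <- Z.mul_assoc, (Z.mul_comm J Q), frac_cancel by trivial.
      apply frac_congr; [exact J0|].
      replace (Z.of_nat n' * x - Z.of_nat n' * v)%Z with (Z.of_nat n' * (x - v))%Z by ring.
      apply Z.divide_mul_r. apply divide_sub_of_inverse with (Z.of_nat a0).
      - now rewrite Z.gcd_comm.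
      - exists (q * Q - x * Z.of_nat l)%Z.
        transitivity (x * (J * Z.of_nat l + Z.of_nat a0) - 1 - x * J * Z.of_nat l)%Z; [ring|].
        rewrite E. ring.
      - exists (- y)%Z. lia. }
    rewrite Ex.
    replace (Z.of_nat m * (J * Z.of_nat l + Z.of_nat a0))%Z with
      (J * (Z.of_nat m * Z.of_nat l) + Z.of_nat m * Z.of_nat a0)%Z by ring.
    rewrite frac_add, frac_cancel by nia. ring.
  - rewrite is_unit_mod_split in U by trivial. fold J Q in U. rewrite G in U. simpl in U.
    fold Q J. rewrite U. ring.
Qed.

Lemma gcd_of_nat_1 m N : (1 <= N)%nat -> Nat.gcd m N = 1%nat -> Z.gcd (Z.of_nat m) (Z.of_nat N) = 1%Z.
Proof.
  intros HN H. set (d := Z.gcd (Z.of_nat m) (Z.of_nat N)).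
  assert (D0 : (0 <= d)%Z) by apply Z.gcd_nonneg.
  assert (P : forall a, (d | Z.of_nat a)%Z -> Nat.divide (Z.to_nat d) a).
  { intros a [q E]. destruct (Z.eq_dec d 0) as [Z0|Z0].
    - exists 0%nat. rewrite Z0 in E. lia.
    - exists (Z.to_nat q). apply Nat2Z.inj. rewrite Nat2Z.inj_mul, !Z2Nat.id; nia. }
  assert (D : Nat.divide (Z.to_nat d) 1).
  { rewrite <- H. apply Nat.gcd_greatest; apply P; [apply Z.gcd_divide_l | apply Z.gcd_divide_r]. }
  apply Nat.divide_1_r in D. lia.
Qed.

Lemma kloosterman_bound m n' N j : (1 <= N)%nat -> squarefree N -> Nat.gcd m N = 1%nat -> (1 <= j)%nat ->
  Cmod (kloosterman m (N * n') (N * j)) <= INR j.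
Proof.
  intros HN Sq Hm Hj.
  assert (Gm : Z.gcd (Z.of_nat m) (Z.of_nat N) = 1%Z) by now apply gcd_of_nat_1.
  rewrite (Nat.mul_comm N j), kloosterman_inverse by nia.
  rewrite csum_seq_mul, csum_swap.
  replace (INR j) with (INR (length (seq 0 j)) * 1) by (rewrite length_seq; ring).
  apply csum_Cmod_le. intros a0 _.
  destruct (Z.eq_dec (Z.gcd (Z.of_nat a0) (Z.of_nat j)) 1) as [G|G].
  - destruct (residue_class_sum m n' N j a0 Hj HN G) as [w [Hw E]]. rewrite E, Cmod_mult, Hw, Rmult_1_l.
    now apply coprime_sum_bound.
  - rewrite csum_zero; [rewrite Cmod_0; lra|]. intros l _.
    rewrite is_unit_mod_split by trivial. apply Z.eqb_neq in G. now rewrite G.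
Qed.

Lemma kloosterman_level m n' N : (1 <= N)%nat -> squarefree N -> Nat.gcd m N = 1%nat ->
  Cmod (kloosterman m (N * n') N) = 1.
Proof.
  intros HN Sq Hm.
  assert (Gm : Z.gcd (Z.of_nat m) (Z.of_nat N) = 1%Z) by now apply gcd_of_nat_1.
  rewrite kloosterman_inverse by exact HN.
  destruct (residue_class_sum m n' N 1 0 (le_n 1) HN eq_refl) as [w [Hw E]].
  rewrite (csum_ext _ (fun l => if is_unit_mod (1 * N) (1 * l + 0)
     then (frac (Z.of_nat m * Z.of_nat (1 * l + 0)) (Z.of_nat (1 * N)) *
           frac (Z.of_nat (N * n') * Z.of_nat (inv_mod (1 * N) (1 * l + 0))) (Z.of_nat (1 * N)))%C
     else RtoC 0)).
  - rewrite E, Cmod_mult, Hw, Rmult_1_l.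
    apply coprime_sum_bound; trivial. apply Z.gcd_1_l.
  - intros l _. now rewrite !Nat.mul_1_l, Nat.add_0_r.
Qed.

(** * The main term dominates *)

Lemma row_sum_eq k m N n kappa (c : nat) : (4 <= k)%nat -> (1 <= c)%nat ->
  (Z.of_nat c mod Z.of_nat N = 0)%Z -> line_int (zpow_e 2 n) kappa ->
  Zsum (row_coef k m N n (Z.of_nat c)) =
  (RtoC (/ INR c ^ k) * kloosterman m n c *
   ((- twopii * RtoC (INR n)) ^ (k - 2) * kappa *
    RtoC (psi (k - 1) (4 * PI ^ 2 * (INR m / INR c ^ 2) * INR n))))%C.
Proof.
  intros Hk Hc HN H. apply Zsum_rows; [exact Hc | lia | exact HN | |].
  - apply line_int_bessel_kernel; [lia | | exact H].
    apply Rdiv_le_0_compat; [apply pos_INR | apply pow_lt, lt_0_INR; lia].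
  - exact (Zsummable_row_coef k m N n (Z.of_nat c) Hk).
Qed.

(** The left-hand side is tailored to the bound for all remaining rows in [pcoef_nonzero]. *)
Lemma psi_main_term_gt nu X : (7 <= nu)%nat -> 0 <= X -> X <= INR nu ^ 2 / 8 ->
  4 / 2 ^ nu * / INR (fact nu) < psi nu X.
Proof.
  intros Hnu X0 HX. apply le_INR in Hnu. simpl in Hnu.
  destruct (psi_bounds X nu X0) as [_ L]; [nra|].
  eapply Rlt_le_trans; [|exact L].
  apply Rmult_lt_compat_r; [apply Rinv_0_lt_compat; apply INR_fact_pos|].
  assert (P2 : 0 < 2 ^ nu) by (apply pow_lt; lra).
  apply Rlt_div_l; [exact P2|].
  (* Bernoulli: [(3/2)^nu >= 1 + nu/2 >= 9/2 > 4], which uses [7 <= nu]. *)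
  assert (B : 1 + INR nu * / 2 <= (1 + / 2) ^ nu) by (apply poly; lra).
  apply Rlt_le_trans with ((3 / 4) ^ nu * 2 ^ nu).
  - rewrite <- Rpow_mult_distr. replace (3 / 4 * 2) with (1 + / 2) by field. lra.
  - apply Rmult_le_compat_r; [lra|].
    (* [2 X / (nu+1) <= nu / 4] by the bound on [X], and [exp(-1/4) >= 1 - 1/4]. *)
    apply Rle_trans with (exp (- (INR nu / 4))).
    + replace (- (INR nu / 4)) with (INR nu * (- / 4)) by field.
      assert (E : exp (INR nu * - / 4) = exp (- / 4) ^ nu).
      { clear. induction nu as [|nu IH]; [simpl; rewrite Rmult_0_l; apply exp_0|].
        rewrite S_INR, Rmult_plus_distr_r, exp_plus, IH, Rmult_1_l. simpl. ring. }
      rewrite E. apply pow_incr. split; [lra|].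
      pose proof (exp_ineq1_le (- / 4)). lra.
    + apply exp_monotone, Ropp_le_contravar. apply Rle_div_l; [lra|]. nra.
Qed.

Lemma pcoef_nonzero k m N n' : Nat.Even k -> (8 <= k)%nat -> (1 <= N)%nat -> squarefree N ->
  Nat.gcd m N = 1%nat -> (1 <= n')%nat -> m <> (N * n')%nat ->
  4 * PI ^ 2 * INR m * INR n' / INR N <= INR (k - 1) ^ 2 / 8 ->
  pcoef k m N (N * n') <> RtoC 0.
Proof.
  intros He Hk HN Sq Gm Hn' Hmn HX E0.
  set (n := (N * n')%nat) in *. assert (Hn : (1 <= n)%nat) by (unfold n; nia).
  destruct (ex_line_int _ _ (zpow_e_dominated 2 n (le_n 2))) as [kappa Hkappa].
  pose proof (line_int_zpow_e_nz n kappa Hn Hkappa) as K0.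
  pose proof (pcoef_partial_sums k m N n He ltac:(lia) HN Hmn E0) as L.
  set (nu := (k - 1)%nat) in *.
  set (D := ((- twopii * RtoC (INR n)) ^ (k - 2) * kappa)%C).
  assert (Dp : 0 < Cmod D).
  { apply Cmod_gt_0. apply Cmult_neq_0; [|exact K0]. apply Cpow_nz, Cmult_neq_0.
    - intros E. apply (f_equal Im) in E. simpl in E. pose proof PI_RGT_0. lra.
    - intros E. injection E as E. apply (not_0_INR n); [lia | exact E]. }
  assert (N0 : 0 < INR N) by (apply lt_0_INR; lia).
  set (X := 4 * PI ^ 2 * INR m * INR n' / INR N) in *.
  assert (X0 : 0 <= X).
  { unfold X. apply Rdiv_le_0_compat; [|exact N0].
    pose proof (pos_INR m). pose proof (pos_INR n'). pose proof (pow2_ge_0 PI).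
    apply Rmult_le_pos; [|lra]. apply Rmult_le_pos; lra. }
  set (a := fun j => Zsum (row_coef k m N n (Z.of_nat (N * S j)))) in *.
  assert (Ha : forall j, a j = (RtoC (/ (INR N * INR (S j)) ^ k) * kloosterman m n (N * S j) *
     (D * RtoC (psi nu (X / INR (S j) ^ 2))))%C).
  { intros j. unfold a. rewrite (row_sum_eq k m N n kappa) by (trivial; try lia; rewrite Nat2Z.inj_mul, Z.mul_comm; apply Z.mod_mul; lia).
    rewrite mult_INR. fold D nu. do 3 f_equal. f_equal.
    unfold X, n. rewrite mult_INR. field. pose proof (lt_0_INR (S j) ltac:(lia)). lra. }
  (* The scale common to all rows, so that only [psi] and powers of [j] remain to be compared. *)
  set (W := Cmod D * / INR N ^ k * / INR (fact nu)).
  assert (Np : 0 < / INR N ^ k) by (apply Rinv_0_lt_compat, pow_lt; exact N0).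
  assert (Fp : 0 < / INR (fact nu)) by (apply Rinv_0_lt_compat, INR_fact_pos).
  assert (W0 : 0 < W) by (unfold W; repeat apply Rmult_lt_0_compat; trivial).
  assert (Main : 4 / 2 ^ nu * W < Cmod (a 0%nat)).
  { rewrite Ha, Nat.mul_1_r. simpl INR. rewrite !Cmod_mult, !Cmod_R.
    pose proof (kloosterman_level m n' N HN Sq Gm) as KL. fold n in KL. rewrite KL, !Rmult_1_r.
    replace (X / 1 ^ 2) with X by field.
    pose proof (psi_main_term_gt nu X ltac:(unfold nu; lia) X0 HX) as P.
    assert (P4 : 0 < 4 / 2 ^ nu) by (apply Rdiv_lt_0_compat; [lra | apply pow_lt; lra]).
    assert (Pp : 0 < psi nu X).
    { eapply Rlt_trans; [|exact P]. now apply Rmult_lt_0_compat. }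
    rewrite !Rabs_pos_eq by lra. unfold W.
    replace (4 / 2 ^ nu * (Cmod D * / INR N ^ k * / INR (fact nu))) with
      (/ INR N ^ k * (Cmod D * (4 / 2 ^ nu * / INR (fact nu)))) by ring.
    apply Rmult_lt_compat_l; [exact Np|]. now apply Rmult_lt_compat_l. }
  (* Here [j = i + 2 = s]. The Kloosterman bound [s] leaves [s^(-nu)], of which [nu - 2] powers are
     bounded by those of [2] and two are kept for the telescoping series of sum [1]. *)
  assert (Rest : forall i, Cmod (a (S i)) <= 4 / 2 ^ nu * W * (/ (INR i + 1) - / (INR i + 2))).
  { intros i. rewrite Ha. rewrite !Cmod_mult, !Cmod_R.
    pose proof (pos_INR i) as I0.
    assert (Es : INR (S (S i)) = INR i + 2) by (rewrite !S_INR; ring).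
    rewrite Es. set (s := INR i + 2) in *.
    assert (S2 : 2 <= s) by (unfold s; lra).
    pose proof (kloosterman_bound m n' N (S (S i)) HN Sq Gm ltac:(lia)) as Kb. rewrite Es in Kb. fold n in Kb.
    assert (Xs : 0 <= X / s ^ 2 <= X).
    { assert (1 <= s ^ 2) by nra. split; [apply Rdiv_le_0_compat; lra|].
      apply Rle_div_l; nra. }
    destruct (psi_bounds (X / s ^ 2) nu) as [[P1 P2] _]; [lra | |].
    { pose proof (pos_INR nu). nra. }
    assert (Ip : 0 < / (INR N * s) ^ k) by (apply Rinv_0_lt_compat, pow_lt; nra).
    rewrite !Rabs_pos_eq by lra.
    apply Rle_trans with (/ (INR N * s) ^ k * s * (Cmod D * / INR (fact nu))).
    - pose proof (Cmod_ge_0 (kloosterman m n (N * S (S i)))).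
      apply Rmult_le_compat.
      + apply Rmult_le_pos; lra.
      + apply Rmult_le_pos; lra.
      + apply Rmult_le_compat_l; lra.
      + apply Rmult_le_compat_l; lra.
    - assert (Ek : / (INR N * s) ^ k * s = / INR N ^ k * (/ s ^ (nu - 2) * / s ^ 2)).
      { assert (Pk : forall x : R, x ^ k = x * (x ^ (nu - 2) * x ^ 2)).
        { intros x. rewrite <- pow_add, tech_pow_Rmult. f_equal. unfold nu. lia. }
        rewrite !Pk, Rpow_mult_distr. field.
        repeat split; try apply pow_nonzero; lra. }
      rewrite Ek. unfold W.
      assert (E2 : 4 / 2 ^ nu = / 2 ^ (nu - 2)).
      { replace nu with (nu - 2 + 2)%nat at 1 by (unfold nu; lia).
        rewrite pow_add. field. apply pow_nonzero. lra. }
      rewrite E2.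
      assert (B1 : / s ^ (nu - 2) <= / 2 ^ (nu - 2)).
      { apply Rinv_le_contravar; [apply pow_lt; lra|]. apply pow_incr. lra. }
      assert (B2 : / s ^ 2 <= / (INR i + 1) - / (INR i + 2)).
      { replace (/ (INR i + 1) - / (INR i + 2)) with (/ ((INR i + 1) * (INR i + 2))) by (field; lra).
        apply Rinv_le_contravar; unfold s; nra. }
      assert (B3 : / s ^ (nu - 2) * / s ^ 2 <= / 2 ^ (nu - 2) * (/ (INR i + 1) - / (INR i + 2))).
      { apply Rmult_le_compat; trivial; left; apply Rinv_0_lt_compat, pow_lt; lra. }
      apply Rmult_le_compat_l with (r := / INR N ^ k * (Cmod D * / INR (fact nu))) in B3.
      + fold s in B3. eapply Rle_trans; [|eapply Rle_trans; [exact B3|]]; right; ring.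
      + left. repeat apply Rmult_lt_0_compat; trivial. }
  assert (Lim : Clim (fun M => csum (fun i => a (S i)) (seq 0 M)) (RtoC 0 - a 0%nat)%C).
  { apply Clim_ext with (u := fun M => (csum a (seq 0 (S M)) + (- a 0%nat))%C).
    - intros M. simpl seq. simpl csum. rewrite <- seq_shift, csum_map. ring.
    - apply Clim_plus; [|apply Clim_const].
      apply (Clim_subseq (fun M => csum a (seq 0 M)) (RtoC 0) S); [intros; lia | exact L]. }
  assert (C0 : Cmod (RtoC 0 - a 0%nat)%C <= 4 / 2 ^ nu * W).
  { eapply Clim_Cmod_le; [exact Lim|]. intros M.
    eapply Rle_trans.
    - apply (csum_Cmod_le_Series _ _ M Rest).
      apply (ex_series_scal_l (4 / 2 ^ nu * W) (fun i => / (INR i + 1) - / (INR i + 2))).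
      eexists. apply is_series_telescope.
    - rewrite Series_scal_l, (is_series_unique _ _ is_series_telescope). lra. }
  replace (RtoC 0 - a 0%nat)%C with (- a 0%nat)%C in C0 by ring.
  rewrite Cmod_opp in C0. lra.
Qed.

Lemma pcoef_zero k m N n : (forall x, Poincare k m N (x, 1) = RtoC 0) -> pcoef k m N n = RtoC 0.
Proof.
  intros H. change (pcoef k m N n) with
      (CInt (fun x => Poincare k m N (x, 1) * e (RtoC (- INR n) * (x, 1)%R))%C 0 1).
  apply CInt_zero; [lra|]. intros x _. rewrite H. ring.
Qed.

Theorem theorem5 :
  exists Cst : R, 0 < Cst /\
    forall N : nat, (1 <= N)%nat -> squarefree N ->
    forall k : nat, Nat.Even k -> Cst * Rmax 1 (INR (omega N)) <= INR k ->
    forall m : nat, (1 <= m)%nat ->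
      INR m <= INR N * (INR k - 1) ^ 2 / (32 * PI ^ 2) ->
      Nat.gcd m N = 1%nat ->
      (exists n : nat, (1 <= n <= 2 * N)%nat /\ pcoef k m N n <> RtoC 0) /\
      (exists z : C, 0 < Im z /\ Poincare k m N z <> RtoC 0).
Proof.
  (* The requirement comes from [m = N = 1] with [n = 2]: [8 pi^2 <= (k-1)^2 / 8], that is
     [k - 1 >= 8 pi], hence [k - 1 >= 32] when [pi] is bounded by [4]. *)
  exists 40. split; [lra|]. intros N HN Sq k He Hk m Hm HX Gm.
  assert (K40 : 40 <= INR k) by (pose proof (Rmax_l 1 (INR (omega N))); lra).
  assert (K40' : (40 <= k)%nat) by (apply INR_le; simpl; lra).
  assert (Ek : INR (k - 1) = INR k - 1) by (rewrite minus_INR by lia; reflexivity).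
  assert (N0 : 0 < INR N) by (apply lt_0_INR; lia).
  pose proof PI_RGT_0 as Pi0. pose proof PI_4 as Pi4.
  assert (Ex : exists n', (1 <= n' <= 2)%nat /\ pcoef k m N (N * n') <> RtoC 0).
  { destruct (Nat.eq_dec m N) as [E|E].
    (* Coprimality and [m = N] force [N = 1]; then [n = N] would meet the diagonal term, so [n = 2]
       is taken. *)
    - subst m. rewrite Nat.gcd_diag in Gm. subst N. exists 2%nat. split; [lia|].
      apply pcoef_nonzero; trivial; try lia.
      rewrite Ek. simpl INR. nra.
    - exists 1%nat. split; [lia|].
      apply pcoef_nonzero; trivial; try lia.
      rewrite Ek. simpl (INR 1). rewrite Rmult_1_r. apply Rle_div_l; [exact N0|].
      apply Rle_div_r in HX; [|nra]. lra. }
  destruct Ex as [n' [Hn' Hp]]. split.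
  - exists (N * n')%nat. split; [nia | exact Hp].
  (* A series vanishing on the line of height one has all coefficients zero, so a point with nonzero
     value is found on that line. *)
  - destruct (excluded_middle_informative (forall x, Poincare k m N (x, 1) = RtoC 0)) as [H|H].
    + exfalso. now apply Hp, pcoef_zero.
    + apply Classical_Pred_Type.not_all_ex_not in H. destruct H as [x Hx].
      exists (x, 1). split; [simpl; lra | exact Hx].
Qed.
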